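(* Let $f$, $u_0$ satisfy the regularity assumption (R) of the context with exponent $\sigma\in[0,1]$, and let $(\Omega,\mathcal F,(\mathcal F_n)_{n},\mathbb P)$ and $(\xi_n)_{n\ge 1}$ satisfy the randomness assumption (X) of the context. Let $u$ be the exact solution, $(u^n)_{n=0}^N$ the approximation by the randomized SDIRK scheme $u^{n+1}=\Phi(t_n,h,\xi_{n+1},u^n)$, $u^0=u_0$, and $e_n=u(t_n)-u^n$. Then there are a constant $C_2>0$ depending only on $\nu$ and $h_{\max}$, and a constant $C>0$, which depends on $M_{\mathrm{exact}}$ and $M_{\mathrm{apriori}}$ and is independent of the discretization parameters $h$, $N$, $n$, such that $$\mathbb E\big[\|e_{n+1}\|^2\big]\le h^{4+4\min(\sigma,\frac14)}\,C\,\exp(C_2T)$$ for all $n\in\{1,\dots,N-1\}$ and all $h=\frac TN$, $N\in\mathbb N$, with $h\in(0,h_{\max}]$.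
   Context: Let $d\in\mathbb N$, $T\in(0,\infty)$, $u_0\in\mathbb R^d$, $f:[0,T]\times\mathbb R^d\to\mathbb R^d$. $\langle\cdot,\cdot\rangle$ and $\|\cdot\|$ are the Euclidean inner product and norm (and induced matrix and tensor norms). (R) $f$ admits weak partial derivatives up to order two in $(t,v)\in[0,T]\times\mathbb R^d$, and: (a) there is $\nu\in\mathbb R$ with $\langle f(t,v)-f(t,w),v-w\rangle\le\nu\|v-w\|^2$ for all $t\in[0,T]$, $v,w\in\mathbb R^d$; (b) for every $\kappa>0$ there is an $L^2$-integrable $\gamma_\kappa:[0,T]\to\mathbb R\cup\{+\infty\}$ with $\|f_{\alpha}(t,v)\|\le\gamma_\kappa(t)$ for every multi-index $\alpha=(\alpha_0,\dots,\alpha_d)$ of order two, every $t\in[0,T]$ and every $\|v\|\le\kappa$, where $f_\alpha=\partial_0^{\alpha_0}\cdots\partial_d^{\alpha_d}f$ and index $0$ refers to the time variable; (c) there is $\sigma\in[0,1]$ such that for every $\kappa>0$ there is an $L^2$-integrable $L_\kappa:[0,T]\to\mathbb R\cup\{+\infty\}$ with $\|f_\alpha(t,v)-f_\alpha(t,w)\|\le L_\kappa(t)\|v-w\|^\sigma$ for every multi-index $\alpha$ of order two, $t\in[0,T]$, $\|v\|,\|w\|\le\kappa$. Mappings are not distinguished from their equivalence classes; $f$ and its first-order derivatives are identified with their continuous representatives. $u$ is the unique solution of $u'(t)=f(t,u(t))$ on $(0,T)$, $u(0)=u_0$. (X) $(\Omega,\mathcal F,(\mathcal F_n)_n,\mathbb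 P)$ is a complete filtered probability space and $(\xi_n)_{n\ge1}$ is a family of independent random variables, uniformly distributed on $[\frac12,1]$, such that $\xi_n$ is $\mathcal F_n$-measurable and independent of $\mathcal F_{n-1}$. $h_{\max}=\min\{\alpha,T\}$ for a fixed $\alpha\in(0,\nu^{-1})$ if $\nu>0$, and $h_{\max}=T$ if $\nu\le0$. Grid: $h=T/N$, $t_n=nh$. One-step operator: $\Phi(t,h,x,v)=v+\frac h2(k^1+k^2)$, where $k^1,k^2\in\mathbb R^d$ are the solutions of $k^1=f(t+hx,v+hxk^1)$ and $k^2=f(t+h(1-x),v+h(1-2x)k^1+hxk^2)$. $M_{\mathrm{exact}}=e^{T\max(\nu,0)}\|u_0\|+\int_0^Te^{(T-\tau)\max(\nu,0)}\|f(\tau,0)\|\,d\tau$, a bound for $\|u(t)\|$ on $[0,T]$. $M_{\mathrm{apriori}}$ is a constant with $\|u^n(\omega)\|\le M_{\mathrm{apriori}}$ for all $n\in\{0,\dots,N\}$, $\omega\in\Omega$ and all $h=T/N\in(0,h_{\max}]$. *)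

(* Defs.v *)
From HB Require Import structures.
From mathcomp Require Import all_boot all_order all_algebra.
From mathcomp Require Import all_classical all_reals all_analysis.
From mathcomp Require Import measurable_realfun.
Set Implicit Arguments.
Unset Strict Implicit.
Unset Printing Implicit Defensive.
Import Order.TTheory GRing.Theory Num.Theory.
Import numFieldNormedType.Exports.
Local Open Scope classical_set_scope.
Local Open Scope ring_scope.

Section euclidean.
Context {R : realType} {n : nat}.
Implicit Types v w : 'rV[R]_n.

(* The library norm of ['rV[R]_n] is the maximum norm. *)
Definition edot v w : R := \sum_(i < n) v 0 i * w 0 i.
Definition enorm v : R := Num.sqrt (edot v v).

End euclidean.

Section lebesgue_measure_on_tuples.
Context {R : realType}.

Definition tuple_cons n (p : R * n.-tuple R) : n.+1.-tuple R :=
  [the n.+1.-tuple R of p.1 :: p.2].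

Lemma measurable_tuple_cons n :
  measurable_fun [set: R * n.-tuple R] (@tuple_cons n).
Proof. by apply: measurable_cons. Qed.

Definition tuple_uncons n (x : n.+1.-tuple R) : R * n.-tuple R :=
  (tnth x ord0, [tuple of behead x]).

Lemma measurable_tuple_uncons n :
  measurable_fun [set: n.+1.-tuple R] (@tuple_uncons n).
Proof.
by apply: measurable_fun_pair; [exact: measurable_tnth|exact: measurable_behead].
Qed.

Lemma tuple_consK n : cancel (@tuple_cons n) (@tuple_uncons n).
Proof. by case=> a x; apply/pair_equal_spec; split => //; apply/val_inj. Qed.

Section step.
Context {n : nat} (mu : {sigma_finite_measure set (n.-tuple R) -> \bar R}).

Definition measure_cons : set (n.+1.-tuple R) -> \bar R :=
  pushforward (lebesgue_measure \x mu)%E (@tuple_cons n).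

Let measure_cons0 : measure_cons set0 = 0%E.
Proof. by rewrite /measure_cons /pushforward preimage_set0 measure0. Qed.

Let measure_cons_ge0 A : (0 <= measure_cons A)%E.
Proof. by rewrite /measure_cons /pushforward; exact: measure_ge0. Qed.

Let measure_cons_sigma_additive : semi_sigma_additive measure_cons.
Proof.
move=> F mF tF mUF; rewrite /measure_cons /pushforward preimage_bigcup.
have mpre A : measurable A -> measurable (@tuple_cons n @^-1` A).
  by move=> mA; rewrite -[X in measurable X]setTI; exact: measurable_tuple_cons.
apply: measure_semi_sigma_additive.
- by move=> k; exact: mpre.
- apply/trivIsetP => /= i j _ _ ij; rewrite -preimage_setI.
  by move/trivIsetP : tF => /(_ _ _ _ _ ij) ->//; rewrite preimage_set0.
- by rewrite -preimage_bigcup; exact: mpre.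
Qed.

HB.instance Definition _ := isMeasure.Build _ _ _ measure_cons
  measure_cons0 measure_cons_ge0 measure_cons_sigma_additive.

Let measure_cons_sigma_finite : sigma_finite [set: n.+1.-tuple R] measure_cons.
Proof.
have /sigma_finiteP[F [TF ndF Foo]] := sigma_finiteT (@lebesgue_measure R).
have /sigma_finiteP[G [TG ndG Goo]] := sigma_finiteT mu.
exists (fun k => @tuple_uncons n @^-1` (F k `*` G k)).
  rewrite -preimage_bigcup -[LHS](preimage_setT (@tuple_uncons n)).
  congr (_ @^-1` _); rewrite -setXTT TF TG predeqE => -[x y]; split.
    move=> [/= [i _ Fix] [k _ Gky]]; exists (maxn i k) => //; split.
    - by move: x Fix; exact/subsetPset/ndF/leq_maxl.
    - by move: y Gky; exact/subsetPset/ndG/leq_maxr.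
  by move=> [i _ []/= ? ?]; split; exists i.
move=> k; have [mFk Fk] := Foo k; have [mGk Gk] := Goo k; split.
  rewrite -[X in measurable X]setTI; apply: measurable_tuple_uncons => //.
  exact: measurableX.
rewrite /measure_cons /pushforward -comp_preimage.
rewrite (_ : _ \o _ = id) ?preimage_id; last first.
  by apply/funext => p; exact: tuple_consK.
by rewrite product_measure1E// lte_mul_pinfty// ge0_fin_numE.
Qed.

HB.instance Definition _ := Measure_isSigmaFinite.Build _ _ _ measure_cons
  measure_cons_sigma_finite.

End step.

(* The library has no Lebesgue measure on [R^n]: it is obtained here by iterating
   binary products, transported along [tuple_cons]. *)
Fixpoint lebesgue_tuple n : {sigma_finite_measure set (n.-tuple R) -> \bar R} :=
  if n is n'.+1 then measure_cons (lebesgue_tuple n') else dirac [tuple].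

End lebesgue_measure_on_tuples.

Section weak_derivatives.
Context {R : realType} {n : nat}.
Implicit Types (phi g : 'rV[R]_n -> R) (alpha : 'I_n -> nat).

Definition rv_of (z : n.-tuple R) : 'rV[R]_n := \row_i tnth z i.

Definition partial (i : 'I_n) phi : 'rV[R]_n -> R :=
  fun x => 'D_(delta_mx 0 i) phi x.

Definition morder alpha : nat := \sum_(i < n) alpha i.

Definition mpartial alpha phi : 'rV[R]_n -> R :=
  foldr (fun i psi => iter (alpha i) (partial i) psi) phi (enum 'I_n).

Definition smooth phi : Prop := forall s : seq 'I_n,
  continuous (foldr partial phi s) /\
  forall (i : 'I_n) (x : 'rV[R]_n), derivable (foldr partial phi s) x (delta_mx 0 i).

Definition test_function (U : set 'rV[R]_n) phi : Prop :=
  let supp := closure [set x | phi x != 0] in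
  [/\ smooth phi, compact supp & supp `<=` U].

Definition L1loc (U : set 'rV[R]_n) g : Prop :=
  forall K : set 'rV[R]_n, compact K -> K `<=` U ->
    (lebesgue_tuple n).-integrable (rv_of @^-1` K) (EFin \o (g \o rv_of)).

Definition weak_derivative (U : set 'rV[R]_n) alpha g galpha : Prop :=
  [/\ L1loc U g, L1loc U galpha & forall phi, test_function U phi ->
    \int[lebesgue_tuple n]_(z in rv_of @^-1` U)
      (g (rv_of z) * mpartial alpha phi (rv_of z)) =
    (-1) ^+ morder alpha *
    \int[lebesgue_tuple n]_(z in rv_of @^-1` U)
      (galpha (rv_of z) * phi (rv_of z))].

End weak_derivatives.

Section assumption_R.
Context {R : realType} {d : nat} (T : R).

(* A point of space-time is a vector of length [1 + d] whose coordinate of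
   index 0 is the time. *)
Definition on_spacetime (f : R -> 'rV[R]_d -> 'rV[R]_d) (z : 'rV[R]_(1 + d)) :
  'rV[R]_d := f (lsubmx z 0 0) (rsubmx z).

Definition open_cylinder : set 'rV[R]_(1 + d) :=
  [set z | 0 < lsubmx z 0 0 < T].

Definition closed_cylinder : set 'rV[R]_(1 + d) :=
  [set z | 0 <= lsubmx z 0 0 <= T].

Definition is_weak_derivative (f : R -> 'rV[R]_d -> 'rV[R]_d)
    (alpha : 'I_(1 + d) -> nat) (falpha : R -> 'rV[R]_d -> 'rV[R]_d) : Prop :=
  forall j : 'I_d, weak_derivative open_cylinder alpha
    (fun z => on_spacetime f z 0 j) (fun z => on_spacetime falpha z 0 j).

Definition L2_Rplusoo (g : R -> \bar R) : Prop :=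
  [/\ measurable_fun `[0, T] g,
      forall t : R, t \in `[0, T] -> g t != -oo%E &
      (\int[lebesgue_measure]_(t in `[0%R, T]) (g t ^+ 2) < +oo)%E].

(* [Df alpha] is a fixed representative of the weak derivative of index [alpha];
   [f] and the [Df alpha] of order one are the continuous representatives.
   The bounds hold at every point, the exceptional times being those where
   [gamma] or [L] is infinite; [0 `^ 0 = 1] is harmless in the Hoelder bound,
   whose left-hand side vanishes for [v = w]. *)
Definition assumption_R (nu sigma : R) (f : R -> 'rV[R]_d -> 'rV[R]_d) : Prop :=
  {within closed_cylinder, continuous (on_spacetime f)} /\
  exists Df : ('I_(1 + d) -> nat) -> R -> 'rV[R]_d -> 'rV[R]_d,
  [/\ forall alpha, (1 <= morder alpha <= 2)%N ->
        is_weak_derivative f alpha (Df alpha),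
      forall alpha, morder alpha = 1%N ->
        {within closed_cylinder, continuous (on_spacetime (Df alpha))},
      forall (t : R) v w, t \in `[0, T] ->
        edot (f t v - f t w) (v - w) <= nu * enorm (v - w) ^+ 2,
      forall kappa : R, 0 < kappa -> exists gamma, L2_Rplusoo gamma /\
        forall alpha (t : R) v, morder alpha = 2%N -> t \in `[0, T] ->
          enorm v <= kappa ->
          ((enorm (Df alpha t v))%:E <= gamma t)%E &
      0 <= sigma <= 1 /\
      forall kappa : R, 0 < kappa -> exists L, L2_Rplusoo L /\
        forall alpha (t : R) v w, morder alpha = 2%N -> t \in `[0, T] ->
          enorm v <= kappa -> enorm w <= kappa ->
          ((enorm (Df alpha t v - Df alpha t w))%:E <=
            L t * (enorm (v - w) `^ sigma)%:E)%E].

Definition is_solution (f : R -> 'rV[R]_d -> 'rV[R]_d) (u0 : 'rV[R]_d)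
    (u : R -> 'rV[R]_d) : Prop :=
  [/\ u 0 = u0, {within `[0, T], continuous u} &
      forall t : R, t \in `]0, T[ -> is_derive t 1 u (f t (u t))].

Definition Mexact (nu : R) (f : R -> 'rV[R]_d -> 'rV[R]_d) (u0 : 'rV[R]_d) : R :=
  expR (T * Num.max nu 0) * enorm u0 +
  \int[lebesgue_measure]_(tau in `[0, T])
    (expR ((T - tau) * Num.max nu 0) * enorm (f tau 0)).

(* [a] only matters when [0 < nu]. *)
Definition hmax (nu a : R) : R := if 0 < nu then Num.min a T else T.

End assumption_R.

Section scheme.
Context {R : realType} {d : nat} (f : R -> 'rV[R]_d -> 'rV[R]_d).

(* [get] picks a solution of the implicit stage equation (unique when
   [h * x * nu < 1]), and an arbitrary vector if there is none. *)
Definition stage1 (t h x : R) (v : 'rV[R]_d) : 'rV[R]_d :=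
  get [set k | k = f (t + h * x) (v + (h * x) *: k)].

Definition stage2 (t h x : R) (v : 'rV[R]_d) : 'rV[R]_d :=
  get [set k | k = f (t + h * (1 - x))
                     (v + (h * (1 - 2 * x)) *: stage1 t h x v + (h * x) *: k)].

Definition Phi (t h x : R) (v : 'rV[R]_d) : 'rV[R]_d :=
  v + (h / 2) *: (stage1 t h x v + stage2 t h x v).

(* The step from index [n] to [n.+1] uses the random variable of index [n.+1];
   [x 0] is never used. *)
Fixpoint sdirk (u0 : 'rV[R]_d) (h : R) (x : nat -> R) (n : nat) : 'rV[R]_d :=
  if n is m.+1 then Phi (m%:R * h) h (x m.+1) (sdirk u0 h x m) else u0.

End scheme.

Section assumption_X.
Context {R : realType} {disp : measure_display} {Om : measurableType disp}.
Variable P : probability Om R.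

Definition complete_filtration (F : nat -> set (set Om)) : Prop :=
  [/\ forall n, sigma_algebra setT (F n),
      forall n, F n `<=` measurable,
      forall n, F n `<=` F n.+1 &
      forall A, P.-negligible A -> F 0%N A].

Lemma half_lt1 : 2^-1 < 1 :> R.
Proof. by rewrite invf_lt1 ?ltr1n ?ltr0n. Qed.

Definition assumption_X (F : nat -> set (set Om)) (xi : nat -> {RV P >-> R}) : Prop :=
  complete_filtration F /\
  [/\ forall (s : seq nat) (B : nat -> set R), uniq s -> all (leq 1) s ->
        (forall i, measurable (B i)) ->
        P (\bigcap_(i in [set` s]) (xi i @^-1` B i)) =
        (\prod_(i <- s) P (xi i @^-1` B i))%E,
      forall n (B : set R), measurable B ->
        P (xi n.+1 @^-1` B) = uniform_prob half_lt1 B,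
      forall n (B : set R), measurable B -> F n.+1 (xi n.+1 @^-1` B) &
      forall n A (B : set R), F n A -> measurable B ->
        P (A `&` xi n.+1 @^-1` B) = (P A * P (xi n.+1 @^-1` B))%E].

End assumption_X.

(* Main.v *)
Require Import Defs.
From HB Require Import structures.
From mathcomp Require Import all_boot all_order all_algebra.
From mathcomp Require Import all_classical all_reals all_analysis.
From mathcomp Require Import measurable_realfun.
From mathcomp Require Import ring lra.

(** Let [e n] be the error after [n] steps.  During a step from [a] to [a + h] it is
    perturbed by [O(h) |e n|], as one step of the scheme is a Lipschitz perturbation
    of the identity ([Phi_lipschitz]), and by the local error at the exact solution.

    The second derivatives of [f] are dominated, on bounded sets, by a square-integrable
    function [gamma] of time.  Hence on the window of the step [f] is affine up to the
    factor [eps], which is about the square root of [h] times the integral of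
    [gamma ^ 2] over the window ([regularity]).  Expanding the solution and the two
    stages with this accuracy ([local_error_bound]) leaves a term of size [eps h ^ 3]
    and the term [unbiased_part], of size [eps h ^ 2].  The latter consists of the
    error of the quadrature of [u'] with nodes [a + h x] and [a + h (1 - x)], and of a
    multiple of [3 x - 3 x ^ 2 - 1 / 2].  When [x] runs over [1/2, 1] the nodes cover
    the step exactly once and the polynomial has mean zero, so that [unbiased_part] is
    centered ([quadrature_defect_centered]).  It depends on the new sample only, which
    is independent of [e n]; in the mean of [|e (n + 1)| ^ 2] its product with [e n]
    disappears ([independent_centered]), and what remains is
      [E |e (n + 1)| ^ 2 <= (1 + G h) E |e n| ^ 2 + H h ^ 4 eps n ^ 2]
    ([mean_square_step]).  The squares [eps n ^ 2] add up to [O(h)], as the integrals of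
    [gamma ^ 2] over the windows add up, and a discrete Gronwall argument yields the
    bound [O(h ^ 5)] ([mean_square_small]).  The exponent of the theorem is at most 5,
    and the steps bounded below only require the boundedness of the errors.

    Two points need care.  The derivatives of order two exist only in the weak sense and
    are bounded at almost all times, by a function that is merely integrable.  Pointwise
    information comes from testing with products of bumps and plateaus of one variable,
    whose integrals factorize.  Increments in time need no kernel in time; for increments
    in space the kernel in time has the width of the window, and the increments in time
    compare the means with the values ([space_increment]).

    The scheme is implicit and [f] is only one-sided Lipschitz.  The solution and the
    iterates are bounded, so [f] can be clamped outside a large box; the clamped field is
    bounded and Lipschitz and its stages are given by Banach's theorem for small steps.
    They stay in the box, where they solve the original equations, whose solutions are
    unique by the one-sided bound ([Phi_truncated]).  Clamping also makes the iterates
    Lipschitz functions of the samples, hence measurable with respect to the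
    filtration. *)

Set Implicit Arguments.
Unset Strict Implicit.
Unset Printing Implicit Defensive.
Import Order.TTheory GRing.Theory Num.Theory.
Import numFieldNormedType.Exports.
Local Open Scope classical_set_scope.
Local Open Scope ring_scope.

(** * Smooth cut-off functions *)

Section bump.
Context {R : realType}.
Implicit Types (J : nat -> R -> R) (f : R -> R) (x y : R).

(** Smoothness as a given sequence of successive derivatives: no iterated
    derivative has to be computed. *)
Definition jet J := forall m x, is_derive x 1 (J m) (J m.+1 x).

(** Glues the derivatives of the bump to zero at the ends of its support. *)
Lemma is_derive_quadratic f x C :
  f x = 0 -> (forall y, `|f y| <= C * (y - x) ^+ 2) -> is_derive x 1 f 0.
Proof.
move=> fx0 fC.
suff cv : h^-1 *: (f (h *: (1 : R) + x) - f x) @[h --> (0:R)^'] --> (0 : R).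
  by constructor; [apply/cvg_ex; exists 0|exact/cvg_lim].
apply/cvgr0Pnorm_lt => e e0.
have C1 : 0 < `|C| + 1 by rewrite ltr_wpDl.
near=> h.
have h0 : h != 0 by near: h; exact: nbhs_dnbhs_neq.
rewrite fx0 subr0 normrZ normfV (_ : h *: (1 : R) = h); last by rewrite /GRing.scale /= mulr1.
apply: (@le_lt_trans _ _ ((`|C| + 1) * `|h|)).
  rewrite ler_pdivrMl ?normr_gt0//; apply: le_trans (fC _) _.
  rewrite addrK -(real_normK (num_real h)) [leRHS]mulrCA -expr2 ler_wpM2r ?sqr_ge0//.
  by rewrite (le_trans (ler_norm _)) // lerDl.
rewrite -ltr_pdivlMl//; near: h; apply: dnbhs0_lt.
by rewrite mulr_gt0 ?invr_gt0.
Unshelve. all: by end_near. Qed.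

(** The derivative of order [m] of [exp (- 1 / (1 - x^2))] is the same exponential
    times [bump_poly m] over [(1 - x^2) ^ (2 m)]. *)
Fixpoint bump_poly (m : nat) : {poly R} :=
  if m is m'.+1 then
    (bump_poly m')^`() * (1 - 'X^2) ^+ 2
    + ((4 * m'%:R) *: ('X * (1 - 'X^2)) - 2 *: 'X) * bump_poly m'
  else 1.

Definition bump_jet m x : R :=
  if `|x| < 1 then
    (bump_poly m).[x] * (1 - x ^+ 2)^-1 ^+ m.*2 * expR (- (1 - x ^+ 2)^-1)
  else 0.

Lemma horner_bounded (p : {poly R}) :
  exists2 C, 0 <= C & forall x, `|x| <= 1 -> `|p.[x]| <= C.
Proof.
exists (\sum_(i < size p) `|p`_i|); first exact: sumr_ge0.
move=> x x1; rewrite horner_coef (le_trans (ler_norm_sum _ _ _))//.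
apply: ler_sum => i _; rewrite normrM ler_piMr// normrX exprn_ile1//.
Qed.

(** The exponential beats every power of the pole. *)
Lemma bump_jet_bound m : exists C : R, forall x, `|bump_jet m x| <= C * (1 - x ^+ 2) ^+ 2.
Proof.
have [C C0 pC] := horner_bounded (bump_poly m).
exists (C * (m.*2.+2)`!%:R) => x; rewrite /bump_jet.
case: ifPn => x1; last by rewrite normr0 mulr_ge0 ?sqr_ge0 ?mulr_ge0 ?ler0n.
have w0 : 0 < 1 - x ^+ 2.
  by rewrite subr_gt0 -real_normK ?num_real// expr_lt1.
set w := (1 - x ^+ 2)^-1; have wp : 0 < w by rewrite invr_gt0.
have -> : (1 - x ^+ 2) = w^-1 by rewrite /w invrK.
rewrite !normrM (gtr0_norm (expR_gt0 _)) (ger0_norm (exprn_ge0 _ (ltW wp))).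
rewrite -!mulrA ler_pM// ?mulr_ge0 ?exprn_ge0 ?expR_ge0 ?(ltW wp) ?pC ?(ltW x1)//.
rewrite expRN ler_pdivrMr ?expR_gt0// [w^-1 ^+ 2]exprVn.
rewrite mulrAC ler_pdivlMr ?exprn_gt0// -exprD addn2.
rewrite mulrC -ler_pdivrMr ?ltr0n ?fact_gt0//.
by rewrite (le_trans _ (expR_ge1Dxn m.*2.+1 (ltW wp)))// lerDr.
Qed.

Lemma bump_jet_out m x : 1 <= `|x| -> bump_jet m x = 0.
Proof. by rewrite /bump_jet ltNge => ->. Qed.

Lemma bump_jetP : jet bump_jet.
Proof.
move=> m x; have [x1|x1] := ltP `|x| 1; last first.
  rewrite (bump_jet_out m.+1)//.
  have [C bC] := bump_jet_bound m.
  have C0 : 0 <= C.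
    have := bC 0; rewrite expr0n subr0 expr1n mulr1; exact: le_trans.
  apply: (@is_derive_quadratic _ _ (4 * C)); first exact: bump_jet_out.
  move=> y; have [y1|y1] := leP 1 `|y|.
    by rewrite bump_jet_out// normr0 mulr_ge0 ?sqr_ge0 ?mulr_ge0 ?ler0n.
  apply: le_trans (bC y) _; rewrite (mulrC 4) -mulrA ler_wpM2l//.
  have -> : 4 * (y - x) ^+ 2 = `|2 * (y - x)| ^+ 2.
    by rewrite real_normK ?num_real// exprMn; congr (_ * _); ring.
  rewrite ler_sqr ?nnegrE ?normr_ge0//; last first.
    by rewrite subr_ge0 -real_normK ?num_real// expr_le1// ltW.
  rewrite normrM (ger0_norm (ler0n _ 2)).
  have -> : 1 - y ^+ 2 = (1 - `|y|) * (1 + `|y|).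
    by rewrite -(real_normK (num_real y)); ring.
  rewrite mulrC; apply: ler_pM; [by rewrite addr_ge0|by rewrite subr_ge0 ltW| |].
    by rewrite -[2]/(1 + 1) lerD2l ltW.
  by rewrite distrC (le_trans _ (lerB_dist x y))// lerB.
have w0 : 1 - x ^+ 2 != 0.
  by rewrite gt_eqF// subr_gt0 -real_normK ?num_real// expr_lt1.
pose V := (fun y => (1 - y ^+ 2)^-1) : R -> R.
have dV : is_derive x 1 V (2 * x * V x ^+ 2).
  have h : is_derive x 1 (fun y : R => 1 - y ^+ 2) (- (2 * x)).
    by apply: is_derive_eq; rewrite /GRing.scale /= ; ring.
  apply: (@is_derive_eq _ _ _ _ _ _ _ _ (is_deriveV _ h)) => //.
  by rewrite /V /GRing.scale /= exprVn; ring.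
have dE : is_derive x 1 (fun y => expR (- V y)) (expR (- V x) * - (2 * x * V x ^+ 2)).
  apply: (@is_derive1_comp R expR (fun y => - V y)).
have dX : is_derive x 1 (fun y => V y ^+ m.*2) (m.*2%:R * V x ^+ m.*2.-1 * (2 * x * V x ^+ 2)).
  have -> : (fun y => V y ^+ m.*2) = V ^+ m.*2 by apply/funext => y; rewrite fctE.
  exact: (@is_deriveX _ _ V).
apply: (@near_eq_is_derive _ _ _ (fun y => (bump_poly m).[y] * V y ^+ m.*2 * expR (- V y))).
  near=> y; rewrite /bump_jet ifT//; near: y.
  by apply: (cvgr_lt `|x|) => //; exact: norm_continuous.
apply: (@is_derive_eq _ _ _ _ _ _ _ _ (is_deriveM (is_deriveM (is_derive_poly _ x) dX) dE)).
rewrite /bump_jet x1 doubleS -/(V x).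
have -> : (bump_poly m.+1).[x] = (bump_poly m)^`().[x] * (1 - x ^+ 2) ^+ 2 +
   (4 * m%:R * (x * (1 - x ^+ 2)) - 2 * x) * (bump_poly m).[x].
  by rewrite [bump_poly _]/= !hornerE /=; ring.
have -> : 1 - x ^+ 2 = (V x)^-1 by rewrite /V invrK.
have V0 : V x != 0 by rewrite /V invr_eq0.
rewrite fctE /GRing.scale [LHS]/=.
move: (V x) (expR _) (bump_poly m)^`().[x] (bump_poly m).[x] V0 => v E p' p v0.
case: m {dX} => [|m]; first by rewrite double0 !expr0 mul0r; field.
rewrite doubleS [m.*2.+2.-1]/= -muln2 !exprS -[(m * 2).+2]addn2 natrD natrM -natr1.
by field.
Unshelve. all: by end_near. Qed.

Lemma jet_continuous J m : jet J -> continuous (J m).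
Proof.
move=> jJ x; apply/differentiable_continuous/derivable1_diffP.
by have [] := jJ m x.
Qed.

Lemma bump_jet0_ge0 x : 0 <= bump_jet 0 x.
Proof. by rewrite /bump_jet; case: ifP => // _; rewrite double0 expr0 mulr1 hornerE mul1r expR_ge0. Qed.

Let F x : R := \int[lebesgue_measure]_(t in `]-oo, x]) bump_jet 0 t.

Let intb (A : set R) : measurable A -> lebesgue_measure.-integrable A (EFin \o bump_jet 0).
Proof.
move=> mA; apply: (@integrableS _ _ _ _ setT) => //.
have -> : EFin \o bump_jet 0 = (EFin \o bump_jet 0) \_ `[-1, 1].
  apply/funext => x; rewrite patchE /=; case: ifPn => //.
  rewrite notin_setE /= in_itv /= -ler_norml => /negP x1; congr _%:E.
  by rewrite bump_jet_out// ltW// ltNge.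
apply: (integrable_mkcond _ _).1 => //.
apply: continuous_compact_integrable; first exact: segment_compact.
by apply: continuous_subspaceT; apply: (jet_continuous bump_jetP).
Qed.

Let F_le x y : x <= y -> F x <= F y.
Proof.
move=> xy; rewrite /F Rintegral_mkcond [leRHS]Rintegral_mkcond.
have i z : lebesgue_measure.-integrable setT (EFin \o (bump_jet 0 \_ `]-oo, z])).
  by rewrite -restrict_EFin; apply: (integrable_mkcond _ _).1 => //; exact: intb.
apply: le_Rintegral => // z _; rewrite !patchE.
case: ifPn => [|_]; last by case: ifP => // _; exact: bump_jet0_ge0.
by rewrite !inE /= !in_itv /= => zx; rewrite ifT// inE /= in_itv /= (le_trans zx).
Qed.

Let F0 x : x <= -1 -> F x = 0.
Proof.
move=> x1; rewrite /F (@eq_Rintegral _ _ _ _ _ (cst 0)) ?Rintegral_cst ?mul0r//.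
move=> y; rewrite inE /= in_itv /= => yx; rewrite bump_jet_out//.
by rewrite ler_normr orbC lerNr (le_trans yx).
Qed.

Let F1 x : 1 <= x -> F x = F 1.
Proof.
move=> x1; rewrite /F Rintegral_mkcond [RHS]Rintegral_mkcond.
congr (\int[_]_(_ in _) _); apply/funext => y; rewrite !patchE !mem_setE !in_itv /=.
have [y1|y1] := leP y 1; first by rewrite (le_trans y1).
by case: ifP => // _; rewrite bump_jet_out// ler_normr (ltW y1).
Qed.

Let Fgt0 : 0 < F 1.
Proof.
pose A := [set` `[-2^-1, 2^-1] : interval R].
have le : \int[lebesgue_measure]_(t in A) expR (- 2) <= F 1 :> R.
  rewrite Rintegral_mkcond /F [leRHS]Rintegral_mkcond; apply: le_Rintegral => //.
  - rewrite -restrict_EFin; apply: (integrable_mkcond _ _).1 => //.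
      by rewrite /A; exact: measurable_itv.
    rewrite /A; apply: continuous_compact_integrable;
      [exact: segment_compact|apply: continuous_subspaceT => ?; exact: cvg_cst].
  - by rewrite -restrict_EFin; apply: (integrable_mkcond _ _).1 => //; exact: intb.
  - move=> x _; rewrite !patchE; case: ifPn => [|_]; last first.
      by case: ifP => // _; exact: bump_jet0_ge0.
    rewrite inE /A /= in_itv /= -ler_norml => x2.
    have x1 : `|x| < 1 by rewrite (le_lt_trans x2)// invf_lt1 ?ltr1n.
    rewrite mem_setE in_itv /= (le_trans (ler_norm x) (ltW x1)).
    rewrite /bump_jet x1 double0 expr0 mulr1 hornerE mul1r ler_expR lerN2.
    have h : x ^+ 2 <= 4^-1.
      rewrite -real_normK ?num_real// (le_trans (lerXn2r 2 _ _ x2)) ?nnegrE//.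
      by rewrite exprVn -natrX.
    by rewrite -[leRHS]invrK lef_pV2 ?posrE ?invr_gt0//; lra.
apply: lt_le_trans le.
rewrite /A Rintegral_cst; last exact: measurable_itv.
rewrite [X in fine X]lebesgue_measure_itv /= ifT; last first.
  by rewrite lte_fin; lra.
by rewrite -EFinD /= mulr_gt0 ?expR_gt0//; lra.
Qed.

Let dF x : is_derive x 1 F (bump_jet 0 x).
Proof.
have [] := @continuous_FTC1 R (bump_jet 0) (BInfty R true) x (x + 1).
- by rewrite ltrDl.
- exact: intb.
- by rewrite ltNyr.
- exact: (jet_continuous bump_jetP).
- by move=> d; rewrite derive1E => e; split.
Qed.

(** The derivatives of a smooth step that climbs from 0 to 1 across [-1, 1] with
    slope at most [M]. *)
Definition step_jet (S : nat -> R -> R) (M : R) :=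
  [/\ jet S, forall x, x <= -1 -> S 0%N x = 0, forall x, 1 <= x -> S 0%N x = 1,
      forall x, 0 <= S 0%N x <= 1 &
      (forall m x, 1 <= `|x| -> S m.+1 x = 0) /\
      forall x, 0 <= S 1%N x <= M].

Lemma step_jet_exists : exists S M, step_jet S M.
Proof.
pose S m := if m is m'.+1 then fun x => (F 1)^-1 * bump_jet m' x
            else fun x => (F 1)^-1 * F x.
have [C bC] := bump_jet_bound 0.
have C0 : 0 <= C.
  have := bC 0; rewrite expr0n subr0 expr1n mulr1; exact: le_trans.
exists S, ((F 1)^-1 * C); split.
- case=> [|m] x.
    have := dF x => d; exact: is_derive_eq.
  have := bump_jetP m x => d; exact: is_derive_eq.
- by move=> x x1; rewrite /S (F0 x1) mulr0.
- by move=> x x1; rewrite /S (F1 x1) mulVf// gt_eqF.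
- move=> x; have h : 0 <= F x <= F 1.
    apply/andP; split.
      by have [/F0->//|/ltW/F_le] := leP x (-1); rewrite (F0 (lexx _)).
    by have [/F1->//|/ltW/F_le] := leP 1 x.
  by rewrite /S mulr_ge0 ?invr_ge0 ?(ltW Fgt0)//= ?ler_pdivrMl ?mulr1//; case/andP: h.
- split; first by move=> m x x1; rewrite /S bump_jet_out ?mulr0.
  move=> x; rewrite /S mulr_ge0 ?invr_ge0 ?(ltW Fgt0) ?bump_jet0_ge0//=.
  rewrite ler_wpM2l ?invr_ge0 ?(ltW Fgt0)// (le_trans (ler_norm _))//.
  have [x1|x1] := leP 1 `|x|; first by rewrite bump_jet_out// normr0.
  have h1 : 0 <= 1 - x ^+ 2.
    by rewrite subr_ge0 -real_normK ?num_real// expr_le1// ltW.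
  by rewrite (le_trans (bC x))// ler_piMr// expr_le1// lerBlDr lerDl sqr_ge0.
Qed.

End bump.

Section cutoffs.
Context {R : realType}.
Implicit Types (c k eps x : R).
Local Notation leb := (@lebesgue_measure R).
Context (S : nat -> R -> R) (M : R) (hS : step_jet S M).

(** The slope of the step rescaled to width [eps]: an approximate unit mass at
    [c]. *)
Definition bump c eps (m : nat) x : R := eps^-1 ^+ m.+1 * S m.+1 ((x - c) / eps).

(** A primitive of the difference of the bumps at [c] and [c + k]: testing a weak
    derivative against it compares two local means. *)
Definition plateau c k eps (m : nat) x : R :=
  eps^-1 ^+ m * (S m ((x - c) / eps) - S m ((x - (c + k)) / eps)).

Let dS c eps m x : is_derive x 1 (fun x => S m ((x - c) / eps)) (eps^-1 * S m.+1 ((x - c) / eps)).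
Proof.
have [jS _ _ _ _] := hS.
have d : is_derive x 1 (fun x : R => (x - c) / eps) eps^-1.
  by apply: is_derive_eq; rewrite /GRing.scale /= subr0 mulr0 add0r mulr1.
have := @is_derive1_comp R (S m) (fun x => (x - c) / eps) x _ _ (jS m _) d.
by rewrite mulrC.
Qed.

Lemma bump_jet_rescaled c eps : jet (bump c eps).
Proof.
move=> m x; have d := dS c eps m.+1 x; apply: is_derive_eq.
by rewrite /bump (exprS _ m.+1) /GRing.scale /=; ring.
Qed.

Lemma plateau_jet c k eps : jet (plateau c k eps).
Proof.
move=> m x; have d := dS c eps m x; have d' := dS (c + k) eps m x.
apply: is_derive_eq.
by rewrite /plateau (exprS _ m) /GRing.scale /=; ring.
Qed.

Lemma plateau1 c k eps x : plateau c k eps 1 x = bump c eps 0 x - bump (c + k) eps 0 x.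
Proof. by rewrite /plateau /bump mulrBr. Qed.

Lemma bump_out c eps m x : 0 < eps -> eps <= `|x - c| -> bump c eps m x = 0.
Proof.
move=> e0 ex; have [_ _ _ _ [S0 _]] := hS.
by rewrite /bump S0 ?mulr0// normrM normfV (gtr0_norm e0) ler_pdivlMr ?mul1r.
Qed.

Lemma plateau_out c k eps m x : 0 < eps -> 0 <= k ->
  (x <= c - eps) || (c + k + eps <= x) -> plateau c k eps m x = 0.
Proof.
move=> e0 k0 ex; have [_ S0 S1 _ [S2 _]] := hS.
have h1 y : y <= - eps -> y / eps <= -1 by rewrite ler_pdivrMr ?mulN1r.
have h2 y : eps <= y -> 1 <= y / eps by rewrite ler_pdivlMr ?mul1r.
rewrite /plateau; case/orP: ex => ex.
  have [h3 h4] : (x - c) / eps <= -1 /\ (x - (c + k)) / eps <= -1 by split; apply: h1; lra.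
  case: m => [|m]; first by rewrite !S0// subrr mulr0.
  by rewrite !S2 ?subrr ?mulr0// ler_normr orbC lerNr ?h3 ?h4.
have [h3 h4] : 1 <= (x - c) / eps /\ 1 <= (x - (c + k)) / eps by split; apply: h2; lra.
case: m => [|m]; first by rewrite !S1// subrr mulr0.
by rewrite !S2 ?subrr ?mulr0// ler_normr ?h3 ?h4.
Qed.

Lemma bump_ge0 c eps x : 0 < eps -> 0 <= bump c eps 0 x <= M / eps.
Proof.
move=> e0; have [_ _ _ _ [_ S1]] := hS; have /andP[h1 h2] := S1 ((x - c) / eps).
have e1 : 0 <= eps^-1 by rewrite invr_ge0 ltW.
by rewrite /bump expr1 mulr_ge0//= mulrC ler_wpM2r.
Qed.

Lemma plateau_01 c k eps x : 0 < eps -> eps *+ 2 <= k -> 0 <= plateau c k eps 0 x <= 1.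
Proof.
move=> e0 ek; have [_ S0 S1 S01 _] := hS.
have h1 y : y <= - eps -> y / eps <= -1 by rewrite ler_pdivrMr ?mulN1r.
have h2 y : eps <= y -> 1 <= y / eps by rewrite ler_pdivlMr ?mul1r.
rewrite /plateau expr0 mul1r.
have [xc|xc] := leP eps (x - c).
  rewrite S1 ?h2//; have /andP[] := S01 ((x - (c + k)) / eps); lra.
rewrite (S0 ((x - (c + k)) / eps)) ?subr0//; apply: h1; move: ek; rewrite mulr2n; lra.
Qed.

Lemma plateau_in c k eps x : 0 < eps -> c + eps <= x <= c + k - eps ->
  plateau c k eps 0 x = 1.
Proof.
move=> e0 /andP[ex xe]; have [_ S0 S1 S01 _] := hS.
rewrite /plateau expr0 mul1r S1 ?S0 ?subr0//.
  by rewrite ler_pdivrMr ?mulN1r//; lra.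
by rewrite ler_pdivlMr ?mul1r//; lra.
Qed.

Lemma bump_continuous c eps : continuous (bump c eps 0).
Proof. by apply: jet_continuous; exact: bump_jet_rescaled. Qed.

Lemma plateau_continuous c k eps : continuous (plateau c k eps 0).
Proof. by apply: jet_continuous; exact: plateau_jet. Qed.

Lemma integral_bump c eps : 0 < eps -> (\int[leb]_x (bump c eps 0 x)%:E = 1)%E.
Proof.
move=> e0; have [jS S0 S1 _ _] := hS.
have -> : (\int[leb]_x (bump c eps 0 x)%:E = \int[leb]_(x in `[(c - eps)%R, (c + eps)%R]) (bump c eps 0 x)%:E)%E.
  rewrite [RHS]integral_mkcond; apply: eq_integral => x _.
  rewrite patchE mem_setE in_itv /=; case: ifPn => // xe; rewrite bump_out//.
  by rewrite leNgt ltr_norml; apply: contra xe => /andP[? ?]; apply/andP; split; lra.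
pose F x := S 0%N ((x - c) / eps).
have dF x : is_derive x 1 F (bump c eps 0 x).
  by have := dS c eps 0 x; rewrite /bump expr1.
have cF : continuous F.
  by move=> x; apply/differentiable_continuous/derivable1_diffP; have [] := dF x.
rewrite (@continuous_FTC2 R _ F); first last.
- by move=> x _; rewrite derive1E; have [] := dF x.
- split; first by move=> x _; have [] := dF x.
  + by apply: cvg_at_right_filter; exact: cF.
  + by apply: cvg_at_left_filter; exact: cF.
- by apply: continuous_subspaceT; exact: bump_continuous.
- by lra.
rewrite /F S1 ?S0 ?sube0//.
  by rewrite ler_pdivrMr ?mulN1r//; lra.
by rewrite ler_pdivlMr ?mul1r//; lra.
Qed.

Lemma integral_plateau c k eps : 0 < eps -> eps *+ 2 <= k ->
  ((k - eps *+ 2)%:E <= \int[leb]_x (plateau c k eps 0 x)%:E <= (k + eps *+ 2)%:E)%E.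
Proof.
move=> e0 ek.
have mes (a b : R) : a <= b -> (\int[leb]_x (\1_`[a, b] x)%:E = (b - a)%:E)%E.
  by move=> ab; rewrite integral_indic// setIT [LHS]lebesgue_measure_itv/= lte_fin -EFinB; case: ltgtP ab => // ->; rewrite subrr.
have mp : measurable_fun setT (fun x => (plateau c k eps 0 x)%:E).
  by apply/measurable_EFinP; apply: continuous_measurable_fun; exact: plateau_continuous.
have mi (A : set R) : measurable A -> measurable_fun setT (fun x : R => (\1_A x)%:E : \bar R).
  by move=> mA; apply/measurable_EFinP; exact: measurable_indic.
apply/andP; split.
  have -> : (k - eps *+ 2)%:E = (\int[leb]_x (\1_`[(c + eps)%R, (c + k - eps)%R] x)%:E)%E.
    by rewrite mes; [congr _%:E|]; move: ek; rewrite mulr2n; lra.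
  apply: ge0_le_integral => //.
  - by apply: mi; exact: measurable_itv.
  - by move=> x _; rewrite lee_fin indicE mem_setE in_itv /=; case: (boolP (_ <= _ <= _)) => [h|_]; rewrite ?(plateau_in e0 h)//; case/andP: (plateau_01 c x e0 ek).
have -> : (k + eps *+ 2)%:E = (\int[leb]_x (\1_`[(c - eps)%R, (c + k + eps)%R] x)%:E)%E.
  by rewrite mes; [congr _%:E|]; move: ek; rewrite mulr2n; lra.
apply: ge0_le_integral => //.
- by move=> x _; rewrite lee_fin; case/andP: (plateau_01 c x e0 ek).
- by apply: mi; exact: measurable_itv.
- move=> x _; rewrite lee_fin indicE mem_setE in_itv /=.
  case: (boolP (_ <= _ <= _)) => h; first by case/andP: (plateau_01 c x e0 ek).
  rewrite plateau_out//; first by move: ek; rewrite mulr2n; lra.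
  by rewrite -[_ || _]negbK negb_or -!ltNge; apply: contra h => /andP[? ?]; rewrite !ltW.
Qed.

End cutoffs.

(** * Weak derivatives tested against products *)

Section product_functions.
Context {R : realType} {n : nat}.
Implicit Types (chi : 'I_n -> nat -> R -> R) (alpha beta : 'I_n -> nat).
Implicit Types (z : 'rV[R]_n) (i j : 'I_n).

(** The only test functions used: their derivatives stay in the same class and
    their integrals factorize. *)
Definition prodfun chi alpha z : R := \prod_(i < n) chi i (alpha i) (z 0 i).

Definition box (lo hi : 'I_n -> R) : set 'rV[R]_n :=
  [set z | forall i, lo i <= z 0 i <= hi i].

Lemma box_compact lo hi : compact (box lo hi).
Proof.
have -> : box lo hi = [set v : 'rV[R]_n | forall i, `[lo i, hi i]%classic (v ord0 i)].
  by apply/seteqP; split => z /= zb i; move: (zb i); rewrite /= in_itv.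
by apply: (@rV_compact _ n (fun i => `[lo i, hi i]%classic)) => i; exact: segment_compact.
Qed.

Lemma prodfun_continuous chi alpha : (forall i, jet (chi i)) -> continuous (prodfun chi alpha).
Proof.
move=> jc; rewrite /prodfun.
pose F s (z : 'rV[R]_n) := \prod_(i <- s) chi i (alpha i) (z 0 i).
suff : forall s, continuous (F s) by apply.
elim=> [|i s ih].
  rewrite (_ : F [::] = cst 1); first exact: cst_continuous.
  by apply/funext => z; rewrite /F big_nil.
rewrite (_ : F _ = (fun z => chi i (alpha i) (z 0 i) * F s z)); last first.
  by apply/funext => z; rewrite /F big_cons.
have h : continuous (fun z : 'rV[R]_n => chi i (alpha i) (z 0 i)).
  move=> x; apply: continuous_comp; first exact: coord_continuous.
  exact: jet_continuous.
by move=> x; exact: (continuousM (h x) (ih x)).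
Qed.

Lemma is_derive_prodfun chi alpha i z : (forall i, jet (chi i)) ->
  is_derive z (delta_mx 0 i) (prodfun chi alpha)
    (prodfun chi (fun k => (alpha k + (k == i))%N) z).
Proof.
move=> jc.
pose c := \prod_(k < n | k != i) chi k (alpha k) (z 0 k).
have h1 h : prodfun chi alpha (h *: delta_mx 0 i + z) = c * chi i (alpha i) (h + z 0 i).
  rewrite /prodfun (bigD1 i)//= mulrC !mxE !eqxx mulr1; congr (_ * _).
  by apply: eq_bigr => k ki; rewrite !mxE eqxx (negbTE ki) mulr0 add0r.
have h2 : prodfun chi (fun k => (alpha k + (k == i))%N) z = c * chi i (alpha i).+1 (z 0 i).
  rewrite /prodfun (bigD1 i)//= mulrC eqxx addn1; congr (_ * _).
  by apply: eq_bigr => k ki; rewrite (negbTE ki) addn0.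
have d : is_derive (z 0 i) 1 (c \*: chi i (alpha i)) (c * chi i (alpha i).+1 (z 0 i)).
  by have := jc i (alpha i) (z 0 i) => ?; exact: is_derive_eq.
rewrite h2.
have e : (fun h => h^-1 *: (prodfun chi alpha (h *: delta_mx 0 i + z) - prodfun chi alpha z)) =
   (fun h => h^-1 *: ((c \*: chi i (alpha i)) (h *: 1 + z 0 i) - (c \*: chi i (alpha i)) (z 0 i))).
  apply/funext => h; rewrite h1; have := h1 0; rewrite scale0r add0r add0r => ->.
  by congr (_ *: (_ * chi i _ (_ + _) - _)); rewrite /GRing.scale /= mulr1.
case: d => d1 d2; constructor.
  by rewrite /derivable e.
by rewrite /derive e.
Qed.

Lemma partial_prodfun chi alpha i : (forall i, jet (chi i)) ->
  partial i (prodfun chi alpha) = prodfun chi (fun k => (alpha k + (k == i))%N).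
Proof. by move=> jc; apply/funext => z; have [] := is_derive_prodfun alpha i z jc. Qed.

Lemma prodfun_smooth chi alpha : (forall i, jet (chi i)) -> smooth (prodfun chi alpha).
Proof.
move=> jc s.
have [beta ->] : exists beta, foldr partial (prodfun chi alpha) s = prodfun chi beta.
  elim: s => [|i s [beta /= ->]]; first by exists alpha.
  by rewrite partial_prodfun//; eexists.
split; first exact: prodfun_continuous.
by move=> i x; have [] := is_derive_prodfun beta i x jc.
Qed.

Lemma mpartial_prodfun chi alpha beta : (forall i, jet (chi i)) ->
  mpartial alpha (prodfun chi beta) = prodfun chi (fun k => (beta k + alpha k)%N).
Proof.
move=> jc; rewrite /mpartial.
have -> : (fun k => (beta k + alpha k)%N) = (fun k => (beta k + (k \in enum 'I_n) * alpha k)%N).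
  by apply/funext => k; rewrite mem_enum mul1n.
elim: (enum _) (enum_uniq 'I_n) => [_|i s ih /= /andP[nis us]].
  by congr prodfun; apply/funext => k; rewrite addn0.
rewrite ih//.
have it m (al : 'I_n -> nat) : iter m (partial i) (prodfun chi al) =
   prodfun chi (fun k => (al k + (k == i) * m)%N).
  elim: m al => [|m ihm] al /=.
    by congr prodfun; apply/funext => k; rewrite muln0 addn0.
  rewrite ihm partial_prodfun//; congr prodfun; apply/funext => k.
  by rewrite -addnA mulnS addnC [(_ * m + _)%N]addnC [RHS]addnC.
rewrite it; congr prodfun; apply/funext => k; rewrite inE -addnA; congr addn.
have [->|ki] := eqVneq k i; first by rewrite (negbTE nis) mul0n.
by rewrite addn0.
Qed.

Lemma prodfun_out chi alpha lo hi z :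
  (forall i m x, ~~ (lo i <= x <= hi i) -> chi i m x = 0) ->
  ~ box lo hi z -> prodfun chi alpha z = 0.
Proof.
move=> c0 /existsNP[i /negP zi].
by rewrite /prodfun (bigD1 i)//= c0// mul0r.
Qed.

Lemma prodfun_test chi alpha lo hi (U : set 'rV[R]_n) : (forall i, jet (chi i)) ->
  (forall i m x, ~~ (lo i <= x <= hi i) -> chi i m x = 0) ->
  box lo hi `<=` U -> test_function U (prodfun chi alpha).
Proof.
move=> jc c0 bU.
have sub : closure [set x | prodfun chi alpha x != 0] `<=` box lo hi.
  rewrite [X in _ `<=` X](closure_id _).1; last first.
    by apply: compact_closed; [exact: norm_hausdorff|exact: box_compact].
  apply: closure_subset => z /= /eqP pz; apply: contrapT => zb.
  by apply: pz; exact: prodfun_out zb.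
split; first exact: prodfun_smooth.
- by apply: subclosed_compact sub; [exact: closed_closure|exact: box_compact].
- exact: subset_trans sub bU.
Qed.

End product_functions.

Section integral_on_tuples.
Context {R : realType}.
Local Notation leb := (@lebesgue_measure R).

Lemma measurable_prod_tuple n (psi : 'I_n -> R -> \bar R) :
  (forall i, measurable_fun setT (psi i)) ->
  measurable_fun setT (fun z : n.-tuple R => \prod_(i < n) psi i (tnth z i))%E.
Proof.
move=> mpsi.
pose F s (z : n.-tuple R) := (\prod_(i <- s) psi i (tnth z i))%E.
suff : forall s, measurable_fun setT (F s) by apply.
elim=> [|i s ih].
  rewrite (_ : F [::] = cst 1%E); first exact: measurable_cst.
  by apply/funext => z; rewrite /F big_nil.
rewrite (_ : F _ = (fun z => psi i (tnth z i) * F s z)%E); last first.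
  by apply/funext => z; rewrite /F big_cons.
apply: emeasurable_funM => //.
apply: measurableT_comp => //.
exact: measurable_tnth.
Qed.

(** By induction on the dimension, through Tonelli. *)
Lemma integral_tuple_prod n (psi : 'I_n -> R -> \bar R) :
  (forall i, measurable_fun setT (psi i)) -> (forall i x, 0 <= psi i x)%E ->
  (\int[lebesgue_tuple n]_z \prod_(i < n) psi i (tnth z i) =
   \prod_(i < n) \int[leb]_x psi i x)%E.
Proof.
elim: n psi => [|n ih] psi mpsi psi0.
  rewrite big_ord0 (eq_integral (cst 1%E)); last by move=> z _; rewrite big_ord0.
  by rewrite integral_cst// mul1e /= diracT.
rewrite /= /measure_cons ge0_integral_pushforward//=; first last.
- by move=> z _; apply: prode_ge0.
- by apply: measurable_funTS; exact: measurable_prod_tuple.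
- exact: measurable_tuple_cons.
rewrite preimage_setT.
pose g (p : R * n.-tuple R) := (psi ord0 p.1 * \prod_(i < n) psi (lift ord0 i) (tnth p.2 i))%E.
transitivity (\int[leb \x lebesgue_tuple n]_p g p)%E.
  apply: eq_integral => p _ /=; rewrite big_ord_recl /g; congr (_ * _)%E.
  by apply: eq_bigr => i _; congr psi; rewrite /tuple_cons (tnth_nth 0) /= -tnth_nth.
have mP : measurable_fun setT (fun z : n.-tuple R => \prod_(i < n) psi (lift ord0 i) (tnth z i))%E.
  exact: (@measurable_prod_tuple n (fun i => psi (lift ord0 i))).
have P0 z : (0 <= \prod_(i < n) psi (lift ord0 i) (tnth z i))%E by apply: prode_ge0.
rewrite fubini_tonelli1//; first last.
- by move=> p; rewrite /g mule_ge0.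
- apply: emeasurable_funM; first exact: measurableT_comp.
  exact: (measurableT_comp mP measurable_snd).
rewrite /fubini_F /g big_ord_recl -(ih (fun i => psi (lift ord0 i)))//.
under eq_integral => x _ do rewrite /= ge0_integralZl//.
rewrite ge0_integralZr//; first exact: mpsi.
by apply: integral_ge0 => z _; exact: P0.
Qed.

End integral_on_tuples.

Section weak_partial_derivatives.
Context {R : realType} {n : nat}.
Local Notation leb := (@lebesgue_measure R).
Local Notation lebn := (@lebesgue_tuple R n).
Implicit Types (chi : 'I_n -> nat -> R -> R) (alpha : 'I_n -> nat).
Implicit Types (U : set 'rV[R]_n) (g : 'rV[R]_n -> R) (lo hi : 'I_n -> R).

Definition supported_in lo hi chi :=
  forall i m x, ~~ (lo i <= x <= hi i) -> chi i m x = 0.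

Definition L1box U g := forall lo hi, box lo hi `<=` U ->
  lebn.-integrable (rv_of @^-1` box lo hi) (EFin \o (g \o rv_of)).

Lemma L1loc_box U g : L1loc U g -> L1box U g.
Proof. by move=> Lg lo hi; apply: Lg; exact: box_compact. Qed.

(** The weak derivative in the direction [j], tested against products only. *)
Definition weak_partial U g gj (j : 'I_n) :=
  [/\ L1box U g, L1box U gj & forall chi lo hi,
    (forall i, jet (chi i)) -> supported_in lo hi chi -> box lo hi `<=` U ->
    \int[lebn]_(z in rv_of @^-1` U)
      (g (rv_of z) * prodfun chi (fun k => (k == j : nat)) (rv_of z)) =
    - \int[lebn]_(z in rv_of @^-1` U)
      (gj (rv_of z) * prodfun chi (fun=> 0%N) (rv_of z))].

Definition unit_index (j : 'I_n) : 'I_n -> nat := fun k => (k == j : nat).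

Lemma morder_unit_index j : morder (unit_index j) = 1%N.
Proof.
rewrite /morder (bigD1 j)//= /unit_index eqxx big1 ?addn0// => i /negbTE ->//.
Qed.

Lemma morder_unit_index2 i j : morder (fun k => (unit_index i k + unit_index j k)%N) = 2%N.
Proof. by rewrite /morder big_split/= -!/(morder _) !morder_unit_index. Qed.

Lemma weak_partial_order1 U g gj j :
  weak_derivative U (unit_index j) g gj -> weak_partial U g gj j.
Proof.
move=> [Lg Lgj w]; split; [exact: L1loc_box|exact: L1loc_box|].
move=> chi lo hi jc sc bU.
have := w _ (prodfun_test (fun=> 0%N) jc sc bU).
by rewrite mpartial_prodfun// morder_unit_index expr1 mulN1r.
Qed.

Lemma weak_partial_order2 U g gi gij i j :
  weak_derivative U (unit_index i) g gi ->
  weak_derivative U (fun k => (unit_index i k + unit_index j k)%N) g gij ->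
  weak_partial U gi gij j.
Proof.
move=> [_ Lgi wi] [_ Lgij wij]; split; [exact: L1loc_box|exact: L1loc_box|].
move=> chi lo hi jc sc bU.
have := wi _ (prodfun_test (unit_index j) jc sc bU).
have := wij _ (prodfun_test (fun=> 0%N) jc sc bU).
rewrite !mpartial_prodfun// morder_unit_index2 morder_unit_index sqrrN expr1n mul1r.
have -> : (fun k => (unit_index j k + unit_index i k)%N) =
          (fun k => (0 + (unit_index i k + unit_index j k))%N).
  by apply/funext => k; rewrite addnC.
by move=> -> /eqP; rewrite expr1 mulN1r -eqr_oppLR => /eqP <-.
Qed.

Lemma measurable_box lo hi : measurable (rv_of @^-1` box lo hi : set (n.-tuple R)).
Proof.
have -> : rv_of @^-1` box lo hi =
    \bigcap_(i in [set: 'I_n]) (fun z : n.-tuple R => tnth z i) @^-1` `[lo i, hi i].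
  apply/seteqP; split => z /=; first by move=> h i _ /=; have := h i; rewrite in_itv /= mxE.
  by move=> h i; have := h i I; rewrite /= in_itv /= mxE.
apply: fin_bigcap_measurable => // i _.
rewrite -[X in measurable X]setTI; apply: (measurable_tnth i) => //.
Qed.

Lemma measurable_prodfun chi alpha : (forall i, jet (chi i)) ->
  measurable_fun setT (fun z : n.-tuple R => prodfun chi alpha (rv_of z)).
Proof.
move=> jc; apply/measurable_EFinP.
rewrite (_ : _ \o _ = (fun z : n.-tuple R =>
  \prod_(i < n) (fun x => (chi i (alpha i) x)%:E) (tnth z i))%E).
  apply: (@measurable_prod_tuple _ _ (fun i x => (chi i (alpha i) x)%:E)) => i.
  apply/measurable_EFinP; apply: continuous_measurable_fun; exact: jet_continuous.
apply/funext => z /=; rewrite prodEFin; congr _%:E.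
by apply: eq_bigr => i _; rewrite mxE.
Qed.

Lemma prodfun_bounded chi alpha lo hi : (forall i, jet (chi i)) ->
  supported_in lo hi chi -> exists N, forall z, `|prodfun chi alpha z| <= N.
Proof.
move=> jc sc.
have /compact_bounded[N [_ hN]] : compact (prodfun chi alpha @` box lo hi).
  apply: continuous_compact; last exact: box_compact.
  by apply: continuous_subspaceT; exact: prodfun_continuous.
exists (`|N| + 1) => z.
have [zb|zb] := pselect (box lo hi z).
  by apply: (hN (`|N| + 1)); [rewrite (le_lt_trans (ler_norm N))// ltrDl|exists z].
by rewrite (prodfun_out alpha sc zb) normr0 addr_ge0.
Qed.

Lemma integrable_prodfunM U g chi alpha lo hi : (forall i, jet (chi i)) ->
  supported_in lo hi chi -> box lo hi `<=` U -> L1box U g ->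
  lebn.-integrable (rv_of @^-1` box lo hi)
    (EFin \o (fun z => g (rv_of z) * prodfun chi alpha (rv_of z))).
Proof.
move=> jc sc bU Lg; have ig := Lg _ _ bU.
have [N hN] := prodfun_bounded alpha jc sc.
have := integrableMl (measurable_box lo hi) ig
  (measurable_funTS (measurable_prodfun alpha jc)).
apply.
exists N; split; first exact: num_real.
by move=> M NM z _ /=; rewrite (le_trans (hN _))// ltW.
Qed.

Lemma Rintegral_box U g chi alpha lo hi :
  supported_in lo hi chi -> box lo hi `<=` U ->
  \int[lebn]_(z in rv_of @^-1` U) (g (rv_of z) * prodfun chi alpha (rv_of z)) =
  \int[lebn]_(z in rv_of @^-1` box lo hi) (g (rv_of z) * prodfun chi alpha (rv_of z)).
Proof.
move=> sc bU; rewrite Rintegral_mkcond [RHS]Rintegral_mkcond.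
congr (\int[_]_(_ in _) _); apply/funext => z; rewrite !patchE.
have [zb|zb] := pselect (box lo hi (rv_of z)).
  by rewrite !ifT// inE//; exact: bU.
rewrite [in RHS]ifF; last by apply/negbTE; rewrite notin_setE.
by case: ifP => // _; rewrite (prodfun_out alpha sc zb) mulr0.
Qed.

End weak_partial_derivatives.

Section integrable_real.
Context d (T : measurableType d) (R : realType) (mu : {measure set T -> \bar R}).
Implicit Types (D : set T) (f g : T -> R).

Lemma integrable_subr D f g : measurable D ->
  mu.-integrable D (EFin \o f) -> mu.-integrable D (EFin \o g) ->
  mu.-integrable D (EFin \o (fun x => f x - g x)).
Proof. by move=> mD fi gi; exact: (integrableB mD fi gi). Qed.

Lemma integrable_scaler D f r : measurable D ->
  mu.-integrable D (EFin \o f) -> mu.-integrable D (EFin \o (fun x => r * f x)).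
Proof. by move=> mD fi; exact: (integrableZl mD r fi). Qed.

End integrable_real.

Section weak_increments.
Context {R : realType} {n : nat}.
Local Notation leb := (@lebesgue_measure R).
Local Notation lebn := (@lebesgue_tuple R n).
Context (S : nat -> R -> R) (M : R) (hS : step_jet S M).
Implicit Types (U : set 'rV[R]_n) (g : 'rV[R]_n -> R) (c eps lo hi : 'I_n -> R).

Definition bump_kernel c eps : 'rV[R]_n -> R :=
  prodfun (fun i => bump S (c i) (eps i)) (fun=> 0%N).

Definition bump_mean U g c eps : R :=
  \int[lebn]_(z in rv_of @^-1` U) (g (rv_of z) * bump_kernel c eps (rv_of z)).

Lemma bump_supported c eps : (forall i, 0 < eps i) ->
  supported_in (fun i => c i - eps i) (fun i => c i + eps i)
    (fun i => bump S (c i) (eps i)).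
Proof.
move=> e0 i m x /negP xe; apply: (bump_out hS) => //.
by rewrite leNgt ltr_norml; apply/negP => /andP[? ?]; apply: xe; apply/andP; split; lra.
Qed.

Lemma integral_bump_kernel c eps : (forall i, 0 < eps i) ->
  (\int[lebn]_z (bump_kernel c eps (rv_of z))%:E = 1)%E.
Proof.
move=> e0.
rewrite (eq_integral (fun z : n.-tuple R =>
    \prod_(i < n) (fun x => (bump S (c i) (eps i) 0 x)%:E) (tnth z i))%E).
  rewrite (@integral_tuple_prod _ n (fun i x => (bump S (c i) (eps i) 0 x)%:E)).
  - by rewrite big1// => i _; exact: (integral_bump hS).
  - by move=> i; apply/measurable_EFinP; apply: continuous_measurable_fun;
      exact: (bump_continuous hS).
  - by move=> i x; rewrite lee_fin; case/andP: (bump_ge0 hS (c i) x (e0 i)).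
by move=> z _; rewrite /bump_kernel prodEFin; congr _%:E; apply: eq_bigr => i _; rewrite mxE.
Qed.

Lemma bump_kernel_ge0 c eps z : (forall i, 0 < eps i) -> 0 <= bump_kernel c eps z.
Proof.
move=> e0; apply: prodr_ge0 => i _.
by case/andP: (bump_ge0 hS (c i) (z 0 i) (e0 i)).
Qed.

Let jb c eps i : jet (bump S (c i) (eps i)).
Proof. exact: (bump_jet_rescaled hS). Qed.

Lemma integral_ge0_box (lo hi : 'I_n -> R) (phi : 'rV[R]_n -> R) :
  (forall z, 0 <= phi z) -> (forall z, ~ box lo hi z -> phi z = 0) ->
  (\int[lebn]_(z in rv_of @^-1` box lo hi) (phi (rv_of z))%:E =
   \int[lebn]_z (phi (rv_of z))%:E)%E.
Proof.
move=> p0 p1; rewrite integral_mkcond; apply: eq_integral => z _.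
by rewrite patchE; case: ifPn => //; rewrite notin_setE => /p1 ->.
Qed.

Lemma bump_mean_near U g c eps (y w : R) : L1box U g -> (forall i, 0 < eps i) ->
  let B := box (fun i => c i - eps i) (fun i => c i + eps i) in
  B `<=` U -> (forall z, B z -> `|g z - y| <= w) ->
  `|bump_mean U g c eps - y| <= w.
Proof.
move=> Lg e0 B BU gw.
have sb := @bump_supported c eps e0.
have mB := measurable_box (fun i => c i - eps i) (fun i => c i + eps i).
rewrite /bump_mean (Rintegral_box _ _ sb BU) -/B -/(bump_kernel c eps).
have i1 : lebn.-integrable (rv_of @^-1` B) (EFin \o (fun z => g (rv_of z) * bump_kernel c eps (rv_of z))).
  exact: integrable_prodfunM BU Lg.
have tot : (\int[lebn]_(z in rv_of @^-1` B) (bump_kernel c eps (rv_of z))%:E = 1)%E.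
  rewrite integral_ge0_box ?integral_bump_kernel//; first by move=> z; exact: bump_kernel_ge0.
  by move=> z; exact: (prodfun_out _ sb).
have mk : measurable_fun (rv_of @^-1` B) (fun z : n.-tuple R => bump_kernel c eps (rv_of z)).
  by apply: measurable_funTS; apply: measurable_prodfun.
have i2 : lebn.-integrable (rv_of @^-1` B) (EFin \o (fun z => bump_kernel c eps (rv_of z))).
  apply/integrableP; split; first exact/measurable_EFinP.
  rewrite (eq_integral (fun z => (bump_kernel c eps (rv_of z))%:E)) ?tot ?ltry//.
  by move=> z _ /=; rewrite ger0_norm// bump_kernel_ge0.
have tot' : \int[lebn]_(z in rv_of @^-1` B) bump_kernel c eps (rv_of z) = 1.
  by rewrite /Rintegral tot.
have i3 r : lebn.-integrable (rv_of @^-1` B) (EFin \o (fun z => r * bump_kernel c eps (rv_of z))).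
  exact: integrable_scaler.
rewrite -[X in _ - X]mulr1 -tot' -RintegralZl// -RintegralB//.
rewrite (le_trans (le_normr_Rintegral _ _))//.
  exact: integrable_subr.
rewrite -[leRHS]mulr1 -tot' -RintegralZl//; apply: le_Rintegral => //.
  apply: integrable_norm.
  exact: integrable_subr.
move=> z zB; rewrite -mulrBl normrM (ger0_norm (bump_kernel_ge0 _ _ e0)).
by rewrite ler_wpM2r ?bump_kernel_ge0// gw.
Qed.

End weak_increments.

Section weak_increment_bound.
Context {R : realType} {n : nat}.
Local Notation leb := (@lebesgue_measure R).
Local Notation lebn := (@lebesgue_tuple R n).
Context (S : nat -> R -> R) (M : R) (hS : step_jet S M).
Implicit Types (U : set 'rV[R]_n) (g : 'rV[R]_n -> R) (c eps lo hi : 'I_n -> R).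

(** The test function is a plateau in the direction [j] and a bump in the others.
    The domination of [gj] only sees the coordinate [i0], so that the other
    coordinates integrate to the mass [k'] of the plateau, or to 1. *)
Lemma bump_mean_increment U g gj (j i0 : 'I_n) c eps (k c0 : R) (gam : R -> \bar R) :
  weak_partial U g gj j -> (forall i, 0 < eps i) -> eps j *+ 2 <= k ->
  let B := box (fun i => c i - eps i) (fun i => c i + eps i + (if i == j then k else 0)) in
  B `<=` U -> measurable_fun setT gam -> (forall x, 0 <= gam x)%E ->
  (forall z, B z -> (`|gj z - c0|%R%:E <= gam (z ord0 i0))%E) ->
  exists2 k', k - eps j *+ 2 <= k' <= k + eps j *+ 2 &
  (`|bump_mean S U g (fun i => c i + (if i == j then k else 0))%R eps
     - bump_mean S U g c eps - c0 * k'|%R%:E <=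
   if i0 == j then \int[leb]_x (gam x * (plateau S (c j) k (eps j) 0 x)%:E)
   else k'%:E * \int[leb]_x (gam x * (bump S (c i0) (eps i0) 0 x)%:E))%E.
Proof.
move=> [Lg Lgj w] e0 ek B BU mgam gam0 gjB.
have k0 : 0 <= k by apply: le_trans ek; rewrite mulrn_wge0// ltW.
have [k' kE] : exists k' : R, (\int[leb]_x (plateau S (c j) k (eps j) 0 x)%:E = k'%:E)%E.
  have /andP[h1 h2] := integral_plateau hS (c j) (e0 j) ek.
  by case: (integral _ _ _) h1 h2 => // r _ _; exists r.
have kb := integral_plateau hS (c j) (e0 j) ek; rewrite kE !lee_fin in kb.
exists k' => //.
have k'0 : 0 <= k' by case/andP: kb => h _; apply: le_trans h; rewrite subr_ge0.
pose c' i := c i + (if i == j then k else 0).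
pose chi i := if i == j then plateau S (c i) k (eps i) else bump S (c i) (eps i).
have jchi i : jet (chi i).
  by rewrite /chi; case: ifP => _; [exact: plateau_jet hS _ _ _|exact: bump_jet_rescaled hS _ _].
have schi : supported_in (fun i => c i - eps i) (fun i => c i + eps i + (if i == j then k else 0)) chi.
  move=> i m x; rewrite /chi; case: ifP => ij xe.
    apply: (plateau_out hS) => //; rewrite -[_ || _]negbK negb_or -!ltNge.
    by apply: contra xe => /andP[? ?]; apply/andP; split; lra.
  by apply: (bump_supported hS e0); rewrite addr0 in xe.
have sb (b : bool) : supported_in (fun i => c i - eps i)
    (fun i => c i + eps i + (if i == j then k else 0))
    (fun i => bump S (if b then c' i else c i) (eps i)).
  move=> i m x xe; apply: (bump_supported hS (c := fun i => if b then c' i else c i) e0).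
  apply: contra xe => /andP[]; rewrite /c'.
  by case: b; case: (i == j); rewrite ?addr0 => ? ?; apply/andP; split; lra.
have jb (b : bool) i : jet (bump S (if b then c' i else c i) (eps i)).
  exact: (bump_jet_rescaled hS).
have mB := measurable_box (fun i => c i - eps i) (fun i => c i + eps i + (if i == j then k else 0)).
have chi0 i x : 0 <= chi i 0%N x.
  rewrite /chi; case: eqP => [->|_]; first by case/andP: (plateau_01 hS (c j) x (e0 j) ek).
  by case/andP: (bump_ge0 hS (c i) x (e0 i)).
have mchi i : measurable_fun setT (fun x => (chi i 0%N x)%:E).
  by apply/measurable_EFinP; apply: continuous_measurable_fun; exact: jet_continuous.
have ichi i : (\int[leb]_x (chi i 0%N x)%:E = if i == j then k'%:E else 1)%E.
  rewrite /chi; case: eqP => [->//|_]; exact: (integral_bump hS).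
pose phi z := prodfun chi (fun=> 0%N) (z : 'rV[R]_n).
have phi0 z : 0 <= phi z by apply: prodr_ge0 => i _.
have totphi : (\int[lebn]_z (phi (rv_of z))%:E = k'%:E)%E.
  rewrite (eq_integral (fun z : n.-tuple R => \prod_(i < n) (fun x => (chi i 0%N x)%:E) (tnth z i))%E).
    rewrite (@integral_tuple_prod _ n (fun i x => (chi i 0%N x)%:E))//.
    rewrite (bigD1 j)//= ichi eqxx big1 ?mule1// => i /negbTE ij.
    by rewrite ichi ij.
  by move=> z _; rewrite /phi prodEFin; congr _%:E; apply: eq_bigr => i _; rewrite mxE.
have phiB z : ~ B z -> phi z = 0 by exact: prodfun_out schi.
have mphi : measurable_fun setT (fun z : n.-tuple R => phi (rv_of z)) by exact: measurable_prodfun.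
have iphi : lebn.-integrable (rv_of @^-1` B) (EFin \o (fun z => phi (rv_of z))).
  apply/integrableP; split; first by apply/measurable_EFinP; exact: measurable_funTS.
  rewrite (eq_integral (fun z => (phi (rv_of z))%:E)) ?integral_ge0_box ?totphi ?ltry//.
  by move=> z _ /=; rewrite ger0_norm.
have igphi : lebn.-integrable (rv_of @^-1` B) (EFin \o (fun z => gj (rv_of z) * phi (rv_of z))).
  exact: integrable_prodfunM BU Lgj.
have eqm : bump_mean S U g c' eps - bump_mean S U g c eps =
    \int[lebn]_(z in rv_of @^-1` B) (gj (rv_of z) * phi (rv_of z)).
  rewrite -(Rintegral_box _ _ schi BU) -[RHS]opprK -(w chi _ _ jchi schi BU).
  rewrite /bump_mean (Rintegral_box _ _ (sb true) BU) (Rintegral_box _ _ (sb false) BU) -/B.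
  rewrite (Rintegral_box _ _ schi BU) -/B -[LHS]opprB; congr (- _).
  have i1 b : lebn.-integrable (rv_of @^-1` B) (EFin \o (fun z => g (rv_of z) *
      prodfun (fun i => bump S (if b then c' i else c i) (eps i)) (fun=> 0%N) (rv_of z))).
    exact: (integrable_prodfunM (fun=> 0%N) (jb b) (sb b) BU Lg).
  rewrite -[LHS](RintegralB mB (i1 false) (i1 true)).
  apply: eq_Rintegral => z _; rewrite -mulrBr; congr (_ * _).
  rewrite /prodfun [RHS](bigD1 j)//= [X in X - _](bigD1 j)//= [X in _ - X](bigD1 j)//=.
  rewrite /c' /chi !eqxx plateau1 mulrBl; congr (_ * _ - _ * _);
    by apply: eq_bigr => i ij; rewrite !(negbTE ij) ?addr0.
rewrite eqm.
have totphi' : \int[lebn]_(z in rv_of @^-1` B) phi (rv_of z) = k'.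
  by rewrite /Rintegral integral_ge0_box// totphi.
rewrite -totphi' -RintegralZl// -RintegralB//; last exact: integrable_scaler.
have isub : lebn.-integrable (rv_of @^-1` B)
    (EFin \o (fun z => gj (rv_of z) * phi (rv_of z) - c0 * phi (rv_of z))).
  by apply: integrable_subr => //; exact: integrable_scaler.
rewrite EFin_normr_Rintegral//.
apply: (le_trans (le_abse_integral _ _ _)) => //; first by case/integrableP: isub.
rewrite totphi'.
pose psi i x := ((chi i 0%N x)%:E * (if i == i0 then gam x else 1))%E.
have mpsi i : measurable_fun setT (psi i).
  by apply: emeasurable_funM => //; case: (i == i0).
have psi0 i x : (0 <= psi i x)%E.
  by rewrite mule_ge0 ?lee_fin//; case: (i == i0).
have -> : (if i0 == j then \int[leb]_x (gam x * (plateau S (c j) k (eps j) 0 x)%:E)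
   else k'%:E * \int[leb]_x (gam x * (bump S (c i0) (eps i0) 0 x)%:E))%E =
   (\int[lebn]_z (\prod_(i < n) psi i (tnth z i)))%E.
  rewrite integral_tuple_prod// (bigD1 i0)//= {1}/psi eqxx.
  have e1 i : i != i0 -> (\int[leb]_x psi i x)%E = (\int[leb]_x (chi i 0%N x)%:E)%E.
    by move=> ii; apply: eq_integral => x _; rewrite /psi (negbTE ii) mule1.
  have [e|ne] := eqVneq i0 j.
    rewrite big1 ?mule1; last by move=> i ii; rewrite e1// ichi -e (negbTE ii).
    by apply: eq_integral => x _; rewrite /chi e eqxx muleC.
  rewrite (bigD1 j) 1?eq_sym//= e1 1?eq_sym// ichi eqxx big1 ?mule1; last first.
    by move=> i /andP[ii ij]; rewrite e1// ichi (negbTE ij).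
  by rewrite muleC; congr (_ * _)%E; apply: eq_integral => x _; rewrite /chi (negbTE ne) muleC.
have psiE z : (\prod_(i < n) psi i (tnth z i) = (phi (rv_of z))%:E * gam (tnth z i0))%E.
  rewrite [LHS](bigD1 i0)//= /phi /prodfun [X in (X%:E * _)%E](bigD1 i0)//= /psi eqxx mxE EFinM.
  rewrite -muleA [(gam _ * _)%E]muleC muleA; congr (_ * _ * _)%E.
  rewrite -prodEFin; apply: eq_bigr => i ii.
  by rewrite (negbTE ii) mule1 mxE.
apply: (@le_trans _ _ (\int[lebn]_(z in rv_of @^-1` B) (\prod_(i < n) psi i (tnth z i)))%E).
  apply: ge0_le_integral => //.
  - by apply: measurableT_comp => //; case/integrableP: isub.
  - by apply: measurable_funTS; exact: measurable_prod_tuple.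
  - move=> z zB; rewrite psiE -mulrBl /= normrM EFinM (ger0_norm (phi0 _)) muleC.
    by rewrite lee_pmul// ?lee_fin//; have := gjB _ zB; rewrite mxE.
apply: ge0_subset_integral => //; first exact: measurable_prod_tuple.
by move=> z _; apply: prode_ge0.
Qed.

End weak_increment_bound.

(** * Increments of weakly differentiable functions *)

Section interval_arithmetic.
Context {R : realType}.
Implicit Types x y p q d e m : R.

Lemma in_open_interval_margin lo hi z m e k y : m <= z - lo -> m <= hi - (z + k) ->
  e < m -> z - e <= y <= z + e + k -> lo < y < hi.
Proof. by move=> ? ? ? /andP[? ?]; apply/andP; split; lra. Qed.

Lemma in_interval_widen c e k k' x : 0 <= k' -> k' <= k ->
  c + k' - e <= x <= c + k' + e -> c - e <= x <= c + e + k.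
Proof. by move=> ? ? /andP[? ?]; apply/andP; split; lra. Qed.

Lemma le_increment x y p q d o1 o2 B :
  `|p - y| <= o1 -> `|q - x| <= o2 -> `|q - p - d| <= B ->
  `|x - y - d| <= B + o1 + o2.
Proof.
rewrite !ler_norml => /andP[? ?] /andP[? ?] /andP[? ?].
by apply/andP; split; lra.
Qed.

Lemma ler_dist_center p x y a b : `|p - x| <= a -> `|p - y| <= b -> `|x - y| <= a + b.
Proof.
by rewrite !ler_norml => /andP[? ?] /andP[? ?]; apply/andP; split; lra.
Qed.

End interval_arithmetic.

Section coordinate_increments.
Context {R : realType} {n : nat}.
Implicit Types (z w : 'rV[R]_n) (g : 'rV[R]_n -> R).

Lemma continuous_coord_modulus g z (e : R) : continuous g -> 0 < e ->
  exists2 r : R, 0 < r & forall w, (forall i, `|w 0 i - z 0 i| <= r) -> `|g w - g z| <= e.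
Proof.
move=> /(_ z) /cvgrPdist_le /(_ e) h e0; have /nbhs_ballP[r /= r0 hr] := h e0.
exists (r / 2); first by rewrite divr_gt0.
move=> w wz; rewrite distrC; apply: hr; split => // i j.
by rewrite /ball /= ord1 distrC (le_lt_trans (wz j))// ltr_pdivrMr// ltr_pMr// ltr1n.
Qed.

(** Passing from [z] to [w] one coordinate at a time. *)
Lemma telescope_coordinates (p : 'I_n -> R -> Prop) g (cc : 'I_n -> R) (beta : 'I_n -> R -> R) :
  (forall j z k, 0 <= k -> (forall i, p i (z 0 i)) ->
    (forall i, p i ((z + k *: delta_mx 0 j) 0 i)) ->
    `|g (z + k *: delta_mx 0 j) - g z - cc j * k| <= beta j k) ->
  forall z w, (forall i, p i (z 0 i)) -> (forall i, p i (w 0 i)) ->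
    `|g w - g z - \sum_j cc j * (w 0 j - z 0 j)| <= \sum_j beta j `|w 0 j - z 0 j|.
Proof.
move=> hg z w pz pw.
pose mix (s : seq 'I_n) : 'rV[R]_n := \row_i if i \in s then w 0 i else z 0 i.
have pm s i : p i (mix s 0 i) by rewrite mxE; case: ifP.
have step j (y : 'rV[R]_n) k : (forall i, p i (y 0 i)) ->
    (forall i, p i ((y + k *: delta_mx 0 j) 0 i)) ->
    `|g (y + k *: delta_mx 0 j) - g y - cc j * k| <= beta j `|k|.
  move=> py pyk; have [k0|k0] := leP 0 k; first by rewrite (ger0_norm k0); exact: hg.
  have h := hg j (y + k *: delta_mx 0 j) (- k).
  rewrite -addrA -scalerDl subrr scale0r addr0 mulrN opprK in h.
  rewrite (ltr0_norm k0) -normrN; have {h} := h _ pyk py.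
  rewrite oppr_ge0 => /(_ (ltW k0)); congr (`|_| <= _); ring.
suff key s : uniq s -> `|g (mix s) - g z - \sum_(j <- s) cc j * (w 0 j - z 0 j)| <=
    \sum_(j <- s) beta j `|w 0 j - z 0 j|.
  have wE : mix (index_enum 'I_n) = w by apply/rowP => i; rewrite mxE mem_index_enum.
  by have := key _ (index_enum_uniq 'I_n); rewrite wE.
elim: s => [_|j s ih /= /andP[js us]].
  have -> : mix [::] = z by apply/rowP => i; rewrite mxE.
  by rewrite !big_nil !subrr normr0.
have E : mix (j :: s) = mix s + (w 0 j - z 0 j) *: delta_mx 0 j.
  apply/rowP => i; rewrite !mxE inE eqxx /=.
  have [->|ij] := eqVneq i j; last by rewrite mulr0 addr0.
  by rewrite (negbTE js) mulr1 addrC subrK.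
rewrite !big_cons.
have h1 : `|g (mix s + (w 0 j - z 0 j) *: delta_mx 0 j) - g (mix s) - cc j * (w 0 j - z 0 j)|
   <= beta j `|w 0 j - z 0 j|.
  by apply: step; [exact: pm|rewrite -E; exact: pm].
rewrite -E in h1.
apply: le_trans (lerD h1 (ih us)).
apply: le_trans (ler_normD _ _).
by rewrite le_eqVlt; apply/orP; left; apply/eqP; congr (`|_|); ring.
Qed.

End coordinate_increments.

Lemma finite_positive_lower_bound (R : realType) n (f : 'I_n -> R) :
  (forall i, 0 < f i) -> exists2 m : R, 0 < m & forall i, m <= f i.
Proof.
move=> f0; have s0 : 0 < 1 + \sum_i (f i)^-1.
  by rewrite ltr_pwDl// sumr_ge0// => i _; rewrite invr_ge0 ltW.
exists (1 + \sum_i (f i)^-1)^-1; first by rewrite invr_gt0.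
move=> i; rewrite -[leRHS]invrK lef_pV2 ?posrE ?invr_gt0//.
rewrite (bigD1 i)//= addrCA lerDl addr_ge0// sumr_ge0// => j _.
by rewrite invr_ge0 ltW.
Qed.

Section pointwise_increments.
Context {R : realType} {n : nat} (i0 : 'I_n) (T : R).
Context (S : nat -> R -> R) (M : R) (hS : step_jet S M).
Local Notation leb := (@lebesgue_measure R).
Implicit Types (z y : 'rV[R]_n) (g : 'rV[R]_n -> R) (lo hi : 'I_n -> R).

Let U := [set z : 'rV[R]_n | 0 < z 0 i0 < T].

(** The bound between local means becomes pointwise when the bumps shrink: [g] is
    continuous, and [e * D] stands for what the width [e] costs. *)
Lemma weak_increment_le g gj j z (k c0 : R) lo hi (gam : R -> \bar R) (Y D : R) :
  continuous g -> weak_partial U g gj j -> 0 < k ->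
  (forall i, lo i < z 0 i) ->
  (forall i, z 0 i + (if i == j then k else 0) < hi i) ->
  0 <= lo i0 -> hi i0 <= T ->
  measurable_fun setT gam -> (forall x, 0 <= gam x)%E ->
  (forall y, (forall i, lo i < y 0 i < hi i) -> (`|gj y - c0|%R%:E <= gam (y ord0 i0))%E) ->
  0 <= D ->
  (forall e k', (0 < e)%R -> (e *+ 2 <= k)%R -> (k - e *+ 2 <= k' <= k + e *+ 2)%R -> (0 <= k')%R ->
    ((if i0 == j then \int[leb]_x (gam x * (plateau S (z ord0 j) k e 0 x)%:E)
     else k'%:E * \int[leb]_x (gam x * (bump S (z ord0 i0) e 0 x)%:E))
     <= (Y + e * D)%R%:E)%E) ->
  `|g (z + k *: delta_mx 0 j) - g z - c0 * k| <= Y.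
Proof.
move=> cg wg k0 loz zhi lo0 hiT mgam gam0 gjb D0 hY.
have [Lg _ _] := wg.
apply/ler_addgt0Pr => /= w w0.
pose C := 2 + D + `|c0| *+ 2.
have C0 : 0 < C by rewrite /C -addrA ltr_wpDr// addr_ge0// mulrn_wge0.
pose om := w / C; have om0 : 0 < om by rewrite divr_gt0.
have [r1 r10 h1] := continuous_coord_modulus z cg om0.
have [r2 r20 h2] := continuous_coord_modulus (z + k *: delta_mx 0 j) cg om0.
have [m m0 hm] : exists2 m : R, 0 < m & forall i, m <= Num.min (z 0 i - lo i)
    (hi i - (z 0 i + (if i == j then k else 0))).
  by apply: finite_positive_lower_bound => i; rewrite lt_min !subr_gt0 loz zhi.
have [e [e0 er1 er2 eom [ek em]]] : exists e : R,
    [/\ 0 < e, e <= r1, e <= r2, e <= om & e *+ 2 <= k /\ e < m].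
  exists (Num.min (Num.min r1 r2) (Num.min (Num.min om (k / 2)) (m / 2))).
  split; rewrite ?ge_min ?lexx ?orbT//.
    by rewrite !lt_min r10 r20 om0 !divr_gt0.
  split; first by rewrite -[leLHS]mulr_natr -ler_pdivlMr// !ge_min lexx !orbT.
  apply: (@le_lt_trans _ _ (m / 2)); first by rewrite !ge_min lexx !orbT.
  by rewrite ltr_pdivrMr// ltr_pMr// ltr1n.
pose c (i : 'I_n) : R := z 0 i.
have inside y : box (fun i => c i - e) (fun i => c i + e + (if i == j then k else 0)) y ->
    forall i, lo i < y 0 i < hi i.
  move=> yb i; have := hm i; rewrite le_min => /andP[m1 m2].
  exact: in_open_interval_margin m1 m2 em (yb i).
have insideU y : (forall i, lo i < y 0 i < hi i) -> U y.
  move=> /(_ i0)/andP[y1 y2]; rewrite /U /=.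
  by rewrite (le_lt_trans lo0 y1) (lt_le_trans y2 hiT).
have BU : box (fun i => c i - e) (fun i => c i + e + (if i == j then k else 0)) `<=` U.
  by move=> y /inside /insideU.
have [k' kk' hk'] := bump_mean_increment hS wg (eps := fun=> e) (fun=> e0) ek BU mgam gam0
  (fun y yb => gjb y (inside y yb)).
have k'0 : 0 <= k' by case/andP: kk' => h _; apply: le_trans h; rewrite subr_ge0.
have {}hk' := le_trans hk' (hY e k' e0 ek kk' k'0).
rewrite lee_fin in hk'.
have m1 : `|bump_mean S U g c (fun=> e) - g z| <= om.
  apply: (bump_mean_near hS) => //.
    move=> y yb; apply: BU => i; have /andP[y1 y2] := yb i; rewrite y1 /=.
    by rewrite (le_trans y2)// lerDl; case: (i == j) => //; exact: ltW.
  move=> y yb; apply: h1 => i; apply: le_trans er1.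
  by rewrite ler_distl; exact: yb.
have m2 : `|bump_mean S U g (fun i => c i + (if i == j then k else 0)) (fun=> e)
    - g (z + k *: delta_mx 0 j)| <= om.
  have zE i : (z + k *: delta_mx 0 j) 0 i = c i + (if i == j then k else 0).
    by rewrite !mxE eqxx /=; case: (i == j); rewrite ?mulr1 ?mulr0.
  apply: (bump_mean_near hS) => //.
    move=> y yb; apply: BU => i; apply: in_interval_widen (yb i).
      by case: (i == j) => //; exact: ltW.
    by case: (i == j).
  move=> y yb; apply: h2 => i; apply: le_trans er2; rewrite zE.
  by rewrite ler_distl; exact: yb.
have c0k : `|c0 * k' - c0 * k| <= `|c0| * (e *+ 2).
  by rewrite -mulrBr normrM ler_wpM2l// ler_distl.
have wE : w = om * C by rewrite /om divfK// gt_eqF.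
have eD : e * D <= om * D by rewrite ler_wpM2r.
have ec : `|c0| * (e *+ 2) <= om * (`|c0| *+ 2).
  by rewrite !mulrnAr lerMn2r /= mulrC ler_wpM2r.
have h3 : `|bump_mean S U g (fun i => c i + (if i == j then k else 0)) (fun=> e)
    - bump_mean S U g c (fun=> e) - c0 * k| <= Y + e * D + `|c0| * (e *+ 2).
  apply: le_trans (lerD hk' c0k); apply: le_trans (ler_normD _ _).
  by rewrite le_eqVlt; apply/orP; left; apply/eqP; congr (`|_|); ring.
apply: (le_trans (le_increment m1 m2 h3)); rewrite wE /C.
apply: (@le_trans _ _ (Y + om * D + om * (`|c0| *+ 2) + om + om)).
  by rewrite !lerD2r lerD// lerD2l.
by rewrite le_eqVlt; apply/orP; left; apply/eqP; ring.
Qed.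

End pointwise_increments.

Lemma line_continuous (R : realType) (V : normedModType R) (p q : V) :
  continuous (fun h : R => p + h *: q).
Proof.
move=> h; apply: (@cvgD _ _ _ _ _ (fun=> p) (fun h : R => h *: q)); first exact: cvg_cst.
by apply: (@cvgZr_tmp _ _ _ _ _ id); exact: cvg_id.
Qed.

Lemma le_limit_at0 (R : realType) (phi : R -> R) (Y : R) :
  continuous phi -> (forall h, 0 < h < 1 -> phi h <= Y) -> phi 0 <= Y.
Proof.
move=> cphi hY; apply/ler_addgt0Pr => /= e e0.
have /cvgrPdist_le/(_ e e0)/nbhs_ballP[r /= r0 hr] := cphi 0.
pose h := Num.min (r / 2) 2^-1.
have h0 : 0 < h by rewrite /h lt_min divr_gt0//= invr_gt0.
have h1 : h < 1 by rewrite /h gt_min orbC invf_lt1 ?ltr1n.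
have hh : h < r.
  by rewrite /h gt_min ltr_pdivrMr// ltr_pMr// ltr1n.
have := hr h; rewrite /ball /= sub0r normrN gtr0_norm// => /(_ hh).
by move=> /(le_trans (ler_norm _)); have := hY h; rewrite h0 h1 => /(_ isT); lra.
Qed.

Section time_coordinate.
Context {R : realType} {n : nat} (i0 : 'I_n).
Implicit Types (z y : 'rV[R]_n) (g : 'rV[R]_n -> R) (lo hi : 'I_n -> R).

Definition settime z (t : R) : 'rV[R]_n := \row_i if i == i0 then t else z 0 i.

Definition in_space lo hi z := forall i, i != i0 -> lo i < z 0 i < hi i.

Lemma settimeE z t i : settime z t 0 i = if i == i0 then t else z 0 i.
Proof. by rewrite mxE. Qed.

Lemma settime_id z : settime z (z 0 i0) = z.
Proof. by apply/rowP => i; rewrite mxE; case: eqP => // ->. Qed.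

Lemma settimeD z s t : settime z t = settime z s + (t - s) *: delta_mx 0 i0.
Proof.
by apply/rowP => i; rewrite !mxE eqxx /=; case: eqP => _; rewrite ?mulr1 ?mulr0 ?addr0// addrC subrK.
Qed.

Lemma in_space_settime lo hi z t : in_space lo hi z -> in_space lo hi (settime z t).
Proof. by move=> hz i ii; rewrite mxE (negbTE ii); exact: hz. Qed.

(** An increment bound extends from the open time interval to its closure, by
    contracting the times towards the midpoint. *)
Lemma increment_closed g j lo hi (a b c0 Y delta : R) :
  continuous g -> a < b -> 0 <= Y ->
  (forall z (k : R), 0 < k -> in_space lo hi z -> in_space lo hi (z + k *: delta_mx 0 j) ->
    a < z 0 i0 -> (z + k *: delta_mx 0 j) 0 i0 < b ->
    `|g (z + k *: delta_mx 0 j) - g z - c0 * k| <= Y + delta * k) ->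
  forall z (k : R), 0 <= k -> in_space lo hi z -> in_space lo hi (z + k *: delta_mx 0 j) ->
    a <= z 0 i0 -> (z + k *: delta_mx 0 j) 0 i0 <= b ->
    `|g (z + k *: delta_mx 0 j) - g z - c0 * k| <= Y + delta * k.
Proof.
move=> cg ab Y0 hop z k; rewrite le_eqVlt => /predU1P[<- _ _ _ _|k0 sz szk az zb].
  by rewrite scale0r addr0 subrr !mulr0 subr0 normr0 addr0.
pose m := (a + b) / 2.
pose kk : R := if j == i0 then k else 0.
pose zh h := z + h *: ((m - z 0 i0) *: delta_mx 0 i0).
pose y := z + k *: delta_mx 0 j.
pose yh h := y + h *: ((m - z 0 i0) *: delta_mx 0 i0 - kk *: delta_mx 0 j).
have yhE h : yh h = zh h + (k - h * kk) *: delta_mx 0 j.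
  by apply/rowP => i; rewrite !mxE; ring.
(* [zh] and [yh] move the two end points towards the time [m]; the increment
   [k - h * kk] shrinks accordingly when [j] is the time direction. *)
pose phi (h : R) : R := `|g (yh h) - g (zh h) - (c0 * k + h * (- (c0 * kk)))| -
  (delta * k + h * (- (delta * kk))).
suff : phi 0 <= Y by rewrite /phi /yh /zh !scale0r !addr0 -/y !mul0r !addr0; lra.
apply: le_limit_at0.
  have cc (p q : R) : continuous (fun h : R => p + h * q) by exact: (@line_continuous R R^o p q).
  have cy : continuous (g \o yh).
    by move=> h; apply: continuous_comp; [exact: line_continuous|exact: cg].
  have cz : continuous (g \o zh).
    by move=> h; apply: continuous_comp; [exact: line_continuous|exact: cg].
  move=> h; apply: (@continuousB _ _ _ (fun h => `|g (yh h) - g (zh h) - (c0 * k + h * (- (c0 * kk)))|)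
    (fun h => delta * k + h * (- (delta * kk)))); last exact: cc.
  apply: (@continuous_comp _ _ _ (fun h => g (yh h) - g (zh h) - (c0 * k + h * (- (c0 * kk)))) Num.norm); last exact: norm_continuous.
  apply: (@continuousB _ _ _ (fun h => g (yh h) - g (zh h)) (fun h => c0 * k + h * (- (c0 * kk)))); last exact: cc.
  by apply: (@continuousB _ _ _ (g \o yh) (g \o zh)); [exact: cy|exact: cz].
move=> h /andP[h0 h1].
have zh0 i : zh h 0 i = if i == i0 then z 0 i + h * (m - z 0 i0) else z 0 i.
  by rewrite !mxE eqxx /=; case: eqP => _; rewrite ?mulr1 ?mulr0 ?addr0.
have y0 : y 0 i0 = z 0 i0 + kk.
  by rewrite /y /kk !mxE eqxx /= eq_sym; case: eqP => _; rewrite ?mulr1 ?mulr0.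
have hkk : h * kk < k.
  rewrite /kk; case: eqP => _; rewrite ?mulr0//; nra.
have := hop (zh h) (k - h * kk); rewrite -yhE subr_gt0 hkk.
have szh : in_space lo hi (zh h).
  by move=> i ii; rewrite zh0 (negbTE ii); exact: sz.
have syh : in_space lo hi (yh h).
  move=> i ii; have := szk i ii; rewrite -/y /yh !mxE (negbTE ii) andbF mulr0 sub0r.
  by rewrite /kk; case: (eqVneq j i0) => [->|_]; rewrite ?(negbTE ii) ?andbF ?mulr0 ?mul0r ?oppr0 ?mulr0 ?addr0.
have yh0 : yh h 0 i0 = z 0 i0 + kk + h * (m - z 0 i0 - kk).
  rewrite /yh; move: y0; move: (y) => y' y0; rewrite !mxE y0 !eqxx /= mulr1.
  by rewrite /kk eq_sym; case: (eqVneq j i0) => _; rewrite ?mulr1 ?mul0r.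
move=> /(_ isT szh syh); rewrite zh0 eqxx yh0.
have zm : z 0 i0 + kk <= b by rewrite -y0.
have am : a < z 0 i0 + h * (m - z 0 i0) by rewrite /m; nra.
have bm : z 0 i0 + kk + h * (m - z 0 i0 - kk) < b by rewrite /m; nra.
move=> /(_ am bm); rewrite /phi !mulrN.
rewrite (_ : c0 * k - h * (c0 * kk) = c0 * (k - h * kk)); last by ring.
by move=> hh; rewrite lerBlDr (le_trans hh)// le_eqVlt; apply/orP; left; apply/eqP; ring.
Qed.

End time_coordinate.

Section increments_on_windows.
Context {R : realType} {n : nat} (i0 : 'I_n) (T : R).
Context (S : nat -> R -> R) (M : R) (hS : step_jet S M).
Local Notation leb := (@lebesgue_measure R).
Implicit Types (z y : 'rV[R]_n) (g : 'rV[R]_n -> R) (lo hi : 'I_n -> R).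

Let U := [set z : 'rV[R]_n | 0 < z 0 i0 < T].

(** The mean value inequality for a weak derivative close to a constant. *)
Lemma const_increment g gj j lo hi (a b c0 delta : R) :
  continuous g -> weak_partial U g gj j -> 0 <= a -> a < b -> b <= T -> 0 <= delta ->
  (forall y, in_space i0 lo hi y -> a <= y 0 i0 <= b -> `|gj y - c0| <= delta) ->
  forall z (k : R), 0 <= k -> in_space i0 lo hi z -> in_space i0 lo hi (z + k *: delta_mx 0 j) ->
    a <= z 0 i0 -> (z + k *: delta_mx 0 j) 0 i0 <= b ->
    `|g (z + k *: delta_mx 0 j) - g z - c0 * k| <= delta * k.
Proof.
move=> cg wg a0 ab bT d0 hd z k k0 sz szk az zb.
rewrite -[leRHS]add0r; move: z k k0 sz szk az zb.
apply: increment_closed => // z k k0 sz szk az zb; rewrite add0r.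
apply: (@weak_increment_le _ _ i0 T S M hS g gj j z k c0 (fun i => if i == i0 then a else lo i)
  (fun i => if i == i0 then b else hi i) (cst delta%:E) (delta * k) (delta * 2)) => //.
- by move=> i; case: eqP => [->//|/eqP ii]; have /andP[] := sz i ii.
- move=> i; have -> : z 0 i + (if i == j then k else 0) = (z + k *: delta_mx 0 j) 0 i.
    by rewrite !mxE eqxx /=; case: (i == j); rewrite ?mulr1 ?mulr0.
  by case: eqP => [->//|/eqP ii]; have /andP[] := szk i ii.
- by rewrite eqxx.
- by rewrite eqxx.
- move=> y yb; rewrite lee_fin; apply: hd.
    by move=> i ii; have := yb i; rewrite (negbTE ii).
  by have := yb i0; rewrite eqxx => /andP[? ?]; rewrite !ltW.
- by rewrite mulr_ge0.
- move=> e k' e0 ek /andP[k1 k2] k'0.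
  have mp : measurable_fun setT (fun x => (plateau S (z ord0 j) k e 0 x)%:E).
    by apply/measurable_EFinP; apply: continuous_measurable_fun; exact: (plateau_continuous hS).
  have mb : measurable_fun setT (fun x => (bump S (z ord0 i0) e 0 x)%:E).
    by apply/measurable_EFinP; apply: continuous_measurable_fun; exact: (bump_continuous hS).
  have hk : (delta%:E * (k + e *+ 2)%:E <= (delta * k + e * (delta * 2))%:E)%E.
    by rewrite -EFinM lee_fin mulrCA -mulrDr mulr_natr.
  case: eqP => [_|_].
    rewrite ge0_integralZl//; last first.
      by move=> x _; rewrite lee_fin; case/andP: (plateau_01 hS (z ord0 j) x e0 ek).
    apply: le_trans hk; rewrite lee_wpmul2l ?lee_fin//.
    by case/andP: (integral_plateau hS (z ord0 j) e0 ek).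
  rewrite ge0_integralZl//; last first.
    by move=> x _; rewrite lee_fin; case/andP: (bump_ge0 hS (z ord0 i0) x e0).
  rewrite (integral_bump hS)// mule1 muleC; apply: le_trans hk.
  by rewrite lee_wpmul2l ?lee_fin.
Qed.

Section dominated.
Context (g gj : 'rV[R]_n -> R) (j : 'I_n) (lo hi : 'I_n -> R) (a b G : R) (gam : R -> \bar R).
Hypotheses (cg : continuous g) (wg : weak_partial U g gj j).
Hypotheses (a0 : 0 <= a) (ab : a < b) (bT : b <= T).
Hypotheses (mgam : measurable_fun `[a, b] gam)
  (gam0 : forall x, a <= x <= b -> (0 <= gam x)%E)
  (hgam : forall y, in_space i0 lo hi y -> a <= y 0 i0 <= b ->
     (`|gj y|%:E <= gam (y ord0 i0))%E)
  (hG : (\int[leb]_(x in `[a, b]) gam x <= G%:E)%E).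

Let gam' := gam \_ `[a, b].

Let mgam' : measurable_fun setT gam'.
Proof. exact: (measurable_restrictT _ _).1. Qed.

Let gam'0 x : (0 <= gam' x)%E.
Proof.
by rewrite /gam' patchE mem_setE in_itv /=; case: ifP => // /gam0.
Qed.

Let gam'E x : a < x < b -> gam' x = gam x.
Proof.
by move=> /andP[? ?]; rewrite /gam' patchE mem_setE in_itv /= ifT// !ltW.
Qed.

Let G0 : 0 <= G.
Proof.
rewrite -lee_fin; apply: le_trans hG; apply: integral_ge0 => x.
by rewrite /= in_itv; exact: gam0.
Qed.

Let igam' : (\int[leb]_x gam' x <= G%:E)%E.
Proof. by rewrite -integral_mkcond. Qed.

(** In the time direction the dominating function is itself integrated, so the
    total [G] bounds every increment. *)
Lemma time_increment z s t : j = i0 -> in_space i0 lo hi z ->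
  a <= s <= b -> a <= t <= b -> `|g (settime i0 z t) - g (settime i0 z s)| <= G.
Proof.
move=> ji sz /andP[sa sb] /andP[ta tb].
wlog st : s t sa sb ta tb / s <= t => [hw|].
  by have [/hw ->//|/ltW/hw] := leP s t; rewrite distrC; apply.
have h : forall z (k : R), 0 <= k -> in_space i0 lo hi z -> in_space i0 lo hi (z + k *: delta_mx 0 i0) ->
    a <= z 0 i0 -> (z + k *: delta_mx 0 i0) 0 i0 <= b ->
    `|g (z + k *: delta_mx 0 i0) - g z - 0 * k| <= G + 0 * k.
  apply: increment_closed => // y k k0 sy syk ay yb; rewrite [X in _ <= _ + X]mul0r addr0.
  apply: (@weak_increment_le _ _ i0 T S M hS g gj i0 y k 0 (fun i => if i == i0 then a else lo i)
    (fun i => if i == i0 then b else hi i) gam' G 0) => //.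
  - by have := wg; rewrite ji.
  - by move=> i; case: eqP => [->//|/eqP ii]; have /andP[] := sy i ii.
  - move=> i; have -> : y 0 i + (if i == i0 then k else 0) = (y + k *: delta_mx 0 i0) 0 i.
      by rewrite !mxE eqxx /=; case: (i == i0); rewrite ?mulr1 ?mulr0.
    by case: eqP => [->//|/eqP ii]; have /andP[] := syk i ii.
  - by rewrite eqxx.
  - by rewrite eqxx.
  - move=> w wb; rewrite subr0; have := wb i0; rewrite eqxx => /andP[w1 w2].
    rewrite gam'E ?w1//; apply: hgam; last by rewrite !ltW.
    by move=> i ii; have := wb i; rewrite (negbTE ii).
  - move=> e k' e0 ek _ _; rewrite eqxx mulr0 addr0; apply: le_trans igam'.
    apply: ge0_le_integral => //.
    + by move=> x _; rewrite mule_ge0// lee_fin; case/andP: (plateau_01 hS (y ord0 i0) x e0 ek).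
    + apply: emeasurable_funM => //; apply/measurable_EFinP.
      by apply: continuous_measurable_fun; exact: (plateau_continuous hS).
    + move=> x _; rewrite -[leRHS]mule1 lee_wpmul2l// lee_fin.
      by case/andP: (plateau_01 hS (y ord0 i0) x e0 ek).
have := h (settime i0 z s) (t - s); rewrite -settimeD !mul0r subr0 addr0 subr_ge0 !settimeE eqxx.
apply => //; exact: in_space_settime.
Qed.

(** The average of the second derivative over the window is used at the scale of
    the window itself, since no bound is available at an individual time. *)
Lemma space_increment z (k D : R) : j != i0 -> 0 <= k -> 0 <= D ->
  in_space i0 lo hi z -> in_space i0 lo hi (z + k *: delta_mx 0 j) ->
  a <= z 0 i0 <= b ->
  (forall y t, in_space i0 lo hi y -> a <= y 0 i0 <= b -> a <= t <= b ->
     `|g (settime i0 y t) - g y| <= D) ->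
  `|g (z + k *: delta_mx 0 j) - g z| <= D *+ 2 + k * (4 * M / (b - a)) * G.
Proof.
move=> ji; rewrite le_eqVlt => /predU1P[<-|k0] D0 sz szk zab hD.
  by rewrite scale0r addr0 subrr normr0 mul0r mul0r addr0 mulrn_wge0.
have M0 : 0 <= M by have [_ _ _ _ [_ /(_ 0)/andP[]]] := hS; exact: le_trans.
(* The kernel in time has half-width [e0] around the midpoint of [a, b], the
   kernels in space shrink with [e]. *)
pose e0 := (b - a) / 4.
have e00 : 0 < e0 by rewrite divr_gt0// subr_gt0.
have Me0 : 0 <= M / e0 by rewrite divr_ge0// ltW.
pose K := 4 * M / (b - a) * G.
have K0 : 0 <= K by rewrite /K !mulr_ge0// invr_ge0 subr_ge0 ltW.
apply/ler_addgt0Pr => /= w w0.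
pose om := w / (2 + K *+ 2).
have C0 : 0 < 2 + K *+ 2 by rewrite ltr_wpDr// mulrn_wge0.
have om0 : 0 < om by rewrite divr_gt0.
have [r1 r10 h1] := continuous_coord_modulus z cg om0.
have [r2 r20 h2] := continuous_coord_modulus (z + k *: delta_mx 0 j) cg om0.
have [m m0 hm] : exists2 m : R, 0 < m & forall i, m <= if i == i0 then 1 else
    Num.min (z 0 i - lo i) (hi i - (z + k *: delta_mx 0 j) 0 i).
  apply: finite_positive_lower_bound => i; case: eqP => // /eqP ii.
  by rewrite lt_min !subr_gt0; have /andP[-> _] := sz i ii; have /andP[_ ->] := szk i ii.
have [e [e0' er1 er2 eom [ek em]]] : exists e : R,
    [/\ 0 < e, e <= r1, e <= r2, e <= om & e *+ 2 <= k /\ e < m].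
  exists (Num.min (Num.min r1 r2) (Num.min (Num.min om (k / 2)) (m / 2))).
  split; rewrite ?ge_min ?lexx ?orbT//.
    by rewrite !lt_min r10 r20 om0 !divr_gt0.
  split; first by rewrite -[leLHS]mulr_natr -ler_pdivlMr// !ge_min lexx !orbT.
  apply: (@le_lt_trans _ _ (m / 2)); first by rewrite !ge_min lexx !orbT.
  by rewrite ltr_pdivrMr// ltr_pMr// ltr1n.
pose eps (i : 'I_n) : R := if i == i0 then e0 else e.
pose c (i : 'I_n) : R := if i == i0 then (a + b) / 2 else z 0 i.
have eps0 i : 0 < eps i by rewrite /eps; case: ifP.
have epsj : eps j = e by rewrite /eps (negbTE ji).
have zkE i : (z + k *: delta_mx 0 j) 0 i = z 0 i + (if i == j then k else 0).
  by rewrite !mxE eqxx /=; case: (i == j); rewrite ?mulr1 ?mulr0.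
set B := box (fun i => c i - eps i) (fun i => c i + eps i + (if i == j then k else 0)).
have inside y : B y -> in_space i0 lo hi y /\ a < y 0 i0 < b.
  move=> yb; split.
    move=> i ii; have := yb i; have := hm i; rewrite /c /eps (negbTE ii) le_min zkE => /andP[m1 m2].
    exact: in_open_interval_margin m1 m2 em.
  have := yb i0; rewrite /c /eps eqxx eq_sym (negbTE ji) /e0; move: ab.
  by move=> ? /andP[? ?]; apply/andP; split; lra.
have BU : B `<=` U.
  by move=> y /inside[_ /andP[y1 y2]]; rewrite /U /= (le_lt_trans a0 y1) (lt_le_trans y2 bT).
have [Lg _ _] := wg.
have ek' : eps j *+ 2 <= k by rewrite epsj.
have hB y : B y -> (`|gj y - 0|%R%:E <= gam' (y ord0 i0))%E.
  move=> /inside[sy /andP[y1 y2]]; rewrite subr0 gam'E ?y1//.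
  by apply: hgam => //; rewrite !ltW.
have [k' /andP[k1 k2]] := bump_mean_increment hS (i0 := i0) (c0 := 0) wg eps0 ek' BU mgam' gam'0 hB.
rewrite epsj in k1 k2; rewrite eq_sym (negbTE ji) mul0r subr0 => hk.
have k'0 : 0 <= k' by apply: le_trans k1; rewrite subr_ge0.
have {}hk : `|bump_mean S U g (fun i => c i + (if i == j then k else 0)) eps
    - bump_mean S U g c eps| <= k' * K.
  rewrite -lee_fin (le_trans hk)// EFinM lee_wpmul2l ?lee_fin//.
  apply: (@le_trans _ _ (\int[leb]_x (gam' x * (M / e0)%:E))%E).
    apply: ge0_le_integral => //.
    + by move=> x _; rewrite mule_ge0// lee_fin; case/andP: (bump_ge0 hS (c i0) x (eps0 i0)).
    + apply: emeasurable_funM => //; apply/measurable_EFinP.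
      by apply: continuous_measurable_fun; exact: (bump_continuous hS).
    + exact: emeasurable_funM.
    + move=> x _; rewrite lee_wpmul2l// lee_fin.
      by case/andP: (bump_ge0 hS (c i0) x (eps0 i0)); rewrite /eps eqxx.
  rewrite ge0_integralZr ?lee_fin//.
  have -> : K = G * (M / e0).
    rewrite /K /e0; field; move: ab; rewrite -subr_gt0 => h; rewrite gt_eqF//; split => //.
  by rewrite [leRHS]EFinM lee_wpmul2r ?lee_fin.
have near_mean (y : 'rV[R]_n) (b' : bool) r : 0 < r -> e <= r -> in_space i0 lo hi y -> a <= y 0 i0 <= b ->
    (forall i, i != i0 -> y 0 i = c i + (if b' && (i == j) then k else 0)) ->
    (forall x : 'rV[R]_n, (forall i, `|x 0 i - y 0 i| <= r) -> `|g x - g y| <= om) ->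
    `|bump_mean S U g (fun i => c i + (if b' && (i == j) then k else 0)) eps - g y| <= D + om.
  move=> r0 er sy yab yE hy.
  have inB x : box (fun i => c i + (if b' && (i == j) then k else 0) - eps i)
      (fun i => c i + (if b' && (i == j) then k else 0) + eps i) x -> B x.
    move=> xb i; apply: in_interval_widen (xb i); case: b' {xb yE}; case: (i == j) => //=;
      exact: ltW.
  apply: (bump_mean_near hS) => //; first by move=> x /inB /BU.
  move=> x xb; have [sx /andP[x1 x2]] := inside x (inB x xb).
  have q1 : `|g (settime i0 x (y 0 i0)) - g x| <= D by apply: hD => //; rewrite !ltW.
  have q2 : `|g (settime i0 x (y 0 i0)) - g y| <= om.
    apply: hy => i; rewrite settimeE; case: eqP => [->|/eqP ii]; first by rewrite subrr normr0 ltW.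
    apply: le_trans er; have := xb i; rewrite (yE i ii) /eps (negbTE ii).
    by rewrite ler_distl.
  exact: ler_dist_center q1 q2.
have zi0 : (z + k *: delta_mx 0 j) 0 i0 = z 0 i0 by rewrite zkE eq_sym (negbTE ji) addr0.
have m1 := near_mean z false r1 r10 er1 sz zab _ h1.
have {}m1 := m1 (ltac:(by move=> i ii; rewrite /c (negbTE ii) addr0)).
have m2 := near_mean (z + k *: delta_mx 0 j) true r2 r20 er2 szk _ _ h2.
rewrite zi0 in m2.
have {}m2 := m2 zab (ltac:(by move=> i ii; rewrite zkE /c (negbTE ii))).
rewrite /= in m1 m2.
have c0E : (fun i => c i + 0) = c by apply/funext => i; rewrite addr0.
rewrite c0E in m1.
have kK : k' * K <= k * K + (e *+ 2) * K by rewrite -mulrDl ler_wpM2r.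
have eK : (e *+ 2) * K <= om * (K *+ 2).
  by rewrite mulrnAr mulrnAl lerMn2r /= ler_wpM2r.
have wE : w = om * 2 + om * (K *+ 2) by rewrite -mulrDr /om divfK// gt_eqF.
have -> : k * (4 * M / (b - a)) * G = k * K by rewrite /K !mulrA.
have h3 := le_increment (d := 0) m1 m2; rewrite !subr0 in h3.
apply: (le_trans (h3 _ hk)); rewrite wE mulr_natr.
apply: (@le_trans _ _ (k * K + om * (K *+ 2) + (D + om) + (D + om))).
  by rewrite !lerD2r (le_trans kK)// lerD2l.
by rewrite le_eqVlt; apply/orP; left; apply/eqP; ring.
Qed.

End dominated.
End increments_on_windows.

Section almost_affine.
Context {R : realType} {n : nat} (i0 : 'I_n) (T : R).
Context (S : nat -> R -> R) (M : R) (hS : step_jet S M).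
Local Notation leb := (@lebesgue_measure R).
Implicit Types (z y : 'rV[R]_n) (g : 'rV[R]_n -> R).

Let U := [set z : 'rV[R]_n | 0 < z 0 i0 < T].

Context (lo hi : 'I_n -> R) (a b : R).
Hypotheses (a0 : 0 <= a) (ab : a < b) (bT : b <= T).

Definition in_window z := in_space i0 lo hi z /\ a <= z 0 i0 <= b.

Let pw (i : 'I_n) (x : R) : Prop := if i == i0 then a <= x <= b else lo i < x < hi i.

Let pwP z : in_window z <-> forall i, pw i (z 0 i).
Proof.
rewrite /pw; split=> [[sz tz] i|h]; first by case: eqP => [->//|/eqP]; exact: sz.
by split=> [i ii|]; [have := h i; rewrite (negbTE ii)|have := h i0; rewrite eqxx].
Qed.

Lemma const_oscillation g (gi : 'I_n -> 'rV[R]_n -> R) (c : 'I_n -> R) (delta : R) :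
  continuous g -> (forall i, weak_partial U g (gi i) i) -> 0 <= delta ->
  (forall i y, in_window y -> `|gi i y - c i| <= delta) ->
  forall z z', in_window z -> in_window z' ->
    `|g z' - g z - \sum_j c j * (z' 0 j - z 0 j)| <= delta * \sum_j `|z' 0 j - z 0 j|.
Proof.
move=> cg wg d0 hd z z' /pwP wz /pwP wz'; rewrite mulr_sumr.
apply: (@telescope_coordinates _ _ pw g c (fun _ k => delta * k)) => // j y k k0 /pwP[sy /andP[ty _]] /pwP[syk /andP[_ tyk]].
apply: (@const_increment _ _ i0 T S M hS g (gi j) j lo hi a b) => //.
by move=> x sx tx; apply: hd.
Qed.

(** A function whose weak gradient is dominated by an integrable function of time
    oscillates by a multiple of its integral, in space as well as in time, on
    windows not much wider than long. *)
Lemma oscillation g (gi : 'I_n -> 'rV[R]_n -> R) (gam : R -> \bar R) (G r : R) :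
  continuous g -> (forall i, weak_partial U g (gi i) i) ->
  measurable_fun `[a, b] gam -> (forall x, a <= x <= b -> (0 <= gam x)%E) ->
  (forall i y, in_window y -> (`|gi i y|%:E <= gam (y ord0 i0))%E) ->
  (\int[leb]_(x in `[a, b]) gam x <= G%:E)%E ->
  0 <= r -> (forall i, i != i0 -> hi i - lo i <= r) ->
  forall z z', in_window z -> in_window z' ->
    `|g z' - g z| <= n%:R * ((2 + r * (4 * M / (b - a))) * G).
Proof.
move=> cg wg mgam gam0 hgam hG r0 hr z z' wz wz'.
have G0 : 0 <= G.
  rewrite -lee_fin; apply: le_trans hG; apply: integral_ge0 => x.
  by rewrite /= in_itv; exact: gam0.
have M0 : 0 <= M by have [_ _ _ _ [_ /(_ 0)/andP[]]] := hS; exact: le_trans.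
have K0 : 0 <= 4 * M / (b - a) by rewrite divr_ge0 ?mulr_ge0// subr_ge0 ltW.
pose beta (j : 'I_n) (k : R) : R := if j == i0 then G else G *+ 2 + k * (4 * M / (b - a)) * G.
have timeG z1 t : in_space i0 lo hi z1 -> a <= z1 0 i0 <= b -> a <= t <= b ->
    `|g (settime i0 z1 t) - g z1| <= G.
  move=> sz tz tt; rewrite -{2}(settime_id i0 z1).
  apply: (@time_increment _ _ i0 T S M hS g (gi i0) i0 lo hi a b G gam) => //.
  by move=> y sy ty; apply: hgam.
have := @telescope_coordinates _ _ pw g (fun=> 0) beta _ z z' (iffLR (pwP z) wz) (iffLR (pwP z') wz').
rewrite big1 ?subr0; last by move=> j _; rewrite mul0r.
have hb : forall (j : 'I_n) y (k : R), 0 <= k -> (forall i, pw i (y 0 i)) ->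
    (forall i, pw i ((y + k *: delta_mx 0 j) 0 i)) ->
    `|g (y + k *: delta_mx 0 j) - g y - 0 * k| <= beta j k.
  move=> j y k k0 /pwP[sy ty] /pwP[syk tyk]; rewrite mul0r subr0 /beta.
  case: eqP => [ji|/eqP ji].
    have := timeG y ((y + k *: delta_mx 0 j) 0 i0) sy ty tyk.
    rewrite (settimeD _ _ (y 0 i0)) settime_id ji; congr (`|g (_ + _ *: _) - _| <= _).
    by rewrite !mxE !eqxx /=; ring.
  apply: (@space_increment _ _ i0 T S M hS g (gi j) j lo hi a b G gam) => //.
  by move=> x sx tx; apply: hgam.
move=> /(_ hb) /le_trans; apply.
have pos : 0 <= 2 + r * (4 * M / (b - a)) by rewrite addr_ge0// mulr_ge0.
have -> : n%:R * ((2 + r * (4 * M / (b - a))) * G) = \sum_(j < n) ((2 + r * (4 * M / (b - a))) * G).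
  by rewrite sumr_const card_ord mulr_natl.
apply: ler_sum => j _; rewrite /beta; case: eqP => [_|/eqP ji].
  by rewrite -[leLHS]mul1r ler_wpM2r// -[1 in leLHS]addr0 lerD ?ler1n// mulr_ge0.
rewrite [leRHS]mulrDl [2 * G]mulr_natl lerD2l ler_wpM2r// ler_wpM2r//.
apply: le_trans (hr j ji); have [sz _] := wz; have [sz' _] := wz'.
have /andP[? ?] := sz j ji; have /andP[? ?] := sz' j ji.
by rewrite ler_norml; apply/andP; split; lra.
Qed.

End almost_affine.

(** * Regularity of the field *)

Section euclidean_bounds.
Context {R : realType} {d : nat}.
Implicit Types v : 'rV[R]_d.

Lemma edot_ge0 v : 0 <= edot v v.
Proof. by apply: sumr_ge0 => i _; rewrite -expr2 sqr_ge0. Qed.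

Lemma enorm_sqr v : enorm v ^+ 2 = edot v v.
Proof. by rewrite /enorm sqr_sqrtr// edot_ge0. Qed.

Lemma enorm_ge0 v : 0 <= enorm v. Proof. exact: sqrtr_ge0. Qed.

Lemma coord_le_enorm v i : `|v 0 i| <= enorm v.
Proof.
rewrite -ler_sqr ?nnegrE ?enorm_ge0// enorm_sqr real_normK ?num_real//.
rewrite /edot (bigD1 i)//= -expr2 lerDl; apply: sumr_ge0 => j _.
by rewrite -expr2 sqr_ge0.
Qed.

Lemma enorm_le_coord v (K : R) : 0 <= K -> (forall i, `|v 0 i| <= K) -> enorm v <= d%:R * K + 1.
Proof.
move=> K0 vK; have h0 : 0 <= d%:R * K by rewrite mulr_ge0.
rewrite -ler_sqr ?nnegrE ?enorm_ge0 ?addr_ge0// enorm_sqr.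
have h1 : edot v v <= d%:R * K ^+ 2.
  have -> : d%:R * K ^+ 2 = \sum_(i < d) K ^+ 2 by rewrite sumr_const card_ord mulr_natl.
  apply: ler_sum => i _; rewrite -expr2 -real_normK ?num_real//.
  by rewrite ler_sqr ?nnegrE.
apply: (le_trans h1); have [->|d0] := posnP d.
  by rewrite !mul0r add0r expr1n.
have d1 : 1 <= d%:R :> R by rewrite ler1n.
have h2 : d%:R * K ^+ 2 <= (d%:R * K) ^+ 2.
  by rewrite exprMn expr2 -mulrA ler_peMl// mulr_ge0// sqr_ge0.
by apply: (le_trans h2); rewrite ler_sqr ?nnegrE ?addr_ge0// lerDl.
Qed.

Lemma enorm0 : enorm (0 : 'rV[R]_d) = 0.
Proof. by rewrite /enorm /edot big1 ?sqrtr0// => i _; rewrite mxE mul0r. Qed.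

End euclidean_bounds.

Lemma within_continuous_comp (X Y Z : topologicalType) (C : set Y) (p : X -> Y) (g : Y -> Z) :
  continuous p -> (forall x, C (p x)) -> {within C, continuous g} -> continuous (g \o p).
Proof.
move=> cp pC cg x; move/subspace_continuousP : cg => /(_ (p x) (pC x)) cg V /cg.
rewrite /= /within /= !nbhs_simpl /= => h.
have := cp x _ h; rewrite /= !nbhs_simpl /=.
by apply: filterS => y /=; apply; exact: pC.
Qed.

Section space_time.
Context {R : realType} {d : nat} (T : R).
Hypothesis T0 : 0 < T.
Implicit Types (t : R) (v : 'rV[R]_d) (z : 'rV[R]_(1 + d)).

Definition itime : 'I_(1 + d) := lshift d ord0.

Definition clamp (lo hi x : R) : R := Num.max lo (Num.min hi x).

Lemma clamp_in lo hi x : lo <= hi -> lo <= clamp lo hi x <= hi.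
Proof. by move=> lh; rewrite /clamp le_max lexx /= ge_max lh ge_min lexx. Qed.

Lemma clamp_id lo hi x : lo <= x <= hi -> clamp lo hi x = x.
Proof. by move=> /andP[h1 h2]; rewrite /clamp (min_idPr h2) (max_idPr h1). Qed.

Lemma clamp_continuous lo hi : continuous (clamp lo hi).
Proof.
move=> x; apply: continuous_max; first exact: cvg_cst.
by apply: continuous_min; [exact: cvg_cst|exact: cvg_id].
Qed.

Lemma clamp_lipschitz lo hi x y : `|clamp lo hi x - clamp lo hi y| <= `|x - y|.
Proof.
wlog xy : x y / x <= y => [hw|].
  by have [/hw//|/ltW/hw] := leP x y; rewrite distrC [leRHS]distrC.
rewrite !(distrC x) !(distrC (clamp _ _ x)) (ger0_norm (_ : 0 <= y - x)) ?subr_ge0//.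
have mono : clamp lo hi x <= clamp lo hi y by rewrite /clamp le_max2// le_min2.
rewrite ger0_norm ?subr_ge0// lerBlDr addrC /clamp ge_max.
have yx : 0 <= y - x by rewrite subr_ge0.
rewrite -[leLHS]addr0 lerD ?le_max ?lexx//=.
have [hx|hx] := leP hi x.
  by rewrite -[leLHS]addr0 lerD// ge_min le_max !lexx orbT.
apply: (@le_trans _ _ y); first by rewrite ge_min lexx orbT.
by rewrite -lerBlDr opprB addrC subrK le_max lexx orbT.
Qed.

Definition st t v : 'rV[R]_(1 + d) := row_mx (const_mx t) v.

Lemma st_time t v : st t v 0 itime = t.
Proof. by rewrite /st /itime row_mxEl mxE. Qed.

Lemma st_space t v i : st t v 0 (rshift 1 i) = v 0 i.
Proof. by rewrite /st row_mxEr. Qed.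

Lemma on_spacetime_st (f : R -> 'rV[R]_d -> 'rV[R]_d) t v : on_spacetime f (st t v) = f t v.
Proof. by rewrite /on_spacetime /st row_mxKl row_mxKr mxE. Qed.

Lemma time_coord z : lsubmx z 0 0 = z 0 itime.
Proof. by rewrite mxE; congr (z _ _). Qed.

Lemma open_cylinderE : @open_cylinder R d T = [set z | 0 < z 0 itime < T].
Proof. by apply/funext => z; rewrite /open_cylinder /= time_coord. Qed.

Lemma space_index (i : 'I_(1 + d)) : i != itime -> exists k, i = rshift 1 k.
Proof.
move=> ii; have [k|k] := splitP i => ik.
  by move: ii; rewrite (_ : i = itime) ?eqxx//; apply: val_inj; rewrite /= ik [k]ord1.
by exists k; apply: val_inj.
Qed.

(** [on_spacetime g] with the time clamped to [0, T]: a globally continuous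
    function agreeing with [g] on the cylinder. *)
Definition clamped (g : R -> 'rV[R]_d -> 'rV[R]_d) (l : 'I_d) z : R :=
  on_spacetime g (settime itime z (clamp 0 T (z 0 itime))) 0 l.

Lemma clampedE g l z : 0 <= z 0 itime <= T -> clamped g l z = on_spacetime g z 0 l.
Proof. by move=> h; rewrite /clamped clamp_id// settime_id. Qed.

Lemma clamped_st g l t v : 0 <= t <= T -> clamped g l (st t v) = g t v 0 l.
Proof. by move=> h; rewrite clampedE ?st_time// on_spacetime_st. Qed.

Lemma settime_clamp_continuous :
  continuous (fun z => settime itime z (clamp 0 T (z 0 itime))).
Proof.
have -> : (fun z => settime itime z (clamp 0 T (z 0 itime))) =
    (fun z => z + ((fun h : R => 0 + h *: delta_mx 0 itime) \o
      (fun z => clamp 0 T (z 0 itime) - z 0 itime)) z).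
  by apply/funext => z; rewrite (settimeD _ _ (z 0 itime)) settime_id /= add0r.
have cs : continuous (fun z : 'rV[R]_(1 + d) => clamp 0 T (z 0 itime) - z 0 itime).
  have cc : continuous (fun z : 'rV[R]_(1 + d) => z 0 itime) by exact: coord_continuous.
  move=> z; apply: (@continuousB _ _ _ (fun z => clamp 0 T (z 0 itime))); last exact: cc.
  by apply: continuous_comp; [exact: cc|exact: clamp_continuous].
move=> z; apply: (@continuousD _ _ _ id); first exact: cvg_id.
by apply: continuous_comp; [exact: cs|exact: line_continuous].
Qed.

Lemma clamped_continuous g l :
  {within @closed_cylinder R d T, continuous (on_spacetime g)} -> continuous (clamped g l).
Proof.
move=> cg.
have h := within_continuous_comp settime_clamp_continuous _ cg.
have {}h := h (ltac:(move=> x; rewrite /closed_cylinder /= time_coord settimeE eqxx;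
  by apply: clamp_in; exact: ltW)).
have cl : continuous (fun v : 'rV[R]_d => v 0 l) by exact: coord_continuous.
by move=> z; exact: continuous_comp (h z) (cl _).
Qed.

Lemma weak_partial_clamped g gj l j :
  weak_partial (@open_cylinder R d T) (fun z => on_spacetime g z 0 l)
    (fun z => on_spacetime gj z 0 l) j ->
  weak_partial [set z | 0 < z 0 itime < T] (clamped g l) (clamped gj l) j.
Proof.
rewrite open_cylinderE => -[Lg Lgj w].
have E h z : (0 < z 0 itime < T) -> clamped h l z = on_spacetime h z 0 l.
  by move=> /andP[z1 z2]; rewrite clampedE// !ltW.
split.
- move=> lo hi bU; refine (eq_integrable (measurable_box lo hi) _ _ _ (Lg lo hi bU)).
  by move=> z; rewrite inE => zb; rewrite /= E//; exact: bU.
- move=> lo hi bU; refine (eq_integrable (measurable_box lo hi) _ _ _ (Lgj lo hi bU)).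
  by move=> z; rewrite inE => zb; rewrite /= E//; exact: bU.
move=> chi lo hi jc sc bU; have := w chi lo hi jc sc bU.
have eqi h (phi : 'rV[R]_(1 + d) -> R) :
    \int[lebesgue_tuple (1 + d)]_(z in rv_of @^-1` [set z | 0 < z 0 itime < T])
      (clamped h l (rv_of z) * phi (rv_of z)) =
    \int[lebesgue_tuple (1 + d)]_(z in rv_of @^-1` [set z | 0 < z 0 itime < T])
      (on_spacetime h (rv_of z) 0 l * phi (rv_of z)).
  by apply: eq_Rintegral => z; rewrite inE => zU; congr (_ * _); exact: E.
by rewrite -!eqi.
Qed.

End space_time.

Section window_energy.
Context {R : realType} (T : R) (gam : R -> \bar R).
Hypotheses (T0 : 0 < T) (Lgam : L2_Rplusoo T gam)
  (gam0 : forall t, 0 <= t <= T -> (0 <= gam t)%E).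
Local Notation leb := (@lebesgue_measure R).

Let mgam : measurable_fun `[0, T] gam. Proof. by have [] := Lgam. Qed.

Let mgam2 : measurable_fun `[0, T] (fun t => gam t ^+ 2)%E.
Proof.
rewrite (_ : (fun t => gam t ^+ 2)%E = (fun t => gam t * gam t)%E).
  exact: emeasurable_funM.
by apply/funext => t; rewrite expe2.
Qed.

Let subT a b : 0 <= a -> b <= T -> `[a, b] `<=` `[0, T].
Proof.
move=> a0 bT x /=; rewrite !in_itv /= => /andP[ax xb].
by rewrite (le_trans a0 ax) (le_trans xb bT).
Qed.

Let g2_0 t : (0 <= gam t ^+ 2)%E.
Proof. by rewrite expe2; case: (gam t) => [r| |]; rewrite ?lee_fin -?expr2 ?sqr_ge0. Qed.

Let q a b : R := fine (\int[leb]_(t in `[a, b]) (gam t ^+ 2))%E.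

Let qE a b : 0 <= a -> b <= T -> (\int[leb]_(t in `[a, b]) (gam t ^+ 2) = (q a b)%:E)%E.
Proof.
move=> a0 bT; rewrite /q fineK// ge0_fin_numE; last by apply: integral_ge0.
have [_ _] := Lgam; apply: le_lt_trans.
by apply: ge0_subset_integral => //; exact: subT.
Qed.

Let q0 a b : 0 <= q a b.
Proof. by apply: fine_ge0; exact: integral_ge0. Qed.

Let q_add a b : 0 <= a -> a <= b -> b <= T -> q 0 a + q a b <= q 0 b.
Proof.
move=> a0 ab bT; rewrite -lee_fin EFinD -!qE//; last exact: le_trans bT.
rewrite -[X in (_ + X <= _)%E]integral_itv_obnd_cbnd; last first.
  apply: measurable_funS mgam2 => //; apply: subset_trans (subT a0 bT).
  by move=> x /=; rewrite !in_itv /= => /andP[/ltW -> ->].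
rewrite -ge0_integral_setU//.
- rewrite -itv_bndbnd_setU ?bnd_simp//.
- rewrite -itv_bndbnd_setU ?bnd_simp//; apply: measurable_funS mgam2 => //.
  exact: subT.
- apply/disj_setPRL => x /=; rewrite !in_itv /= => /andP[xa _] /andP[_ ax].
  by move: xa; rewrite ltNge ax.
Qed.

Let q_len_ge0 a b : a <= b -> 0 <= q a b + (b - a).
Proof. by move=> ab; rewrite addr_ge0// subr_ge0. Qed.

(** Larger than the length of [a, b] and, by Cauchy-Schwarz, than the integral of
    [gam]; its square is [b - a] times an additive function of the interval, which
    gives [sum_window_size]. *)
Definition window_size (a b : R) : R := Num.sqrt ((b - a) * (q a b + (b - a))).

Let wsq a b : a <= b -> window_size a b ^+ 2 = (b - a) * (q a b + (b - a)).
Proof. by move=> ab; rewrite sqr_sqrtr// mulr_ge0 ?subr_ge0// q_len_ge0. Qed.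

Lemma window_size_ge (a b : R) : a <= b -> b - a <= window_size a b.
Proof.
move=> ab; rewrite -ler_sqr ?nnegrE ?subr_ge0 ?sqrtr_ge0// wsq// mulrDr -expr2 lerDr.
by rewrite mulr_ge0 ?subr_ge0.
Qed.

(** Cauchy-Schwarz, as the integral of Young's inequality
    [gam <= s / 2 + gam ^ 2 / (2 s)] for the optimal [s]. *)
Lemma integral_le_window_size (a b : R) : 0 <= a -> a < b -> b <= T ->
  (\int[leb]_(t in `[a, b]) gam t <= (window_size a b)%:E)%E.
Proof.
move=> a0 ab bT; set h := b - a; set E := window_size a b.
have h0 : 0 < h by rewrite subr_gt0.
have hE : h <= E by apply: window_size_ge; exact: ltW.
have E0 : 0 < E by exact: lt_le_trans hE.
pose s := E / h; have s0 : 0 < s by rewrite divr_gt0.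
have EE : E ^+ 2 = h * (q a b + h) by apply: wsq; exact: ltW.
have mI : measurable_fun `[a, b] gam by apply: measurable_funS mgam => //; exact: subT.
have mI2 : measurable_fun `[a, b] (fun t => gam t ^+ 2)%E.
  by apply: measurable_funS mgam2 => //; exact: subT.
have gI t : `[a, b]%classic t -> (0 <= gam t)%E.
  by move=> /(subT a0 bT); rewrite /= in_itv /=; exact: gam0.
apply: (@le_trans _ _ (\int[leb]_(t in `[a, b]) ((s / 2)%:E + (2 * s)^-1%:E * gam t ^+ 2))%E).
  apply: ge0_le_integral => //.
  - by apply: emeasurable_funD => //; exact: emeasurable_funM.
  - move=> t _; rewrite expe2; case: (gam t) => [r| |].
    + rewrite -!EFinM -EFinD lee_fin -subr_ge0.
      rewrite (_ : _ - _ = (r - s) ^+ 2 / (2 * s)); last by field; rewrite gt_eqF.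
      by rewrite divr_ge0 ?sqr_ge0// mulr_ge0// ltW.
    + by rewrite mulyy gt0_muley// lte_fin invr_gt0 mulr_gt0.
    + by rewrite leNye.
have sp : (0 <= (s / 2)%:E)%E by rewrite lee_fin divr_ge0// ltW.
have sp' : (0 <= ((2 * s)^-1)%:E)%E by rewrite lee_fin invr_ge0 mulr_ge0// ltW.
rewrite ge0_integralD//; last 2 first.
- by move=> t _; rewrite mule_ge0.
- exact: emeasurable_funM.
rewrite ge0_integralZl// qE// integral_cst//=.
rewrite lebesgue_measure_itv /= lte_fin ab -EFinB -!EFinM -EFinD lee_fin -/h.
have -> : q a b = E ^+ 2 / h - h by rewrite EE mulrC mulKf ?gt_eqF// addrK.
rewrite /s -subr_ge0 (_ : _ - _ = h * h / (2 * E)).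
  by have h' := ltW h0; have E' := ltW E0; rewrite !(mulr_ge0, divr_ge0, invr_ge0).
by field; rewrite !gt_eqF.
Qed.

Lemma sum_window_size (N : nat) (h : R) : (0 < N)%N -> N%:R * h = T ->
  \sum_(n < N) window_size (n%:R * h) (n.+1%:R * h) ^+ 2 <= h * (q 0 T + T).
Proof.
move=> N0 hN; have N0' : 0 < N%:R :> R by rewrite ltr0n.
have h0 : 0 < h by rewrite -(pmulr_rgt0 _ N0') hN.
have step n : n.+1%:R * h - n%:R * h = h by rewrite -mulrBl -natr1 addrAC subrr add0r mul1r.
have tT n : (n <= N)%N -> n%:R * h <= T by move=> nN; rewrite -hN ler_pM2r// ler_nat.
have hs n : (n <= N)%N -> \sum_(k < n) q (k%:R * h) (k.+1%:R * h) <= q 0 (n%:R * h).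
  elim: n => [_|n ih nN]; first by rewrite big_ord0.
  rewrite big_ord_recr /=; apply: le_trans (q_add (a := n%:R * h) _ _ (tT _ nN)).
  - by rewrite lerD2r ih// ltnW.
  - by rewrite mulr_ge0// ltW.
  - by rewrite ler_pM2r// ler_nat.
rewrite (eq_bigr (fun n : 'I_N => h * (q (n%:R * h) (n.+1%:R * h) + h))); last first.
  by move=> n _; rewrite wsq ?step// ler_pM2r// ler_nat.
rewrite -mulr_sumr ler_wpM2l ?(ltW h0)// big_split /= sumr_const card_ord.
by rewrite -mulr_natl hN lerD2r (le_trans (hs N _))// hN.
Qed.

Lemma window_size_bounded : exists K : R, 0 <= K /\
  (forall a b : R, 0 <= a -> a <= b -> b <= T -> window_size a b <= K) /\
  (forall N (h : R), (0 < N)%N -> N%:R * h = T ->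
    \sum_(n < N) window_size (n%:R * h) (n.+1%:R * h) ^+ 2 <= h * K).
Proof.
have qT0 : 0 <= q 0 T + T by rewrite addr_ge0// ltW.
exists ((T + 1) * (q 0 T + T) + 1); split; first by rewrite addr_ge0// mulr_ge0// addr_ge0// ltW.
split=> [a b a0 ab bT|N h N0 hN].
  apply: (@le_trans _ _ (T * (q 0 T + T) + 1)); last by rewrite lerD2r ler_wpM2r// lerDl.
  have h1 : (b - a) * (q a b + (b - a)) <= T * (q 0 T + T).
    have baT : b - a <= T by rewrite lerBlDr (le_trans bT)// lerDl.
    rewrite ler_pM ?subr_ge0 ?q_len_ge0// lerD//.
    rewrite -lee_fin -!qE//; apply: ge0_subset_integral => //; exact: subT.
  have TT : 0 <= T * (q 0 T + T) by rewrite mulr_ge0// ltW.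
  rewrite -ler_sqr ?nnegrE ?sqrtr_ge0 ?addr_ge0// wsq// (le_trans h1)//.
  by move: TT; move: (T * _) => x x0; nra.
apply: (le_trans (sum_window_size N0 hN)).
have h0 : 0 < h by rewrite -(@pmulr_rgt0 _ N%:R) ?ltr0n// hN.
rewrite ler_wpM2l ?(ltW h0)// -[leLHS]addr0 lerD//.
by rewrite mulrDl mul1r lerDr mulr_ge0// ltW.
Qed.

End window_energy.

Lemma bounded_on_box (R : realType) n m (g : 'I_m -> 'rV[R]_n -> R) lo hi :
  (forall i, continuous (g i)) ->
  exists2 C : R, 0 <= C & forall i z, box lo hi z -> `|g i z| <= C.
Proof.
move=> cg.
have h i : exists C : R, forall z, box lo hi z -> `|g i z| <= C.
  have /compact_bounded[N [_ hN]] : compact (g i @` box lo hi).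
    apply: continuous_compact; last exact: box_compact.
    by apply: continuous_subspaceT; exact: cg.
  exists (`|N| + 1) => z zb.
  by apply: (hN (`|N| + 1)); [rewrite (le_lt_trans (ler_norm N))// ltrDl|exists z].
have [C hC] := choice h.
exists (\sum_i `|C i|); first exact: sumr_ge0.
move=> i z /hC /le_trans; apply; rewrite (bigD1 i)//= (le_trans (ler_norm _))//.
by rewrite lerDl sumr_ge0.
Qed.

Section regularity.
Context {R : realType} {d : nat} (T nu sigma : R) (f : R -> 'rV[R]_d -> 'rV[R]_d).
Hypotheses (T0 : 0 < T) (Rf : assumption_R T nu sigma f).
Local Notation leb := (@lebesgue_measure R).
Implicit Types (v w : 'rV[R]_d) (t s : R).

(** A single constant [L] and window sizes [E] carry all the regularity used
    below: boundedness, the Lipschitz estimate, and a nearly affine behaviour on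
    short space-time windows. *)
Definition regular_on (K L : R) (E : R -> R -> R) :=
  [/\ 0 <= L,
      forall t v l, 0 <= t <= T -> (forall i, `|v 0 i| <= K) -> `|f t v 0 l| <= L,
      forall t s v w l, 0 <= t <= T -> 0 <= s <= T ->
        (forall i, `|v 0 i| <= K) -> (forall i, `|w 0 i| <= K) ->
        `|f t v 0 l - f s w 0 l| <= L * (`|t - s| + \sum_i `|v 0 i - w 0 i|),
      (forall a b : R, 0 <= a -> a < b -> b <= T -> b - a <= E a b <= L) /\
      (forall N (h : R), (0 < N)%N -> N%:R * h = T ->
        \sum_(n < N) E (n%:R * h) (n.+1%:R * h) ^+ 2 <= h * L) &
      forall (a b : R) v0 (r : R), 0 <= a -> a < b -> b <= T -> 0 <= r ->
        (forall i, `|v0 0 i| + r <= K) ->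
        exists (c : 'rV[R]_d) (J : 'M[R]_d),
        [/\ forall l, `|c 0 l| <= L, forall i l, `|J i l| <= L &
          forall t t' w w' l, a <= t <= b -> a <= t' <= b ->
            (forall i, `|w 0 i - v0 0 i| <= r) -> (forall i, `|w' 0 i - v0 0 i| <= r) ->
            `|f t w 0 l - f t' w' 0 l -
              ((t - t') * c 0 l + \sum_i (w 0 i - w' 0 i) * J i l)| <=
            L * (1 + r / (b - a)) * E a b * (`|t - t'| + \sum_i `|w 0 i - w' 0 i|)]].

Lemma sum_space_time (F : 'I_(1 + d) -> R) :
  \sum_j F j = F (itime (d := d)) + \sum_i F (rshift 1 i).
Proof. by rewrite big_split_ord /= big_ord1. Qed.

(** The second derivatives being dominated by [gam], [oscillation] keeps the first
    derivatives within [dl] of their value at one point of a short window;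
    [const_oscillation] then makes [f] affine up to [dl]. *)
Lemma regularity (K : R) : 0 <= K -> exists L E, regular_on K L E.
Proof.
move=> K0; have [cf [Df [wDf cDf _ hgam _]]] := Rf.
have [S [M hS]] := @step_jet_exists R.
have M0 : 0 <= M by have [_ _ _ _ [_ /(_ 0)/andP[]]] := hS; exact: le_trans.
(* Room around the box of size [K] for windows of length at most [T]. *)
pose K' := K + T + 1.
have K'0 : 0 <= K' by rewrite /K' !addr_ge0// ltW.
have kap0 : 0 < d%:R * K' + 1 by rewrite ltr_wpDl// mulr_ge0.
have [gam [Lgam Dgam]] := hgam _ kap0.
have gam0 t : 0 <= t <= T -> (0 <= gam t)%E.
  move=> tT; apply: le_trans (Dgam (fun k => (unit_index (itime (d := d)) k + unit_index (itime (d := d)) k)%N) t 0 _ _ _).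
  - by rewrite lee_fin enorm_ge0.
  - exact: morder_unit_index2.
  - by rewrite in_itv.
  - by rewrite enorm0 ltW.
have [Ke [Ke0 [hKe1 hKe2]]] := window_size_bounded T0 Lgam.
pose g l := clamped T f l.
pose gi l (i : 'I_(1 + d)) := clamped T (Df (unit_index i)) l.
pose gij l (i j : 'I_(1 + d)) := clamped T (Df (fun k => (unit_index i k + unit_index j k)%N)) l.
have cg l : continuous (g l) by apply: clamped_continuous.
have cgi l i : continuous (gi l i).
  by apply: clamped_continuous => //; apply: cDf; exact: morder_unit_index.
pose U := [set z : 'rV[R]_(1 + d) | 0 < z 0 (itime (d := d)) < T].
have wg l i : weak_partial U (g l) (gi l i) i.
  apply: weak_partial_clamped; apply: weak_partial_order1.
  by apply: wDf; rewrite morder_unit_index.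
have wgi l i j : weak_partial U (gi l i) (gij l i j) j.
  apply: weak_partial_clamped; apply: (@weak_partial_order2 _ _ _ (fun z => on_spacetime f z 0 l)).
    by apply: wDf; rewrite morder_unit_index.
  by apply: wDf; rewrite morder_unit_index2.
pose blo (i : 'I_(1 + d)) : R := if i == itime (d := d) then 0 else - K'.
pose bhi (i : 'I_(1 + d)) : R := if i == itime (d := d) then T else K'.
have [C1 C10 hC1] := @bounded_on_box R (1 + d) d g blo bhi cg.
have [C2 C20 hC2] := @bounded_on_box R (1 + d) #|{: 'I_d * 'I_(1 + d)}|
  (fun k => gi (enum_val k).1 (enum_val k).2) blo bhi (fun k => cgi _ _).
have {}hC2 l i z : box blo bhi z -> `|gi l i z| <= C2.
  by have := hC2 (enum_rank (l, i)) z; rewrite enum_rankK.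
have inbox t v : 0 <= t <= T -> (forall i, `|v 0 i| <= K') -> box blo bhi (st t v).
  move=> tT vK i; rewrite /blo /bhi; case: eqP => [->|/eqP ii]; first by rewrite st_time.
  by have [k ->] := space_index ii; rewrite st_space -ler_norml.
pose L := C1 + C2 + Ke + (1 + d)%:R * (2 + 8 * M).
have m0 : 0 <= (1 + d)%:R * (2 + 8 * M) :> R by rewrite mulr_ge0// addr_ge0// mulr_ge0.
have [L0 C1L C2L KeL mL] : [/\ 0 <= L, C1 <= L, C2 <= L, Ke <= L & (1 + d)%:R * (2 + 8 * M) <= L].
  by rewrite /L; move: (_%:R * _) m0 => mm m0; split; lra.
have KK' v : (forall i, `|v 0 i| <= K) -> forall i, `|v 0 i| <= K'.
  by move=> vK i; apply: le_trans (vK i) _; rewrite /K' -addrA lerDl addr_ge0// ltW.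
exists L, (window_size gam); split => //.
- move=> t v l tT vK; rewrite -(clamped_st f l v tT); apply: le_trans C1L.
  by apply: hC1; apply: inbox => //; exact: KK'.
- move=> t s v w l tT sT vK wK; rewrite -(clamped_st f l v tT) -(clamped_st f l w sT).
  have vw (x : 'rV[R]_d) : (forall i, `|x 0 i| <= K) -> forall t, 0 <= t <= T ->
      in_window (itime (d := d)) (fun=> - K') (fun=> K') 0 T (st t x).
    move=> xK y yT; split; last by rewrite st_time.
    move=> i ii; have [k ->] := space_index ii; rewrite st_space -ltr_norml.
    by rewrite (le_lt_trans (xK k))// /K' -addrA ltrDl ltr_wpDl// ltW.
  have := @const_oscillation R (1 + d) (itime (d := d)) T S M hS (fun=> - K') (fun=> K') 0 T
    (lexx _) T0 (lexx _) (g l) (gi l) (fun=> 0) C2 (cg l) (wg l) C20 _ (st s w) (st t v)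
    (vw _ wK _ sT) (vw _ vK _ tT).
  rewrite big1 ?subr0; last by move=> j _; rewrite mul0r.
  rewrite sum_space_time !st_time.
  under eq_bigr do rewrite !st_space.
  move=> h; apply: (le_trans (h _)); last first.
    by rewrite ler_wpM2r// addr_ge0// sumr_ge0.
  move=> i y [sy ty]; rewrite subr0; apply: hC2 => k; rewrite /blo /bhi.
  by case: eqP => [->//|/eqP kk]; have /andP[? ?] := sy k kk; rewrite !ltW.
- split=> [a b a0 ab bT|N h N0 hN].
    apply/andP; split; first by apply: window_size_ge; exact: ltW.
    exact: le_trans (hKe1 _ _ a0 (ltW ab) bT) KeL.
  rewrite (le_trans (hKe2 _ _ N0 hN))// ler_wpM2l//.
  by rewrite -(@pmulr_rge0 _ N%:R) ?ltr0n// hN ltW.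
- move=> a b v0 r a0 ab bT r0 vr.
  set h := b - a; have h0 : 0 < h by rewrite subr_gt0.
  set E := window_size gam a b.
  have E0 : 0 <= E by exact: sqrtr_ge0.
  pose p := st a v0.
  have hT : h <= T by rewrite /h lerBlDr (le_trans bT)// lerDl.
  pose lo i := p 0 i - (r + h); pose hi i := p 0 i + (r + h).
  have aT : 0 <= a <= T by rewrite a0 (le_trans (ltW ab)).
  have vK : forall i, `|v0 0 i| <= K' by apply: KK' => i; apply: le_trans (vr i); rewrite lerDl.
  have stw t w : a <= t <= b -> (forall i, `|w 0 i - v0 0 i| <= r) ->
      in_window (itime (d := d)) lo hi a b (st t w).
    move=> tab wr; split; last by rewrite st_time.
    move=> i ii; have [k ->] := space_index ii; rewrite /lo /hi /p !st_space.
    by rewrite -ltr_distl (le_lt_trans (wr k))// ltrDl.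
  have wp : in_window (itime (d := d)) lo hi a b p.
    by apply: stw => [|i]; [rewrite lexx ltW|rewrite subrr normr0].
  have wtime y : in_window (itime (d := d)) lo hi a b y -> 0 <= y 0 (itime (d := d)) <= T.
    by move=> [_ /andP[y1 y2]]; rewrite (le_trans a0 y1) (le_trans y2 bT).
  have wspace y : in_window (itime (d := d)) lo hi a b y -> forall k, `|rsubmx y 0 k| <= K'.
    move=> [sy _] k; have := sy (rshift 1 k) (ltac:(by rewrite eq_sym -val_eqE)).
    rewrite /lo /hi /p st_space mxE -ltr_distl => /ltW yk.
    have := ler_normD (y 0 (rshift 1 k) - v0 0 k) (v0 0 k); rewrite subrK => /le_trans; apply.
    apply: (le_trans (lerD yk (lexx _))); rewrite addrC addrA.
    by apply: (@le_trans _ _ (K + T)); [rewrite lerD|rewrite /K' lerDl].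
  have dom l i j y : in_window (itime (d := d)) lo hi a b y ->
      (`|gij l i j y|%:E <= gam (y ord0 (itime (d := d))))%E.
    move=> wy; rewrite /gij clampedE ?wtime// -(time_coord y).
    apply: le_trans (Dgam _ _ (rsubmx y) (morder_unit_index2 i j) _ _).
    - by rewrite lee_fin; exact: coord_le_enorm.
    - by rewrite in_itv /= time_coord wtime.
    - by apply: enorm_le_coord => //; exact: wspace.
  have mgam : measurable_fun `[a, b] gam.
    have [mg _ _] := Lgam; apply: measurable_funS mg => //.
    by move=> x /=; rewrite !in_itv /= => /andP[x1 x2]; rewrite (le_trans a0 x1) (le_trans x2 bT).
  have gamab x : a <= x <= b -> (0 <= gam x)%E.
    by move=> /andP[x1 x2]; apply: gam0; rewrite (le_trans a0 x1) (le_trans x2 bT).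
  have hG := integral_le_window_size Lgam gam0 a0 ab bT.
  pose dl := (1 + d)%:R * ((2 + (r + h) *+ 2 * (4 * M / (b - a))) * E).
  have dl0 : 0 <= dl.
    have rh0 : 0 <= (r + h) *+ 2 by rewrite mulrn_wge0// addr_ge0// ltW.
    have Mh0 : 0 <= 4 * M / (b - a) by rewrite divr_ge0 ?mulr_ge0// ltW.
    by rewrite /dl mulr_ge0// mulr_ge0// addr_ge0// mulr_ge0.
  have osc l i y : in_window (itime (d := d)) lo hi a b y -> `|gi l i y - gi l i p| <= dl.
    move=> wy; apply: (@oscillation R (1 + d) (itime (d := d)) T S M hS lo hi a b a0 ab bT
      (gi l i) (gij l i) gam E ((r + h) *+ 2)) => //.
    - by move=> j z wz; exact: dom.
    - by rewrite mulrn_wge0// addr_ge0// ltW.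
    - by move=> j _; rewrite /hi /lo mulr2n; lra.
  have dlL : dl <= L * (1 + r / h) * E.
    rewrite /dl mulrA ler_wpM2r//.
    apply: (@le_trans _ _ ((1 + d)%:R * (2 + 8 * M) * (1 + r / h))); last first.
      by rewrite ler_wpM2r// addr_ge0// divr_ge0// ltW.
    rewrite -[leRHS]mulrA ler_wpM2l// -/h.
    rewrite -subr_ge0 (_ : _ - _ = 2 * (r / h)); last by field; rewrite gt_eqF.
    by rewrite mulr_ge0// divr_ge0// ltW.
  exists (\row_l gi l (itime (d := d)) p), (\matrix_(i, l) gi l (rshift 1 i) p); split.
  - by move=> l; rewrite mxE; apply: le_trans C2L; apply: hC2; exact: inbox.
  - by move=> i l; rewrite mxE; apply: le_trans C2L; apply: hC2; exact: inbox.
  move=> t t' w w' l tab tab' wr wr'.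
  have tT : 0 <= t <= T by have := wtime _ (stw t w tab wr); rewrite st_time.
  have tT' : 0 <= t' <= T by have := wtime _ (stw t' w' tab' wr'); rewrite st_time.
  rewrite -(clamped_st f l w tT) -(clamped_st f l w' tT').
  have := @const_oscillation R (1 + d) (itime (d := d)) T S M hS lo hi a b a0 ab bT
    (g l) (gi l) (fun j => gi l j p) dl (cg l) (wg l) dl0 (fun i y wy => osc l i y wy)
    (st t' w') (st t w) (stw t' w' tab' wr') (stw t w tab wr).
  rewrite !sum_space_time !st_time.
  under eq_bigr do rewrite !st_space.
  under [X in _ <= _ * (_ + X) -> _]eq_bigr do rewrite !st_space.
  rewrite mxE; under [X in _ -> `|_ - (_ + X)| <= _]eq_bigr do rewrite mxE mulrC.
  rewrite [gi l itime p * _]mulrC => /le_trans; apply.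
  by rewrite ler_wpM2r// addr_ge0// sumr_ge0.
Qed.

End regularity.

(** * The local error *)

Section row_vectors.
Context {R : realType} {d : nat}.
Implicit Types (v w : 'rV[R]_d) (u : R -> 'rV[R]_d).

Lemma coord_le_norm v i : `|v 0 i| <= `|v|.
Proof.
rewrite /Num.Def.normr /= mx_normrE (bigmax_sup (ord0, i))//=.
Qed.

Lemma norm_le_coord v (c : R) : 0 <= c -> (forall i, `|v 0 i| <= c) -> `|v| <= c.
Proof.
move=> c0 vc; rewrite /Num.Def.normr /= mx_normrE.
by apply: bigmax_le => // -[i j] _ /=; rewrite ord1.
Qed.

Lemma is_derive_coord u (t : R) v i : is_derive t 1 u v ->
  is_derive t 1 (fun s : R => u s 0 i) (v 0 i).
Proof.
move=> [du Du].
suff cv : h^-1 *: (u (h *: (1 : R) + t) 0 i - u t 0 i) @[h --> 0^'] --> v 0 i.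
  by constructor; [apply/cvg_ex; exists (v 0 i)|exact: cvg_lim].
have cu : h^-1 *: (u (h *: (1 : R) + t) - u t) @[h --> 0^'] --> v.
  by rewrite -Du; exact: du.
have -> : (fun h => h^-1 *: (u (h *: (1 : R) + t) 0 i - u t 0 i)) =
    (fun w => w 0 i) \o (fun h => h^-1 *: (u (h *: (1 : R) + t) - u t)).
  by apply/funext => h /=; rewrite !mxE.
exact: (continuous_cvg _ (@coord_continuous _ _ _ _ _ v) cu).
Qed.

Lemma within_coord u (D : set R) i : {within D, continuous u} ->
  {within D, continuous (fun s => u s 0 i)}.
Proof.
move=> cu x; apply: (@continuous_comp _ _ _ (u : subspace D -> _) (fun w : 'rV[R]_d => w 0 i)).
  exact: cu.
exact: coord_continuous.
Qed.

(** A derivative close to an affine function integrates to a quadratic expansion. *)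
Lemma quadratic_expansion u u' (s t : R) (p q : 'rV[R]_d) (K : R) : s <= t -> 0 <= K ->
  {within `[s, t], continuous u} ->
  (forall r : R, s < r < t -> is_derive r 1 u (u' r)) ->
  (forall r, s < r < t -> `|u' r - p - (r - s) *: q| <= K) ->
  `|u t - u s - (t - s) *: p - ((t - s) ^+ 2 / 2) *: q| <= K * (t - s).
Proof.
move=> st K0 cu du uK; have ts0 : 0 <= t - s by rewrite subr_ge0.
apply: norm_le_coord => [|i]; first exact: mulr_ge0.
move: st; rewrite le_eqVlt => /predU1P[->|st].
  by rewrite !mxE !subrr expr0n /= !mul0r !oppr0 !addr0 normr0 mulr0.
pose psi r : R := u r 0 i - (r - s) * p 0 i - ((r - s) ^+ 2 / 2) * q 0 i.
have dpsi r : r \in `]s, t[ -> is_derive r 1 psi (u' r 0 i - p 0 i - (r - s) * q 0 i).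
  rewrite in_itv /= => srt; have d1 := is_derive_coord i (du r srt).
  by apply: is_derive_eq; rewrite /GRing.scale /=; field.
have cpsi : {within `[s, t], continuous psi}.
  have c1 : continuous (fun r : R => (r - s) * p 0 i + ((r - s) ^+ 2 / 2) * q 0 i).
    move=> r; apply/differentiable_continuous/derivable1_diffP.
    by apply: ex_derive.
  have -> : psi = (fun r => u r 0 i - ((r - s) * p 0 i + ((r - s) ^+ 2 / 2) * q 0 i)).
    by apply/funext => r; rewrite /psi opprD addrA.
  by apply: within_continuousB; [exact: within_coord|exact: continuous_subspaceT].
have [r rst E] := MVT st dpsi cpsi.
have -> : (u t - u s - (t - s) *: p - ((t - s) ^+ 2 / 2) *: q) 0 i = psi t - psi s.
  by rewrite /psi !mxE subrr expr0n /= !mul0r !subr0; ring.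
rewrite E normrM (ger0_norm ts0) ler_wpM2r//.
move: rst; rewrite in_itv /= => /uK; apply: le_trans.
by have := coord_le_norm (u' r - p - (r - s) *: q) i; rewrite !mxE.
Qed.

End row_vectors.

Section local_error_definitions.
Context {R : realType} {d : nat}.

(** The part of the local error that averages to zero when [x] is uniform on
    [1/2, 1]: the error of the symmetric two-point quadrature of [u'], and the
    leading term of the defect of the two stages. *)
Definition unbiased_part (F : R -> 'rV[R]_d -> 'rV[R]_d) (u : R -> 'rV[R]_d) (a h : R)
    (p : 'rV[R]_d) (x : R) : 'rV[R]_d :=
  u (a + h) - u a
  - (h / 2) *: (F (a + h * x) (u (a + h * x)) + F (a + h * (1 - x)) (u (a + h * (1 - x))))
  - (h ^+ 3 / 2 * (3 * x - 3 * x ^+ 2 - 2^-1)) *: p.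

Lemma stage_coefficients (x : R) : 0 <= x <= 1 ->
  `|x ^+ 2 / 2| <= 1 /\
  `|(1 - 2 * x) * x + x * (1 - x) - (1 - x) ^+ 2 / 2| <= 2 /\
  `|3 * x - 3 * x ^+ 2 - 2^-1| <= 1.
Proof.
move=> /andP[x0 x1]; have := mulr_ge0 x0 x0.
have : x * x <= x by rewrite ler_piMr.
have := sqr_ge0 (x - 2^-1); rewrite !expr2 !ler_norml => ? ? ?; split; [|split]; apply/andP; split; lra.
Qed.

(** The bounds [K3], ..., [P2] follow the successive estimates of the proof. *)
Definition local_error_const (A : R) : R :=
  let K3 := A + A * A + A * (1 + A) in
  let K5 := (1 + A) + A * K3 in
  let Kq := A + A * A in
  let D1 := Kq + 2 * K5 * A in
  let P1 := 2 * D1 + A * (2 * K5 + 2 * A * D1) in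
  let Q2 := 3 * K5 + 2 * A * D1 in
  let D2 := 2 * Kq + Q2 * A in
  let P2 := 2 * D2 + A * (Q2 + 2 * A * D2) in
  P1 + P2 + 3 * K5 + A * Kq.

End local_error_definitions.

Section local_error.
Context {R : realType} {d : nat}.
Context (F : R -> 'rV[R]_d -> 'rV[R]_d) (u : R -> 'rV[R]_d) (A B a h eps : R).
Context (c : 'rV[R]_d) (J : 'M[R]_d).
Implicit Types (t x : R) (w k y : 'rV[R]_d).
Hypotheses (A1 : 1 <= A) (BA : B <= A) (h0 : 0 < h) (hA : h * A <= 4^-1) (heps : h <= eps) (epsA : eps <= A).
Hypotheses (FB : forall t w, `|F t w| <= B)
  (FL : forall t w w', `|F t w - F t w'| <= A * `|w - w'|).
Hypotheses (cu : {within `[a, a + h], continuous u})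
  (du : forall t, a < t < a + h -> is_derive t 1 u (F t (u t))).
Hypotheses (cB : `|c| <= A) (JB : forall w, `|w *m J| <= A * `|w|).
Hypothesis FA : forall t t' w w', a <= t <= a + h -> a <= t' <= a + h ->
  `|w - u a| <= 2 * (B * h) -> `|w' - u a| <= 2 * (B * h) ->
  `|F t w - F t' w' - ((t - t') *: c + (w - w') *m J)| <= eps * (`|t - t'| + `|w - w'|).

Local Notation g t := (F t (u t)).
Let q := c + g a *m J.

Let A0 : 0 <= A. Proof. exact: le_trans ler01 A1. Qed.
Let hp : 0 <= h. Proof. exact: ltW. Qed.
Let eps0 : 0 <= eps. Proof. exact: le_trans hp heps. Qed.

Let sub_cu t : a <= t <= a + h -> {within `[a, t], continuous u}.
Proof.
move=> /andP[_ tb]; apply: continuous_subspaceW cu => x /=.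
by rewrite !in_itv /= => /andP[-> xt]; exact: le_trans tb.
Qed.

Let sub_du t : a <= t <= a + h -> forall r, a < r < t -> is_derive r 1 u (g r).
Proof. by move=> /andP[_ tb] r /andP[ar rt]; apply: du; rewrite ar (lt_le_trans rt). Qed.

Let B0 : 0 <= B. Proof. exact: le_trans (normr_ge0 _) (FB a 0). Qed.

Let L0 t : a <= t <= a + h -> `|u t - u a| <= B * (t - a).
Proof.
move=> tab; have /andP[at_ _] := tab.
have := @quadratic_expansion _ _ u (fun r => g r) a t 0 0 B at_ B0 (sub_cu tab) (sub_du tab).
by rewrite !scaler0 !subr0; apply => r _; rewrite scaler0 !subr0.
Qed.

Let L1 t : a <= t <= a + h -> `|u t - u a| <= A * (t - a).
Proof.
move=> tab; apply: le_trans (L0 tab) _; rewrite ler_wpM2r// subr_ge0.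
by case/andP: tab.
Qed.

Let L1' t : a <= t <= a + h -> `|u t - u a| <= A * h.
Proof. by move=> tab; apply: le_trans (L1 tab) _; rewrite ler_wpM2l// lerBlDr addrC; case/andP: tab. Qed.

Let ball_u t : a <= t <= a + h -> `|u t - u a| <= 2 * (B * h).
Proof.
move=> tab; apply: (le_trans (L0 tab)); have : B * (t - a) <= B * h.
  by rewrite ler_wpM2l// lerBlDr addrC; case/andP: tab.
by have := mulr_ge0 B0 hp; lra.
Qed.

Let aab : a <= a <= a + h. Proof. by rewrite lexx lerDl. Qed.

Let L2 t : a <= t <= a + h ->
  `|g t - g a - ((t - a) *: c + (u t - u a) *m J)| <= eps * ((1 + A) * (t - a)).
Proof.
move=> tab; apply: le_trans (FA tab aab (ball_u tab) (ball_u aab)) _.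
have /andP[at_ _] := tab.
by rewrite ler_wpM2l// mulrDl mul1r lerD ?L1// ger0_norm ?subr_ge0.
Qed.

Let K3 := A + A * A + A * (1 + A).
Let K5 := (1 + A) + A * K3.
Let Kq := A + A * A.

Let K30 : 0 <= K3. Proof. by rewrite /K3 !addr_ge0 ?mulr_ge0 ?addr_ge0. Qed.
Let K50 : 0 <= K5. Proof. by rewrite /K5 !addr_ge0 ?mulr_ge0. Qed.
Let Kq0 : 0 <= Kq. Proof. by rewrite /Kq addr_ge0 ?mulr_ge0. Qed.

Let L3 t : a <= t <= a + h -> `|g t - g a| <= K3 * h.
Proof.
move=> tab; have /andP[at_ tb] := tab; have th : t - a <= h by rewrite lerBlDr addrC.
have ta : 0 <= t - a by rewrite subr_ge0.
have -> : g t - g a = (g t - g a - ((t - a) *: c + (u t - u a) *m J)) +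
  ((t - a) *: c + (u t - u a) *m J) by rewrite subrK.
apply: (le_trans (ler_normD _ _)).
apply: (le_trans (lerD (L2 tab) (ler_normD _ _))).
rewrite normrZ (ger0_norm ta).
have e1 : eps * ((1 + A) * (t - a)) <= A * (1 + A) * h.
  by rewrite mulrA; apply: ler_pM => //; [rewrite mulr_ge0// addr_ge0|rewrite ler_wpM2r// addr_ge0].
have e2 : (t - a) * `|c| <= A * h by rewrite mulrC ler_pM.
have e3 : `|(u t - u a) *m J| <= A * A * h.
  by apply: (le_trans (JB _)); rewrite -mulrA ler_wpM2l// L1'.
by rewrite /K3; lra.
Qed.

Let L4 t : a <= t <= a + h -> `|u t - u a - (t - a) *: g a| <= K3 * h * h.
Proof.
move=> tab; have /andP[at_ tb] := tab; have th : t - a <= h by rewrite lerBlDr addrC.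
have K3h : 0 <= K3 * h by rewrite mulr_ge0.
have := @quadratic_expansion _ _ u (fun r => g r) a t (g a) 0 _ at_ K3h (sub_cu tab) (sub_du tab).
rewrite scaler0 subr0 => h4; apply: (le_trans (h4 _)); last by rewrite ler_wpM2l.
move=> r /andP[ar rt]; rewrite scaler0 subr0; apply: L3.
by rewrite (ltW ar) (le_trans (ltW rt)).
Qed.

Let L5 t : a <= t <= a + h -> `|g t - g a - (t - a) *: q| <= K5 * (eps * h).
Proof.
move=> tab; have /andP[at_ tb] := tab; have th : t - a <= h by rewrite lerBlDr addrC.
have -> : g t - g a - (t - a) *: q = (g t - g a - ((t - a) *: c + (u t - u a) *m J)) +
  (u t - u a - (t - a) *: g a) *m J.
  rewrite [in RHS](mulmxBl (u t - u a)) -scalemxAl /q scalerDr.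
  move: ((u t - u a) *m J) ((t - a) *: (g a *m J)) ((t - a) *: c) => X Y Z.
  by apply/rowP => i; rewrite !mxE; ring.
apply: (le_trans (ler_normD _ _)); apply: (le_trans (lerD (L2 tab) (JB _))).
have e1 : eps * ((1 + A) * (t - a)) <= (1 + A) * (eps * h).
  by rewrite mulrCA ler_wpM2l ?addr_ge0// ler_wpM2l.
have e2 : A * `|u t - u a - (t - a) *: g a| <= A * K3 * (eps * h).
  rewrite -mulrA ler_wpM2l// (le_trans (L4 tab))// -mulrA ler_wpM2l//.
  by rewrite ler_wpM2r.
by rewrite /K5 [leRHS]mulrDl; exact: lerD e1 e2.
Qed.

Let L6 t : a <= t <= a + h ->
  `|u t - u a - (t - a) *: g a - ((t - a) ^+ 2 / 2) *: q| <= K5 * (eps * h ^+ 2).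
Proof.
move=> tab; have /andP[at_ tb] := tab; have th : t - a <= h by rewrite lerBlDr addrC.
have Kh : 0 <= K5 * (eps * h) by rewrite !mulr_ge0.
have := @quadratic_expansion _ _ u (fun r => g r) a t (g a) q _ at_ Kh (sub_cu tab) (sub_du tab).
move=> h6; apply: (le_trans (h6 _)).
  by move=> r /andP[ar rt]; apply: L5; rewrite (ltW ar) (le_trans (ltW rt)).
by rewrite expr2 !mulrA ler_wpM2l// -mulrA.
Qed.

Let qB : `|q| <= Kq.
Proof.
apply: (le_trans (ler_normD _ _)); rewrite lerD// (le_trans (JB _))//.
by rewrite ler_wpM2l// (le_trans _ BA).
Qed.

Let e2 := eps * h ^+ 2.

Let h3e2 : h * h ^+ 2 <= e2. Proof. by rewrite ler_wpM2r// exprn_ge0. Qed.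
Let e20 : 0 <= e2. Proof. by rewrite mulr_ge0// exprn_ge0. Qed.
Let e2A : e2 <= A * h ^+ 2. Proof. by rewrite ler_wpM2r// exprn_ge0. Qed.

(** The implicit equation improves an error on the explicit part of a stage by a
    factor [h], through the Lipschitz constant for its size and through [FA] for its
    leading term. *)
Let stage t k y (th kap D D1 : R) : a <= t <= a + h -> 0 <= th <= 1 ->
  k = F t (y + (h * th) *: k) -> `|y + (h * th) *: k - u a| <= 2 * (B * h) ->
  `|y + (h * th) *: g t - u t| <= D ->
  `|y + (h * th) *: g t - u t - (h ^+ 2 * kap) *: q| <= D1 ->
  `|k - g t| <= 2 * A * D /\
  `|k - g t - (h ^+ 2 * kap) *: (q *m J)| <= eps * (2 * D) + A * (D1 + h * (2 * A * D)).
Proof.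
move=> tab /andP[th0 th1] kE wB eD eD1.
set w := y + (h * th) *: k in kE wB.
pose e := y + (h * th) *: g t - u t.
have wE : w - u t = e + (h * th) *: (k - g t).
  by rewrite /w /e; apply/rowP => i; rewrite !mxE; ring.
have kg : `|k - g t| <= A * `|w - u t| by rewrite {1}kE; exact: FL.
have hth : 0 <= h * th <= h by rewrite mulr_ge0//= ler_piMr.
have sc : `|(h * th) *: (k - g t)| <= h * `|k - g t|.
  by rewrite normrZ ger0_norm ?ler_wpM2r//; case/andP: hth.
have wD : `|w - u t| <= 2 * D.
  have h1 : `|w - u t| <= D + h * (A * `|w - u t|).
    rewrite {1}wE; apply: (le_trans (ler_normD _ _)); rewrite lerD//.
    by apply: (le_trans sc); rewrite ler_wpM2l.
  have h2 : h * (A * `|w - u t|) <= 4^-1 * `|w - u t| by rewrite mulrA ler_wpM2r.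
  by have := normr_ge0 (w - u t); lra.
have kD : `|k - g t| <= 2 * A * D.
  by apply: (le_trans kg); rewrite (mulrC 2) -mulrA ler_wpM2l.
split=> //.
have -> : k - g t - (h ^+ 2 * kap) *: (q *m J) =
   (k - g t - ((t - t) *: c + (w - u t) *m J)) + (w - u t - (h ^+ 2 * kap) *: q) *m J.
  rewrite subrr scale0r add0r (mulmxBl (w - u t)) -scalemxAl.
  by rewrite addrA subrK.
apply: (le_trans (ler_normD _ _)); apply: lerD.
  rewrite {1}kE; apply: (le_trans (FA tab tab wB (ball_u tab))).
  by rewrite subrr normr0 add0r ler_wpM2l.
apply: (le_trans (JB _)); rewrite ler_wpM2l//.
have -> : w - u t - (h ^+ 2 * kap) *: q = (e - (h ^+ 2 * kap) *: q) + (h * th) *: (k - g t).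
  by rewrite wE addrAC.
apply: (le_trans (ler_normD _ _)); rewrite lerD// (le_trans sc)//.
by rewrite ler_wpM2l.
Qed.

Let D1 := Kq + 2 * K5 * A.
Let P1 := 2 * D1 + A * (2 * K5 + 2 * A * D1).
Let Q2 := 3 * K5 + 2 * A * D1.
Let D2 := 2 * Kq + Q2 * A.
Let P2 := 2 * D2 + A * (Q2 + 2 * A * D2).

Let D10 : 0 <= D1. Proof. by rewrite /D1 addr_ge0// !mulr_ge0. Qed.
Let Q20 : 0 <= Q2. Proof. by rewrite /Q2 addr_ge0// !mulr_ge0. Qed.
Let D20 : 0 <= D2. Proof. by rewrite /D2 addr_ge0// !mulr_ge0. Qed.
Let P10 : 0 <= P1. Proof. by rewrite /P1 addr_ge0// !mulr_ge0// addr_ge0// !mulr_ge0. Qed.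
Let P20 : 0 <= P2. Proof. by rewrite /P2 addr_ge0// !mulr_ge0// addr_ge0// !mulr_ge0. Qed.

Let hsq : 0 <= h ^+ 2. Proof. exact: exprn_ge0. Qed.

(* The two forms of the stage bound, with all powers of [h] absorbed in [e2]. *)
Let stage_const (D Q : R) : 0 <= D -> 0 <= Q ->
  eps * (2 * (D * h ^+ 2)) + A * (Q * e2 + h * (2 * A * (D * h ^+ 2))) <=
  (2 * D + A * (Q + 2 * A * D)) * e2.
Proof.
move=> DD QQ.
have -> : eps * (2 * (D * h ^+ 2)) = 2 * D * e2 by rewrite /e2; ring.
have -> : h * (2 * A * (D * h ^+ 2)) = 2 * A * D * (h * h ^+ 2) by ring.
rewrite [leRHS]mulrDl lerD2l -[leRHS]mulrA ler_wpM2l// [leRHS]mulrDl lerD2l.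
by rewrite ler_wpM2l// !mulr_ge0.
Qed.

Let stage_size (kap Q : R) (z : 'rV[R]_d) (m : R) : 0 <= Q -> `|kap| <= m ->
  `|z - (h ^+ 2 * kap) *: q| <= Q * e2 -> `|z| <= (m * Kq + Q * A) * h ^+ 2.
Proof.
move=> QQ km zq; rewrite -[z](subrK ((h ^+ 2 * kap) *: q)).
apply: (le_trans (ler_normD _ _)); rewrite [leRHS]mulrDl addrC; apply: lerD.
  rewrite normrZ normrM (ger0_norm hsq).
  have -> : h ^+ 2 * `|kap| * `|q| = `|kap| * `|q| * h ^+ 2 by ring.
  by rewrite ler_wpM2r// ler_pM.
by apply: (le_trans zq); rewrite -mulrA ler_wpM2l.
Qed.

(** With [q = c + F a (u a) *m J], the second derivative of [u] up to [eps], the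
    stages differ from [u'] by [h ^ 2 * kap] times [q *m J], where [kap] is
    [x ^ 2 / 2] for the first one and
    [(1 - 2 x) x + x (1 - x) - (1 - x) ^ 2 / 2] for the second one. These factors add
    up to the weight [3 x - 3 x ^ 2 - 1 / 2] of [unbiased_part]. *)
Lemma local_error_bound x k1 k2 : 2^-1 <= x <= 1 ->
  k1 = F (a + h * x) (u a + (h * x) *: k1) ->
  k2 = F (a + h * (1 - x)) (u a + (h * (1 - 2 * x)) *: k1 + (h * x) *: k2) ->
  `|u (a + h) - u a - (h / 2) *: (k1 + k2) - unbiased_part F u a h (q *m J) x|
     <= local_error_const A * (h * (eps * h ^+ 2)) /\
  `|unbiased_part F u a h (q *m J) x| <= local_error_const A * (eps * h ^+ 2).
Proof.
move=> /andP[x1 x2] k1E k2E.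
have x0 : 0 <= x by lra.
have x01 : 0 <= x <= 1 by rewrite x0.
have tin th : 0 <= th <= 1 -> a <= a + h * th <= a + h.
  by move=> /andP[t0 t1]; rewrite lerDl mulr_ge0//= lerD2l ler_piMr.
have y01 : 0 <= 1 - x <= 1 by apply/andP; split; lra.
set s := a + h * x in k1E *; set t := a + h * (1 - x) in k2E *.
have sab : a <= s <= a + h by exact: tin.
have tab : a <= t <= a + h by exact: tin.
have bab : a <= a + h <= a + h by rewrite lexx lerDl hp.
have sa : s - a = h * x by rewrite /s addrC addKr.
have ta : t - a = h * (1 - x) by rewrite /t addrC addKr.
have ba : a + h - a = h by rewrite addrC addKr.
pose rs := g s - g a - (h * x) *: q.
pose rt := g t - g a - (h * (1 - x)) *: q.
pose us := u s - u a - (h * x) *: g a - ((h * x) ^+ 2 / 2) *: q.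
pose ut := u t - u a - (h * (1 - x)) *: g a - ((h * (1 - x)) ^+ 2 / 2) *: q.
pose ub := u (a + h) - u a - h *: g a - (h ^+ 2 / 2) *: q.
have rsB : `|rs| <= K5 * (eps * h) by have := L5 sab; rewrite sa.
have rtB : `|rt| <= K5 * (eps * h) by have := L5 tab; rewrite ta.
have usB : `|us| <= K5 * e2 by have := L6 sab; rewrite sa.
have utB : `|ut| <= K5 * e2 by have := L6 tab; rewrite ta.
have ubB : `|ub| <= K5 * e2 by have := L6 bab; rewrite ba.
have zr (b : R) (r : 'rV[R]_d) : `|b| <= 1 -> `|r| <= K5 * (eps * h) -> `|(h * b) *: r| <= K5 * e2.
  move=> b1 rB; rewrite normrZ normrM (ger0_norm hp).
  have -> : K5 * e2 = h * 1 * (K5 * (eps * h)) by rewrite /e2; ring.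
  by apply: ler_pM => //; rewrite ?mulr_ge0// ler_wpM2l.
have x1' : `|x| <= 1 by rewrite ger0_norm.
have k1B : `|k1| <= B by rewrite k1E.
have k2B : `|k2| <= B by rewrite k2E.
have y1' : `|1 - 2 * x| <= 1 by rewrite ler_norml; apply/andP; split; lra.
have hBh : 0 <= B * h by exact: mulr_ge0.
have sc (b : R) (k : 'rV[R]_d) : `|b| <= 1 -> `|k| <= B -> `|(h * b) *: k| <= B * h.
  move=> b1 kB; rewrite normrZ normrM (ger0_norm hp) -mulrA mulrC ler_wpM2r//.
  by rewrite -[leRHS]mul1r ler_pM.
(* The explicit part of the first stage misses [u s] by [x ^ 2 / 2] times
   [h ^ 2 *: q], up to [e2]. *)
have e1E : u a + (h * x) *: g s - u s - (h ^+ 2 * (x ^+ 2 / 2)) *: q = (h * x) *: rs - us.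
  by rewrite /rs /us; apply/rowP => i; rewrite !mxE; field.
have e1B : `|u a + (h * x) *: g s - u s - (h ^+ 2 * (x ^+ 2 / 2)) *: q| <= 2 * K5 * e2.
  rewrite e1E; apply: (le_trans (ler_normB _ _)).
  by have := lerD (zr _ _ x1' rsB) usB; lra.
have kap1 : `|x ^+ 2 / 2| <= 1.
  exact: (stage_coefficients x01).1.
have e1D : `|u a + (h * x) *: g s - u s| <= D1 * h ^+ 2.
  have -> : D1 = 1 * Kq + 2 * K5 * A by rewrite mul1r.
  by apply: (stage_size _ kap1 e1B) => //; rewrite mulr_ge0.
have w1B : `|u a + (h * x) *: k1 - u a| <= 2 * (B * h).
  by rewrite addrC addKr; apply: (le_trans (sc _ _ x1' k1B)); lra.
have [k1D k1R] := stage sab x01 k1E w1B e1D e1B.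
have {}k1R := le_trans k1R (stage_const D10 (mulr_ge0 (ler0n _ 2) K50)).
(* For the second stage the factor is [kap]: the error of [k1] only enters at the
   order of [e2]. *)
pose kap := (1 - 2 * x) * x + x * (1 - x) - (1 - x) ^+ 2 / 2.
pose y := u a + (h * (1 - 2 * x)) *: k1.
have e2E : y + (h * x) *: g t - u t - (h ^+ 2 * kap) *: q =
   (h * (1 - 2 * x)) *: rs + (h * x) *: rt - ut + (h * (1 - 2 * x)) *: (k1 - g s).
  by rewrite /y /rs /rt /ut /kap; apply/rowP => i; rewrite !mxE; field.
have e2B : `|y + (h * x) *: g t - u t - (h ^+ 2 * kap) *: q| <= Q2 * e2.
  rewrite e2E; apply: (le_trans (ler_normD _ _)).
  have h1 : `|(h * (1 - 2 * x)) *: rs + (h * x) *: rt - ut| <= 3 * K5 * e2.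
    apply: (le_trans (ler_normB _ _)).
    have := lerD (ler_normD ((h * (1 - 2 * x)) *: rs) ((h * x) *: rt)) utB.
    by have := zr _ _ y1' rsB; have := zr _ _ x1' rtB; lra.
  have h2 : `|(h * (1 - 2 * x)) *: (k1 - g s)| <= 2 * A * D1 * e2.
    rewrite normrZ normrM (ger0_norm hp).
    apply: (@le_trans _ _ (h * 1 * (2 * A * (D1 * h ^+ 2)))).
      by apply: ler_pM => //; rewrite ?mulr_ge0// ler_wpM2l.
    have -> : h * 1 * (2 * A * (D1 * h ^+ 2)) = 2 * A * D1 * (h * h ^+ 2) by ring.
    by rewrite ler_wpM2l// !mulr_ge0.
  by rewrite /Q2 [leRHS]mulrDl lerD.
have kap2 : `|kap| <= 2.
  exact: (stage_coefficients x01).2.1.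
have e2D : `|y + (h * x) *: g t - u t| <= D2 * h ^+ 2 by exact: (stage_size _ kap2 e2B).
have w2B : `|y + (h * x) *: k2 - u a| <= 2 * (B * h).
  have -> : y + (h * x) *: k2 - u a = (h * (1 - 2 * x)) *: k1 + (h * x) *: k2.
    by rewrite /y; apply/rowP => i; rewrite !mxE; ring.
  by apply: (le_trans (ler_normD _ _)); have := sc _ _ y1' k1B; have := sc _ _ x1' k2B; lra.
have [_ k2R] := stage tab x01 k2E w2B e2D e2B.
have {}k2R := le_trans k2R (stage_const D20 Q20).
have C0 : [/\ 0 <= P1 * e2, 0 <= P2 * e2, 0 <= K5 * e2 & 0 <= A * Kq * e2].
  by split; rewrite !mulr_ge0.
have CE : local_error_const A = P1 + P2 + 3 * K5 + A * Kq by [].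
have CEe : local_error_const A * e2 = P1 * e2 + P2 * e2 + 3 * (K5 * e2) + A * Kq * e2.
  by rewrite CE; ring.
split.
  have -> : u (a + h) - u a - (h / 2) *: (k1 + k2) - unbiased_part F u a h (q *m J) x =
     - ((h / 2) *: ((k1 - g s - (h ^+ 2 * (x ^+ 2 / 2)) *: (q *m J)) +
                 (k2 - g t - (h ^+ 2 * kap) *: (q *m J)))).
    rewrite /unbiased_part -/s -/t /kap; move: (q *m J) => qJ.
    by apply/rowP => i; rewrite !mxE; field.
  rewrite normrN normrZ ger0_norm ?divr_ge0//.
  rewrite [leRHS]mulrCA -/e2 CEe; case: C0 => c1 c2 c3 c4.
  have : h / 2 * `|k1 - g s - (h ^+ 2 * (x ^+ 2 / 2)) *: (q *m J) +
     (k2 - g t - (h ^+ 2 * kap) *: (q *m J))| <= h / 2 * (P1 * e2 + P2 * e2).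
    by rewrite ler_wpM2l ?divr_ge0// (le_trans (ler_normD _ _))// lerD.
  move=> /le_trans; apply.
  by rewrite [leLHS]mulrAC -[leLHS]mulrA ler_wpM2l//; lra.
have qJB : `|q *m J| <= A * Kq by apply: (le_trans (JB _)); rewrite ler_wpM2l.
have -> : unbiased_part F u a h (q *m J) x =
   ub - (h / 2) *: rs - (h / 2) *: rt - (h ^+ 3 / 2 * (3 * x - 3 * x ^+ 2 - 2^-1)) *: (q *m J).
  rewrite /unbiased_part -/s -/t /ub /rs /rt; move: (q *m J) => qJ.
  by apply/rowP => i; rewrite !mxE; field.
rewrite -/e2 CEe; case: C0 => c1 c2 c3 c4.
have half : `|2^-1 : R| <= 1 by rewrite ger0_norm ?invr_ge0// invf_le1 ?ler1n.
have b1 := zr _ _ half rsB; have b2 := zr _ _ half rtB.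
have b3 : `|(h ^+ 3 / 2 * (3 * x - 3 * x ^+ 2 - 2^-1)) *: (q *m J)| <= A * Kq * e2.
  rewrite normrZ mulrC; apply: ler_pM => //.
  rewrite normrM ger0_norm ?divr_ge0 ?exprn_ge0//.
  have b4 : `|3 * x - 3 * x ^+ 2 - 2^-1| <= 1.
    exact: (stage_coefficients x01).2.2.
  apply: le_trans h3e2; rewrite -exprS -[leRHS]mulr1; apply: ler_pM => //.
    by rewrite divr_ge0// exprn_ge0.
  by rewrite ler_pdivrMr// ler_peMr ?exprn_ge0// ler1n.
apply: (le_trans (ler_normB _ _)).
apply: (le_trans (lerD (le_trans (ler_normB _ _) (lerD (le_trans (ler_normB _ _) (lerD ubB b1)) b2)) b3)).
by lra.
Qed.

End local_error.

(** * Stages and truncation of the field *)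

(** Joins the complete and the normed structures of row vectors, as the Banach fixed
    point theorem requires. *)
HB.instance Definition _ (R : realType) (d : nat) :=
  Uniform_isComplete.Build 'rV[R]_d (@mx_complete R 1 d).

Section bounded_lipschitz_stages.
Context {R : realType} {d : nat}.
Context (F : R -> 'rV[R]_d -> 'rV[R]_d) (A h : R).
Hypotheses (A1 : 1 <= A) (h0 : 0 < h) (hA : h * A <= 4^-1).
Hypotheses (FB : forall t w, `|F t w| <= A)
  (FL : forall t t' w w', `|F t w - F t' w'| <= A * (`|t - t'| + `|w - w'|)).

Let A0 : 0 <= A. Proof. exact: le_trans A1. Qed.
Let hp : 0 <= h. Proof. exact: ltW. Qed.

(** The terms [k] and [k'] on the right-hand side are absorbed since [h * A] is
    small. *)
Lemma stage_lipschitz t t' th th' y y' k k' : 0 <= th <= h ->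
  k = F t (y + th *: k) -> k' = F t' (y' + th' *: k') ->
  `|k - k'| <= 2 * A * (`|t - t'| + `|y - y'| + `|th - th'| * A).
Proof.
move=> /andP[th0 thh] kE k'E.
have := FL t t' (y + th *: k) (y' + th' *: k'); rewrite -kE -k'E.
have -> : y + th *: k - (y' + th' *: k') = (y - y') + (th *: (k - k') + (th - th') *: k').
  by apply/rowP => i; rewrite !mxE; ring.
have k'B : `|k'| <= A by rewrite k'E.
have e1 : `|th *: (k - k') + (th - th') *: k'| <= h * `|k - k'| + `|th - th'| * A.
  apply: (le_trans (ler_normD _ _)); rewrite !normrZ lerD ?ler_wpM2l//.
  by rewrite ler_wpM2r// ger0_norm.
have e2 := ler_normD (y - y') (th *: (k - k') + (th - th') *: k').
move=> e3.
have : `|k - k'| <= A * (`|t - t'| + `|y - y'| + `|th - th'| * A) + h * A * `|k - k'|.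
  apply: (le_trans e3); rewrite (_ : _ + h * A * _ =
    A * (`|t - t'| + (`|y - y'| + (h * `|k - k'| + `|th - th'| * A)))); last by ring.
  by rewrite ler_wpM2l// lerD2l (le_trans e2)// lerD2l.
have : h * A * `|k - k'| <= 4^-1 * `|k - k'| by rewrite ler_wpM2r.
set X := `|k - k'|; set Y := _ + _ * A => e4 e5.
have : 0 <= X by exact: normr_ge0.
by rewrite -mulrA; move: (A * Y) e5 => Z e5 X0; lra.
Qed.

Lemma stage_exists (t th : R) (y : 'rV[R]_d) : 0 <= th <= h -> exists k : 'rV[R]_d, k = F t (y + th *: k).
Proof.
move=> /andP[th0 thh].
pose G := fun k : 'rV[R]_d => F t (y + th *: k).
have GT : set_fun setT setT G by [].
pose G' := mkfun_fun GT.
have cG : is_contraction G'.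
  have q0 : 0 <= 4^-1 :> R by [].
  exists (NngNum q0); split => /=; first lra.
  move=> [k k'] _ /=; rewrite /G'/= /G.
  apply: (le_trans (FL _ _ _ _)).
  have -> : y + th *: k - (y + th *: k') = th *: (k - k').
    by apply/rowP => i; rewrite !mxE; ring.
  rewrite subrr normr0 add0r normrZ (ger0_norm th0) mulrA ler_wpM2r//.
  by apply: le_trans hA; rewrite mulrC ler_wpM2r.
have [k _ kE] := @banach_fixed_point R 'rV[R]_d setT G' cG closedT (ex_intro _ 0 I).
by exists k.
Qed.

Lemma stage1E (t x : R) (v : 'rV[R]_d) : 0 <= x <= 1 ->
  stage1 F t h x v = F (t + h * x) (v + (h * x) *: stage1 F t h x v).
Proof.
move=> /andP[x0 x1]; rewrite /stage1; set S := [set k | _].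
have : S (get S) by apply: getPex; apply: stage_exists; rewrite mulr_ge0//= ler_piMr.
by [].
Qed.

Lemma stage2E (t x : R) (v : 'rV[R]_d) : 0 <= x <= 1 ->
  stage2 F t h x v = F (t + h * (1 - x))
    (v + (h * (1 - 2 * x)) *: stage1 F t h x v + (h * x) *: stage2 F t h x v).
Proof.
move=> /andP[x0 x1]; rewrite /stage2; set S := [set k | _].
have : S (get S) by apply: getPex; apply: stage_exists; rewrite mulr_ge0//= ler_piMr.
by [].
Qed.

Lemma Phi_bound (t x : R) (v : 'rV[R]_d) : 0 <= x <= 1 -> `|Phi F t h x v| <= `|v| + h * A.
Proof.
move=> x01; apply: (le_trans (ler_normD _ _)); rewrite lerD2l normrZ ger0_norm ?divr_ge0//.
have := ler_normD (stage1 F t h x v) (stage2 F t h x v).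
rewrite {2}stage1E// {2}stage2E//; set X := F _ _; set Y := F _ _; move=> e.
have -> : h * A = h / 2 * (A + A) by field.
apply: ler_wpM2l; first exact: divr_ge0.
by apply: (le_trans e); apply: lerD; exact: FB.
Qed.

(** [Phi] is a Lipschitz perturbation of the identity: this gives the stability
    of the scheme and the measurability of its iterates at once. *)
Lemma Phi_lipschitz (t x x' : R) (v v' : 'rV[R]_d) : 0 <= x <= 1 -> 0 <= x' <= 1 ->
  `|Phi F t h x v - Phi F t h x' v' - (v - v')| <=
    h * (A * (3 + 5 * A)) * (`|x - x'| + `|v - v'|).
Proof.
move=> x01 x'01.
have k1E := stage1E t v x01; have k1E' := stage1E t v' x'01.
have k2E := stage2E t v x01; have k2E' := stage2E t v' x'01.
rewrite /Phi.
set k1 := stage1 F t h x v in k1E k2E *; set k2 := stage2 F t h x v in k2E *.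
set k1' := stage1 F t h x' v' in k1E' k2E' *; set k2' := stage2 F t h x' v' in k2E' *.
have h1 : h <= 4^-1 by apply: le_trans hA; rewrite ler_peMr.
have thh : 0 <= h * x <= h by case/andP: x01 => x0 x1; rewrite mulr_ge0//= ler_piMr.
set X : R := `|x - x'|; set V : R := `|v - v'|.
have X0 : 0 <= X by exact: normr_ge0.
have V0 : 0 <= V by exact: normr_ge0.
have hX : `|h * x - h * x'| <= X by rewrite -mulrBr normrM (ger0_norm hp) ler_piMl//; lra.
have AX : 0 <= A * X by exact: mulr_ge0.
have AV : 0 <= A * V by exact: mulr_ge0.
have d1 : `|k1 - k1'| <= 2 * A * (V + (1 + A) * X).
  apply: (le_trans (stage_lipschitz thh k1E k1E')); rewrite ler_wpM2l ?mulr_ge0//.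
  have -> : t + h * x - (t + h * x') = h * x - h * x' by ring.
  have : `|h * x - h * x'| * A <= X * A by rewrite ler_wpM2r.
  by rewrite -/V; lra.
have d1' : h * `|k1 - k1'| <= 2^-1 * (V + (1 + A) * X).
  have W0 : 0 <= V + (1 + A) * X by lra.
  apply: (@le_trans _ _ (h * (2 * A * (V + (1 + A) * X)))); first by rewrite ler_wpM2l.
  have -> : h * (2 * A * (V + (1 + A) * X)) = 2 * (h * A) * (V + (1 + A) * X) by ring.
  apply: ler_wpM2r => //; move: (h * A) hA => Y Y4; lra.
have d2 : `|k2 - k2'| <= 2 * A * (2 * V + (2 + 4 * A) * X).
  apply: (le_trans (stage_lipschitz thh k2E k2E')); rewrite ler_wpM2l ?mulr_ge0//.
  have -> : t + h * (1 - x) - (t + h * (1 - x')) = - (h * x - h * x') by ring.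
  have -> : v + (h * (1 - 2 * x)) *: k1 - (v' + (h * (1 - 2 * x')) *: k1') =
      (v - v') + ((h * (1 - 2 * x)) *: (k1 - k1') - (2 * (h * x - h * x')) *: k1').
    by apply/rowP => i; rewrite !mxE; ring.
  have := ler_normD (v - v') ((h * (1 - 2 * x)) *: (k1 - k1') - (2 * (h * x - h * x')) *: k1').
  have := ler_normB ((h * (1 - 2 * x)) *: (k1 - k1')) ((2 * (h * x - h * x')) *: k1').
  have : `|(h * (1 - 2 * x)) *: (k1 - k1')| <= h * `|k1 - k1'|.
    rewrite normrZ normrM (ger0_norm hp) -mulrA ler_wpM2l// ler_piMl//.
    by case/andP: x01 => x0 x1; rewrite ler_norml; apply/andP; split; lra.
  have : `|(2 * (h * x - h * x')) *: k1'| <= 2 * X * A.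
    rewrite normrZ ler_pM//; last by rewrite k1E'.
    by rewrite normrM ger0_norm// ler_wpM2l.
  have : `|h * x - h * x'| * A <= X * A by rewrite ler_wpM2r.
  by rewrite normrN -/V; lra.
have -> : v + (h / 2) *: (k1 + k2) - (v' + (h / 2) *: (k1' + k2')) - (v - v') =
    (h / 2) *: ((k1 - k1') + (k2 - k2')).
  by apply/rowP => i; rewrite !mxE; ring.
rewrite normrZ ger0_norm ?divr_ge0//.
have d3 : `|k1 - k1' + (k2 - k2')| <= 2 * (A * (3 + 5 * A)) * (X + V).
  apply: (le_trans (ler_normD _ _)); apply: (le_trans (lerD d1 d2)).
  have -> : 2 * A * (V + (1 + A) * X) + 2 * A * (2 * V + (2 + 4 * A) * X) =
    2 * A * (3 * V + (3 + 5 * A) * X) by ring.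
  rewrite !mulrA -!mulrA !ler_wpM2l//; lra.
have -> : h * (A * (3 + 5 * A)) * (X + V) = h / 2 * (2 * (A * (3 + 5 * A)) * (X + V)) by field.
by rewrite ler_wpM2l ?divr_ge0.
Qed.

End bounded_lipschitz_stages.

Section truncation.
Context {R : realType} {d : nat} (T : R) (f : R -> 'rV[R]_d -> 'rV[R]_d) (K L : R)
  (E : R -> R -> R).
Hypotheses (T0 : 0 < T) (K0 : 0 <= K) (reg : regular_on T f K L E).

(** Clamping is 1-Lipschitz, so that the bounds on the cylinder of size [K] become
    global. *)
Definition truncated (t : R) (v : 'rV[R]_d) : 'rV[R]_d :=
  f (clamp 0 T t) (\row_i clamp (- K) K (v 0 i)).

Let L0 : 0 <= L. Proof. by case: reg. Qed.

Let boxed (v : 'rV[R]_d) i : `|(\row_i clamp (- K) K (v 0 i)) 0 i| <= K.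
Proof. by rewrite mxE ler_norml clamp_in// ge0_cp. Qed.

Let timed (t : R) : 0 <= clamp 0 T t <= T. Proof. by apply: clamp_in; exact: ltW. Qed.

Lemma truncated_id (t : R) (v : 'rV[R]_d) : 0 <= t <= T -> `|v| <= K -> truncated t v = f t v.
Proof.
move=> tT vK; rewrite /truncated clamp_id//; congr (f t _).
apply/rowP => i; rewrite mxE clamp_id// -ler_norml.
exact: le_trans (coord_le_norm v i) vK.
Qed.

Lemma truncated_bound t v : `|truncated t v| <= L.
Proof.
apply: norm_le_coord => // i; have [_ h _ _ _] := reg.
by apply: h.
Qed.

Lemma sum_coord_le (w : 'rV[R]_d) : \sum_i `|w 0 i| <= d%:R * `|w|.
Proof.
have -> : d%:R * `|w| = \sum_(i < d) `|w| by rewrite sumr_const card_ord mulr_natl.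
by apply: ler_sum => i _; exact: coord_le_norm.
Qed.

Let sum_le (s : R) (w w' : 'rV[R]_d) : 0 <= s ->
  s + \sum_i `|w 0 i - w' 0 i| <= (1 + d%:R) * (s + `|w - w'|).
Proof.
move=> s0; have := sum_coord_le (w - w').
under eq_bigr => i _ do rewrite !mxE.
have := normr_ge0 (w - w'); have : 0 <= d%:R * s by rewrite mulr_ge0.
by move: (\sum_(i < d) _) => S; rewrite mulrDl mul1r mulrDr; lra.
Qed.

Lemma truncated_lipschitz (t t' : R) (w w' : 'rV[R]_d) :
  `|truncated t w - truncated t' w'| <= (1 + d%:R) * L * (`|t - t'| + `|w - w'|).
Proof.
apply: norm_le_coord => [|l].
  by rewrite !mulr_ge0 ?addr_ge0.
rewrite !mxE; have [_ _ h _ _] := reg.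
apply: (le_trans (h _ _ _ _ _ (timed t) (timed t') (boxed w) (boxed w'))).
rewrite [leRHS]mulrAC [leRHS]mulrC ler_wpM2l//.
apply: le_trans (sum_le w w' (normr_ge0 (t - t'))).
apply: lerD; first exact: clamp_lipschitz.
by apply: ler_sum => i _; rewrite !mxE; exact: clamp_lipschitz.
Qed.

Lemma truncated_almost_affine (a h r : R) (v0 : 'rV[R]_d) :
  0 <= a -> 0 < h -> a + h <= T -> 0 <= r -> `|v0| + r <= K ->
  exists (c : 'rV[R]_d) (J : 'M[R]_d),
  [/\ `|c| <= L, forall w : 'rV[R]_d, `|w *m J| <= d%:R * L * `|w| &
    forall (t t' : R) (w w' : 'rV[R]_d), a <= t <= a + h -> a <= t' <= a + h -> `|w - v0| <= r -> `|w' - v0| <= r ->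
    `|truncated t w - truncated t' w' - ((t - t') *: c + (w - w') *m J)| <=
      (1 + d%:R) * (L * (1 + r / h)) * E a (a + h) * (`|t - t'| + `|w - w'|)].
Proof.
move=> a0 h0 ahT r0 vr; have [_ _ _ _ H] := reg.
have ab : a < a + h by rewrite ltrDl.
have [l|c [J [cL JL FA]]] := H a (a + h) v0 r a0 ab ahT r0.
  by apply: le_trans vr; rewrite lerD2r; exact: coord_le_norm.
exists c, J; split.
- by apply: norm_le_coord.
- move=> w; apply: norm_le_coord => [|l]; first by rewrite !mulr_ge0.
  rewrite mxE; apply: (le_trans (ler_norm_sum _ _ _)).
  apply: (@le_trans _ _ (\sum_(i < d) `|w| * L)).
    apply: ler_sum => i _; rewrite normrM ler_pM//; exact: coord_le_norm.
  by rewrite sumr_const card_ord -[leLHS]mulr_natl mulrA [leRHS]mulrAC.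
have [_ _ _ [bE _] _] := reg; have /andP[bE1 _] := bE _ _ a0 ab ahT.
have E0 : 0 <= E a (a + h) by apply: le_trans bE1; rewrite subr_ge0 ltW.
have box_id w : `|w - v0| <= r -> `|w| <= K.
  move=> wr; apply: le_trans vr; rewrite -[w](subrK v0) addrC.
  by apply: (le_trans (ler_normD _ _)); rewrite lerD2l.
have tT t : a <= t <= a + h -> 0 <= t <= T.
  by move=> /andP[t1 t2]; rewrite (le_trans a0 t1) (le_trans t2 ahT).
have ball w : `|w - v0| <= r -> forall i, `|w 0 i - v0 0 i| <= r.
  by move=> wr i; apply: le_trans wr; have := coord_le_norm (w - v0) i; rewrite !mxE.
have rh : 0 <= L * (1 + r / h) by rewrite mulr_ge0// addr_ge0// divr_ge0// ltW.
move=> t t' w w' tab t'ab wr w'r; have d1 : 0 <= 1 + d%:R :> R by rewrite addr_ge0.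
apply: norm_le_coord => [|l].
  by rewrite mulr_ge0 ?addr_ge0// mulr_ge0// mulr_ge0.
rewrite !truncated_id ?tT ?box_id//.
have := FA t t' w w' l tab t'ab (ball _ wr) (ball _ w'r).
have -> : (f t w - f t' w' - ((t - t') *: c + (w - w') *m J)) 0 l =
  f t w 0 l - f t' w' 0 l - ((t - t') * c 0 l + \sum_i (w 0 i - w' 0 i) * J i l).
  by rewrite !mxE; under [in LHS]eq_bigr => i _ do rewrite !mxE.
move=> /le_trans; apply; rewrite (addrC a h) addrK.
have -> : (1 + d%:R) * (L * (1 + r / h)) * E a (h + a) * (`|t - t'| + `|w - w'|) =
  L * (1 + r / h) * E a (h + a) * ((1 + d%:R) * (`|t - t'| + `|w - w'|)) by ring.
by rewrite (addrC h) ler_wpM2l ?sum_le// mulr_ge0.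
Qed.

End truncation.

Section truncated_scheme.
Context {R : realType} {d : nat} (T nu : R) (f : R -> 'rV[R]_d -> 'rV[R]_d) (K L A h : R)
  (E : R -> R -> R).
Hypotheses (T0 : 0 < T) (K0 : 0 <= K) (reg : regular_on T f K L E).
Hypotheses (A1 : 1 <= A) (LA : (1 + d%:R) * L <= A) (nuA : nu <= A).
Hypotheses (h0 : 0 < h) (hA : h * A <= 4^-1).
Hypothesis osl : forall (t : R) v w, t \in `[0, T] ->
  edot (f t v - f t w) (v - w) <= nu * enorm (v - w) ^+ 2.

Local Notation F := (truncated T f K).

Let hp : 0 <= h. Proof. exact: ltW. Qed.

Let FB t w : `|F t w| <= A.
Proof.
apply: (le_trans (truncated_bound T0 K0 reg t w)); apply: le_trans LA.
by have [L0 _ _ _ _] := reg; rewrite mulrDl mul1r lerDl mulr_ge0.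
Qed.

Let FL t t' w w' : `|F t w - F t' w'| <= A * (`|t - t'| + `|w - w'|).
Proof.
apply: (le_trans (truncated_lipschitz T0 K0 reg t t' w w')).
by rewrite ler_wpM2r// addr_ge0.
Qed.

Lemma edot_eq0 (v : 'rV[R]_d) : edot v v <= 0 -> v = 0.
Proof.
move=> v0; apply/rowP => i; rewrite mxE; apply/eqP; rewrite -normr_le0.
apply: (le_trans (coord_le_enorm v i)).
by rewrite -[leRHS]sqrtr0 ler_wsqrtr.
Qed.

(** A one-sided Lipschitz field has at most one stage, however large it is
    globally. *)
Lemma one_sided_stage_unique (t th : R) (y k k' : 'rV[R]_d) : 0 <= t <= T ->
  0 <= th -> th * nu < 1 -> k = f t (y + th *: k) -> k' = f t (y + th *: k') -> k = k'.
Proof.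
move=> tT; rewrite le_eqVlt => /predU1P[<- _ -> ->|th0 thnu kE k'E]; first by rewrite !scale0r.
have := @osl t (y + th *: k) (y + th *: k'); rewrite in_itv => /(_ tT).
rewrite -kE -k'E enorm_sqr.
have -> : y + th *: k - (y + th *: k') = th *: (k - k').
  by apply/rowP => i; rewrite !mxE; ring.
set z := k - k'.
have -> : edot z (th *: z) = th * edot z z.
  by rewrite /edot mulr_sumr; apply: eq_bigr => i _; rewrite !mxE; ring.
have -> : edot (th *: z) (th *: z) = th * (th * edot z z).
  by rewrite /edot !mulr_sumr; apply: eq_bigr => i _; rewrite !mxE; ring.
rewrite mulrCA ler_pM2l// mulrA => H.
apply/eqP; rewrite -subr_eq0; apply/eqP; apply: edot_eq0; rewrite -/z.
have H2 : 0 < 1 - th * nu by rewrite subr_gt0.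
rewrite -(ler_pM2l H2) mulr0 mulrBl mul1r subr_le0 (le_trans H)//.
by rewrite (mulrC th).
Qed.

(** The stages of the truncated field stay in the box where the two fields agree,
    hence they are the stages of [f]. *)
Lemma Phi_truncated (a x : R) (v : 'rV[R]_d) : 0 <= a -> a + h <= T -> 2^-1 <= x <= 1 ->
  `|v| + 1 <= K -> Phi f a h x v = Phi F a h x v.
Proof.
move=> a0 ahT /andP[x1 x2] vK.
have x0 : 0 <= x by lra.
have x01 : 0 <= x <= 1 by rewrite x0.
have hx0 : 0 <= h * x by exact: mulr_ge0.
have hxnu : h * x * nu < 1.
  apply: (@le_lt_trans _ _ (h * A)); last first.
    by apply: (le_lt_trans hA); rewrite invf_lt1 ?ltr1n.
  rewrite -mulrA ler_wpM2l//.
  case: (leP 0 nu) => nu0; first by apply: le_trans nuA; rewrite ler_piMl.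
  by apply: le_trans (le_trans ler01 A1); rewrite mulr_ge0_le0// ltW.
have tT (th : R) : 0 <= th <= 1 -> 0 <= a + h * th <= T.
  move=> /andP[t0 t1]; rewrite addr_ge0 ?mulr_ge0//= (le_trans _ ahT)// lerD2l.
  by rewrite ler_piMr.
have y01 : 0 <= 1 - x <= 1 by apply/andP; split; lra.
have sc (b : R) (k : 'rV[R]_d) : `|b| <= 1 -> `|k| <= A -> `|(h * b) *: k| <= 4^-1.
  move=> b1 kB; apply: le_trans hA; rewrite normrZ normrM (ger0_norm hp) -mulrA ler_wpM2l//.
  by rewrite -[leRHS]mul1r ler_pM.
have e1 := stage1E A1 h0 hA FL a v x01.
have e2 := stage2E A1 h0 hA FL a v x01.
set k1 := stage1 F a h x v in e1 e2; set k2 := stage2 F a h x v in e2.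
have k1B : `|k1| <= A by rewrite e1.
have k2B : `|k2| <= A by rewrite e2.
have x1' : `|x| <= 1 by rewrite ger0_norm.
have y1' : `|1 - 2 * x| <= 1 by rewrite ler_norml; apply/andP; split; lra.
have e1f : k1 = f (a + h * x) (v + (h * x) *: k1).
  rewrite {1}e1 truncated_id ?tT//; apply: le_trans vK.
  by apply: (le_trans (ler_normD _ _)); have := sc _ _ x1' k1B; lra.
have s1 : stage1 f a h x v = k1.
  apply: (one_sided_stage_unique (tT _ x01) hx0 hxnu _ e1f).
  rewrite /stage1; set S := [set k | _].
  by have : S (get S) by apply: getPex; exists k1.
have e2f : k2 = f (a + h * (1 - x)) (v + (h * (1 - 2 * x)) *: k1 + (h * x) *: k2).
  rewrite {1}e2 truncated_id ?tT//; apply: le_trans vK.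
  apply: (le_trans (ler_normD _ _)); apply: (le_trans (lerD (ler_normD _ _) (lexx _))).
  by have := sc _ _ x1' k2B; have := sc _ _ y1' k1B; lra.
have s2 : stage2 f a h x v = k2.
  apply: (one_sided_stage_unique (tT _ y01) hx0 hxnu _ e2f).
  rewrite /stage2 s1; set S := [set k | _].
  by have : S (get S) by apply: getPex; exists k2.
by rewrite /Phi s1 s2.
Qed.

Lemma sdirk_truncated (u0 : 'rV[R]_d) (x : nat -> R) N n : N%:R * h = T ->
  (forall m, 2^-1 <= x m.+1 <= 1) ->
  (forall m, (m <= N)%N -> `|sdirk f u0 h x m| + 1 <= K) -> (n <= N)%N ->
  sdirk f u0 h x n = sdirk F u0 h (fun m => clamp 2^-1 1 (x m)) n.
Proof.
move=> NT x1 bnd; elim: n => [//|n IH nN /=].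
rewrite -IH ?(ltnW nN)// clamp_id//; apply: Phi_truncated => //.
- by rewrite mulr_ge0.
- by rewrite -NT -[X in _ + X]mul1r -mulrDl natr1 ler_wpM2r// ler_nat.
- by apply: bnd; exact: ltnW.
Qed.

End truncated_scheme.

(** * Measurability, independence and the centered part of the error *)

Section measurability_of_lipschitz_functions.
Context {R : realType} {disp : measure_display} {Om : measurableType disp}.

Lemma measurable_fun_rays (X : Om -> R) :
  (forall c, measurable [set w | X w < c]) -> measurable_fun setT X.
Proof.
move=> h; apply: (measurability _ (RGenInftyO.measurableE R)).
move=> _ [_ [c ->] <-]; rewrite setTI.
have -> : X @^-1` `]-oo, c[ = [set w | X w < c] by apply/seteqP; split => w /=; rewrite in_itv.
exact: h.
Qed.

(** A Lipschitz function is the infimum of cones with rational vertices, a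
    countable family. *)
Lemma measurable_lipschitz {d} (x : Om -> R) (v : Om -> 'rV[R]_d)
    (phi : R -> 'rV[R]_d -> R) (C : R) : 0 < C ->
  measurable_fun setT x -> (forall i, measurable_fun setT (fun w => v w 0 i)) ->
  (forall r r' z z', `|phi r z - phi r' z'| <= C * (`|r - r'| + `|z - z'|)) ->
  measurable_fun setT (fun w => phi (x w) (v w)).
Proof.
move=> C0 mx mv lip; apply: measurable_fun_rays => c.
pose q1 (p : rat * 'rV[rat]_d) : R := ratr p.1.
pose q2 (p : rat * 'rV[rat]_d) : 'rV[R]_d := \row_i ratr (p.2 0 i).
pose D w p := `|x w - q1 p| + \sum_i `|v w 0 i - q2 p 0 i|.
have mD p : measurable_fun setT (D ^~ p).
  apply: measurable_funD.
    by apply: measurableT_comp => //; apply: measurable_funB.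
  apply: measurable_sum => i; apply: measurableT_comp => //.
  by apply: measurable_funB.
have normD w p : `|x w - q1 p| + `|v w - q2 p| <= D w p.
  rewrite lerD2l; apply: norm_le_coord => [|i]; first exact: sumr_ge0.
  by rewrite !mxE (bigD1 i)//= !mxE lerDl sumr_ge0.
(* A vertex close to [(x w, v w)] detects [phi (x w) (v w) < c]. *)
have -> : [set w | phi (x w) (v w) < c] =
    \bigcup_(p in [set: rat * 'rV[rat]_d]) [set w | phi (q1 p) (q2 p) + C * D w p < c].
  apply/seteqP; split => w /=; last first.
    move=> [p _ /=]; apply: le_lt_trans.
    rewrite -lerBlDl; apply: (le_trans (ler_norm _)); apply: (le_trans (lip _ _ _ _)).
    by rewrite ler_pM2l.
  move=> wc; pose e := (c - phi (x w) (v w)) / (C * (3 * (1 + d%:R))).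
  have d0 : 0 < 1 + d%:R :> R by rewrite ltr_pwDl.
  have e0 : 0 < e by rewrite divr_gt0 ?subr_gt0// !mulr_gt0.
  have rat_near (r : R) : exists q : rat, `|r - ratr q| <= e.
    have [|q] := @rat_in_itvoo R (r - e) r; first by rewrite ltrBlDr ltrDl.
    rewrite in_itv /= => /andP[q1' q2']; exists q.
    rewrite ger0_norm ?subr_ge0 ?(ltW q2')//; lra.
  have [p1 hp1] := rat_near (x w).
  have /(@choice _ _ (fun i (q : rat) => `|v w 0 i - ratr q| <= e))[p2 hp2] :
    forall i, exists q : rat, `|v w 0 i - ratr q| <= e by move=> i; exact: rat_near.
  pose p := (p1, \row_i p2 i); exists p => //=.
  have Dp : D w p <= (1 + d%:R) * e.
    rewrite /D mulrDl mul1r; apply: lerD; first exact: hp1.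
    have -> : d%:R * e = \sum_(i < d) e by rewrite sumr_const card_ord mulr_natl.
    by apply: ler_sum => i _; rewrite !mxE.
  have : phi (q1 p) (q2 p) - phi (x w) (v w) <= C * D w p.
    apply: (le_trans (ler_norm _)); rewrite distrC; apply: (le_trans (lip _ _ _ _)).
    by rewrite ler_pM2l.
  have : C * D w p <= C * ((1 + d%:R) * e) by rewrite ler_pM2l.
  have -> : C * ((1 + d%:R) * e) = (c - phi (x w) (v w)) / 3.
    by rewrite /e; field; rewrite !gt_eqF//.
  by rewrite -subr_gt0 in wc *; move: (C * D w p) => Y; lra.
apply: countable_bigcupT_measurable => [|p]; first exact: countableP.
have : measurable_fun setT (fun w => phi (q1 p) (q2 p) + C * D w p).
  by apply: measurable_funD => //; apply: measurable_funM.
move=> /(_ measurableT `]-oo, c[%classic (measurable_itv _)); rewrite setTI.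
congr (measurable _); apply/seteqP; split => w /=; by rewrite in_itv.
Qed.

End measurability_of_lipschitz_functions.

Section independence.
Context {R : realType} {disp : measure_display} {Om : measurableType disp}.
Variable P : probability Om R.

Lemma bounded_integrable (X : Om -> R) (C : R) : measurable_fun setT X ->
  (forall w, `|X w| <= C) -> P.-integrable setT (EFin \o X).
Proof.
move=> mX XC; apply: measurable_bounded_integrable => //.
  by rewrite (le_lt_trans (probability_le1 _ _))// ltry.
by exists C; split; [exact: num_real|move=> y Cy w _; apply: le_trans (XC w) (ltW Cy)].
Qed.

(** By independence the law of the pair is a product measure, so that the inner
    integral, over [Y], vanishes. *)
Lemma independent_centered {d2 : measure_display} {T2 : measurableType d2}
    (X : {mfun Om >-> R}) (Y : {mfun Om >-> T2}) (g : T2 -> R) (C : R) :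
  measurable_fun setT g -> (forall w, `|X w| <= C) -> (forall y, `|g y| <= C) ->
  (forall A B, measurable A -> measurable B ->
     P (X @^-1` A `&` Y @^-1` B) = (P (X @^-1` A) * P (Y @^-1` B))%E) ->
  (\int[pushforward P Y]_y (g y)%:E = 0)%E ->
  \int[P]_w (X w * g (Y w)) = 0.
Proof.
move=> mg XC gC indep g0.
(* Clamping [X], which changes nothing on its range, makes the integrand bounded on
   the whole product space. *)
pose c := clamp (- C) C.
have C0 : 0 <= C by apply: le_trans (gC point).
have mc : measurable_fun setT c.
  by apply: continuous_measurable_fun; exact: clamp_continuous.
pose F (z : R * T2) : \bar R := (c z.1 * g z.2)%:E.
have mF : measurable_fun setT F.
  apply/measurable_EFinP; apply: measurable_funM.
    by apply: (measurableT_comp mc); exact: measurable_fst.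
  by apply: (measurableT_comp mg); exact: measurable_snd.
pose XY w := (X w, Y w).
have mXY : measurable_fun setT XY by apply: measurable_fun_pair.
have XcE w : c (X w) = X w by rewrite /c clamp_id// -ler_norml.
have bF w : `|X w * g (Y w)| <= C * C by rewrite normrM ler_pM.
have mXg : measurable_fun setT (fun w => X w * g (Y w)).
  by apply: measurable_funM => //; exact: measurableT_comp.
have FXY : F \o XY = EFin \o (fun w => X w * g (Y w)).
  by apply/funext => w; rewrite /F /XY /= XcE.
have iF : P.-integrable setT (F \o XY) by rewrite FXY; exact: (bounded_integrable mXg bF).
rewrite /Rintegral; have -> : (\int[P]_w (X w * g (Y w))%:E = \int[P]_w (F \o XY) w)%E.
  by rewrite FXY.
have := @integral_pushforward _ _ _ _ R XY mXY P setT F mF.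
rewrite preimage_setT => /(_ iF measurableT) <-.
pose mu := (distribution P X \x distribution P Y)%E.
have muE A : measurable A -> mu A = pushforward P XY A.
  move=> mA; apply: (@product_measure_unique _ _ _ _ R (distribution P X) (distribution P Y)
    (pushforward P XY)) => //.
have iFp : (pushforward P XY).-integrable setT F.
  by apply: integrable_pushforward => //; rewrite preimage_setT.
have iFm : mu.-integrable setT F.
  apply/integrableP; split => //; have /integrableP[_] := iFp.
  by rewrite (eq_measure_integral mu)// => A mA _; exact: esym (muE _ mA).
rewrite (eq_measure_integral mu); last by move=> A mA _; exact: esym (muE _ mA).
rewrite -(integral12_prod_meas1 iFm) (_ : fubini_F _ _ = cst 0%E) ?integral0//.
apply/funext => x; rewrite /fubini_F /F /=.
under eq_integral => y _ do rewrite EFinM.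
rewrite integralZl// ?g0 ?mule0//.
apply: measurable_bounded_integrable => //.
  by rewrite (le_lt_trans (probability_le1 _ _))// ltry.
by exists C; split; [exact: num_real|move=> y Cy w _; apply: le_trans (gC w) (ltW Cy)].
Qed.

End independence.

Section quadrature_mean.
Context {R : realType}.
Local Notation leb := (@lebesgue_measure R).

(** The error of the symmetric two-point quadrature of [w'], with a cubic
    correction of mean zero. *)
Definition quadrature_defect (w w' : R -> R) (a h p x : R) : R :=
  w (a + h) - w a - h / 2 * (w' (a + h * x) + w' (a + h * (1 - x)))
  - h ^+ 3 / 2 * (3 * x - 3 * x ^+ 2 - 2^-1) * p.

(** Integrating [w'] along [a + h x] and [a + h (1 - x)] for [x] in [1/2, 1]
    covers [a, a + h] exactly once, and the cubic weight has mean zero. *)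
Lemma two_point_quadrature_mean (w w' : R -> R) (a h p : R) : 0 < h ->
  {within `[a, a + h], continuous w} -> {within `[a, a + h], continuous w'} ->
  (forall t, a < t < a + h -> is_derive t 1 w (w' t)) ->
  (\int[leb]_(x in `[(2^-1)%R, 1%R]) (quadrature_defect w w' a h p x)%:E = 0)%E.
Proof.
rewrite /quadrature_defect => h0 cw cw' dw; have hp := ltW h0.
have aah : a <= a + h by rewrite lerDl.
pose cl := clamp a (a + h).
have ccl : continuous cl by exact: clamp_continuous.
have clin x : `[a, a + h]%classic (cl x) by rewrite /= in_itv; exact: clamp_in.
have c1 : continuous (w \o cl) by exact: within_continuous_comp ccl clin cw.
have c1' : continuous (w' \o cl) by exact: within_continuous_comp ccl clin cw'.
have tin (x : R) : 0 <= x <= 1 -> a <= a + h * x <= a + h.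
  by move=> /andP[x0 x1]; rewrite lerDl mulr_ge0//= lerD2l ler_piMr.
have clE (x : R) : 0 <= x <= 1 -> cl (a + h * x) = a + h * x by move=> /tin ?; exact: clamp_id.
pose al (x : R) := a + h * x; pose be (x : R) := a + h * (1 - x).
have dal (x : R) : is_derive x 1 al h.
  by apply: is_derive_eq; rewrite /GRing.scale /=; ring.
have dbe (x : R) : is_derive x 1 be (- h).
  by apply: is_derive_eq; rewrite /GRing.scale /=; ring.
have cal : continuous al by move=> x; apply/differentiable_continuous/derivable1_diffP; case: (dal x).
have cbe : continuous be by move=> x; apply/differentiable_continuous/derivable1_diffP; case: (dbe x).
(* A primitive of the cubic weight, with the same value at 1/2 and at 1. *)
pose q : {poly R} := (3 / 2)%:P * 'X^2 - 'X^3 - 2^-1%:P * 'X.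
pose Dl := w (a + h) - w a; pose kap := h ^+ 3 / 2 * p.
pose G (x : R) := x * Dl - 2^-1 * ((w \o cl) (al x) - (w \o cl) (be x)) - kap * q.[x].
pose g (x : R) := Dl - h / 2 * ((w' \o cl) (al x) + (w' \o cl) (be x)) - kap * (deriv q).[x].
have qE (x : R) : q.[x] = 3 / 2 * x ^+ 2 - x ^+ 3 - 2^-1 * x.
  by rewrite /q !hornerE.
have q'E (x : R) : (deriv q).[x] = 3 * x - 3 * x ^+ 2 - 2^-1.
  by rewrite /q !poly.derivE !(hornerE, hornerMn) /=; field.
have half0 : 0 <= 2^-1 :> R by rewrite invr_ge0.
transitivity (\int[leb]_(x in `[(2^-1)%R, 1%R]) (g x)%:E)%E.
  apply: eq_integral => x; rewrite inE /= in_itv /= => /andP[x1 x2].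
  have x0 : 0 <= x by apply: le_trans x1.
  have y0 : 0 <= 1 - x <= 1 by rewrite subr_ge0 x2 lerBlDr lerDl.
  rewrite /g /al /be /= !clE ?q'E ?x0//.
  by congr EFin; rewrite /Dl /kap; ring.
have cg : continuous g.
  move=> x; apply: (@continuousB _ _ _ (fun x : R => Dl - h / 2 * ((w' \o cl) (al x) + (w' \o cl) (be x)))).
    apply: (@continuousB _ _ _ (fun _ : R => Dl)); first exact: cvg_cst.
    apply: (@continuousM _ _ (fun _ : R => h / 2)); first exact: cvg_cst.
    apply: (@continuousD _ _ _ (fun x : R => (w' \o cl) (al x))).
      exact: (@continuous_comp _ _ _ al (w' \o cl) x (cal x) (c1' (al x))).
    exact: (@continuous_comp _ _ _ be (w' \o cl) x (cbe x) (c1' (be x))).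
  apply: (@continuousM _ _ (fun _ : R => kap)); first exact: cvg_cst.
  exact: continuous_horner.
have cG : continuous G.
  move=> x; apply: (@continuousB _ _ _ (fun x : R => x * Dl - 2^-1 * ((w \o cl) (al x) - (w \o cl) (be x)))).
    apply: (@continuousB _ _ _ (fun x : R => x * Dl)).
      by apply: (@continuousM _ _ id (fun=> Dl)); [exact: cvg_id|exact: cvg_cst].
    apply: (@continuousM _ _ (fun _ : R => 2^-1)); first exact: cvg_cst.
    apply: (@continuousB _ _ _ (fun x : R => (w \o cl) (al x))).
      exact: (@continuous_comp _ _ _ al (w \o cl) x (cal x) (c1 (al x))).
    exact: (@continuous_comp _ _ _ be (w \o cl) x (cbe x) (c1 (be x))).
  apply: (@continuousM _ _ (fun _ : R => kap)); first exact: cvg_cst.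
  exact: continuous_horner.
have dcl (t : R) : a < t < a + h -> is_derive t 1 (w \o cl) ((w' \o cl) t).
  move=> tab; rewrite /= /cl clamp_id; last by case/andP: tab => t1 t2; rewrite !ltW.
  apply: near_eq_is_derive (dw t tab); near=> s.
  have : s \in `]a, a + h[ by near: s; apply: near_in_itvoo; rewrite in_itv.
  by rewrite in_itv /= => /andP[s1 s2]; rewrite /cl clamp_id// !ltW.
have dG (x : R) : x \in `]2^-1, 1[ -> is_derive x 1 G (g x).
  rewrite in_itv /= => /andP[x1 x2].
  have alin : a < al x < a + h by rewrite /al ltrDl mulr_gt0 ?ltrD2l ?gtr_pMr//; lra.
  have bein : a < be x < a + h by rewrite /be ltrDl mulr_gt0 ?ltrD2l ?gtr_pMr//; lra.
  have d1 := @is_derive1_comp R (w \o cl) al x _ _ (dcl _ alin) (dal x).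
  have d2 := @is_derive1_comp R (w \o cl) be x _ _ (dcl _ bein) (dbe x).
  have d3 := is_derive_poly q x.
  have d12 := is_deriveZ 2^-1 (is_deriveB d1 d2).
  have d0 : is_derive x 1 (fun x : R => x * Dl) Dl.
    by apply: is_derive_eq; rewrite /GRing.scale /=; ring.
  have := is_deriveB (is_deriveB d0 d12) (is_deriveZ kap d3).
  move=> dd; apply: (is_derive_eq (dd : is_derive x 1 G _)).
  by rewrite /g /GRing.scale /=; ring.
have half1 : 2^-1 < 1 :> R by lra.
rewrite (continuous_FTC2 half1 (continuous_subspaceT cg) (F := G)); last 2 first.
- split; first by move=> x /dG[].
    by apply: cvg_at_right_filter; exact: cG.
  by apply: cvg_at_left_filter; exact: cG.
- by move=> x /dG[_ dE]; rewrite derive1E.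
rewrite -EFinB; congr EFin; rewrite /G /= /al /be.
have -> : a + h * 1 = a + h by rewrite mulr1.
have -> : a + h * (1 - 1) = a by rewrite subrr mulr0 addr0.
have -> : a + h * (1 - 2^-1) = a + h * 2^-1 by field.
have -> : cl (a + h) = a + h by apply: clamp_id; rewrite aah lexx.
have -> : cl a = a by apply: clamp_id; rewrite lexx aah.
by rewrite !qE /Dl; field.
Unshelve. all: by end_near. Qed.

Lemma continuous_quadrature_defect (w w' : R -> R) (a h p : R) : 0 < h ->
  {within `[a, a + h], continuous w'} ->
  continuous (fun y => quadrature_defect w w' a h p (clamp 2^-1 1 y)).
Proof.
move=> h0 cw'; pose c := clamp 2^-1 (1 : R).
have cin y : 0 <= c y <= 1.
  have half1 : 2^-1 <= 1 :> R by rewrite invf_le1 ?ler1n.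
  have /andP[c1 ->] := clamp_in y half1; rewrite andbT; apply: le_trans c1.
  by rewrite invr_ge0.
have cc : continuous c by exact: clamp_continuous.
pose al y := a + h * c y; pose be y := a + h * (1 - c y).
have caff (m b : R) : continuous (fun x : R => b + m * x).
  have daff (x : R) : is_derive x 1 (fun x : R => b + m * x) m.
    by apply: is_derive_eq; rewrite /GRing.scale /=; ring.
  by move=> x; apply/differentiable_continuous/derivable1_diffP; case: (daff x).
have cal : continuous al by move=> y; exact: (@continuous_comp _ _ _ c (fun x : R => a + h * x) y (cc y) (caff h a (c y))).
have cbe : continuous be.
  have -> : be = (fun x : R => a + h + - h * x) \o c by apply/funext => y; rewrite /be /=; ring.
  by move=> y; exact: (@continuous_comp _ _ _ c (fun x : R => a + h + - h * x) y (cc y) (caff (- h) (a + h) (c y))).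
have hp := ltW h0.
have tin (x : R) : 0 <= x <= 1 -> `[a, a + h]%classic (a + h * x).
  by move=> /andP[x0 x1]; rewrite /= in_itv /= lerDl mulr_ge0//= lerD2l ler_piMr.
have ain y : `[a, a + h]%classic (al y) by exact: tin.
have bin y : `[a, a + h]%classic (be y).
  by apply: tin; have /andP[x0 x1] := cin y; rewrite subr_ge0 x1 lerBlDr lerDl.
have c1 : continuous (w' \o al) by exact: within_continuous_comp cal ain cw'.
have c2 : continuous (w' \o be) by exact: within_continuous_comp cbe bin cw'.
pose q : {poly R} := 3 *: 'X - 3 *: 'X^2 - 2^-1%:P.
have -> : (fun y => quadrature_defect w w' a h p (c y)) =
   (fun y => w (a + h) - w a - h / 2 * ((w' \o al) y + (w' \o be) y) - h ^+ 3 / 2 * p * q.[c y]).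
  by apply/funext => y; rewrite /quadrature_defect /q !hornerE /=; ring.
move=> y; apply: (@continuousB _ _ _ (fun y : R => w (a + h) - w a - h / 2 * ((w' \o al) y + (w' \o be) y))).
  apply: (@continuousB _ _ _ (fun _ : R => w (a + h) - w a)); first exact: cvg_cst.
  apply: (@continuousM _ _ (fun _ : R => h / 2)); first exact: cvg_cst.
  by apply: (@continuousD _ _ _ (w' \o al)); [exact: c1|exact: c2].
apply: (@continuousM _ _ (fun _ : R => h ^+ 3 / 2 * p)); first exact: cvg_cst.
exact: (@continuous_comp _ _ _ c (horner q) y (cc y) (@continuous_horner _ q (c y))).
Qed.

Lemma quadrature_defect_centered {disp : measure_display} {Om : measurableType disp}
    (P : probability Om R) (Y : {mfun Om >-> measurableTypeR R}) (w w' : R -> R) (a h p C : R) : 0 < h ->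
  {within `[a, a + h], continuous w} -> {within `[a, a + h], continuous w'} ->
  (forall t, a < t < a + h -> is_derive t 1 w (w' t)) ->
  (forall x, 2^-1 <= x <= 1 -> `|quadrature_defect w w' a h p x| <= C) ->
  (forall B, measurable B -> P (Y @^-1` B) = uniform_prob (@half_lt1 R) B) ->
  (\int[pushforward P Y]_y (quadrature_defect w w' a h p (clamp 2^-1 1 y))%:E = 0)%E.
Proof.
move=> h0 cw cw' dw bC law.
pose g y := quadrature_defect w w' a h p (clamp 2^-1 1 y).
have half1 : 2^-1 <= 1 :> R by rewrite invf_le1 ?ler1n.
have gC y : `|g y| <= C by apply: bC; exact: clamp_in.
have mg : measurable_fun [set: measurableTypeR R] g.
  by apply: continuous_measurable_fun; exact: continuous_quadrature_defect.
transitivity (\int[uniform_prob (@half_lt1 R)]_y (g y)%:E)%E.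
  by apply: eq_measure_integral => B mB _; exact: law.
have ig : (uniform_prob (@half_lt1 R)).-integrable setT (EFin \o g) by exact: (@bounded_integrable R _ (measurableTypeR R) (uniform_prob (@half_lt1 R)) g C mg gC).
have gC0 y : (0 <= (g y + C)%:E)%E.
  by rewrite lee_fin -lerBlDr sub0r; have := gC y; rewrite ler_norml => /andP[].
have mgC : measurable_fun [set: measurableTypeR R] (fun y => (g y + C)%:E) by apply/measurable_EFinP; exact: measurable_funD.
(* The constant [C] makes the integrand nonnegative, as [integral_uniform] asks. *)
have := integral_uniform (@half_lt1 R) mgC gC0.
have -> : (\int[uniform_prob (@half_lt1 R)]_y (g y + C)%:E =
    \int[uniform_prob (@half_lt1 R)]_y (g y)%:E + C%:E)%E.
  under eq_integral => y _ do rewrite EFinD.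
  have iC := @bounded_integrable R _ (measurableTypeR R) (uniform_prob (@half_lt1 R))
    (fun _ : R => C) `|C| (measurable_cst _) (fun=> lexx _).
  rewrite (integralD measurableT ig iC); congr (_ + _)%E.
  have uT : uniform_prob (@half_lt1 R) setT = 1%E by exact: probability_setT.
  by rewrite (_ : EFin \o _ = cst C%:E)// integral_cst//= uT mule1.
have mhalf : measurable (`[2^-1, 1]%classic : set R) by exact: measurable_itv.
have ileb : leb.-integrable `[(2^-1)%R, 1%R] (EFin \o g).
  apply: continuous_compact_integrable; first exact: segment_compact.
  by apply: continuous_subspaceT; exact: continuous_quadrature_defect.
have -> : (\int[leb]_(y in `[(2^-1)%R, 1%R]) (g y + C)%:E = (C * 2^-1)%:E)%E.
  under eq_integral => y _ do rewrite EFinD.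
  rewrite integralD//; last first.
    apply: (@continuous_compact_integrable _ (fun=> C)); first exact: segment_compact.
    by apply: continuous_subspaceT => y; exact: cvg_cst.
  rewrite integral_cst// (_ : (\int[leb]_(y in `[(2^-1)%R, 1%R]) (g y)%:E = 0)%E).
    rewrite add0e [X in (_ * X)%E]lebesgue_measure_itv /= lte_fin half_lt1 -EFinB -EFinM.
    by congr EFin; congr (_ * _); field.
  rewrite -(two_point_quadrature_mean p h0 cw cw' dw); apply: eq_integral => y.
  by rewrite inE /= in_itv /= /g => y12; rewrite clamp_id.
rewrite -EFinM => H.
have : (\int[uniform_prob (@half_lt1 R)]_y (g y)%:E + C%:E = C%:E)%E.
  by rewrite H; congr EFin; field.
have : (\int[uniform_prob (@half_lt1 R)]_y (g y)%:E)%E \is a fin_num by exact: integrable_fin_num ig.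
move=> /fineK <-; rewrite -EFinD => -[zC]; congr EFin.
by apply: (@addIr _ C); rewrite zC add0r.
Qed.

End quadrature_mean.

(** * One step in mean square *)

Section one_step.
Context {R : realType}.

Definition growth_rate (d : nat) (A : R) : R :=
  let lip := A * (3 + 5 * A) in d%:R * (2 * lip + 1 + 3 * lip ^+ 2).

Definition error_rate (d : nat) (A : R) : R := 7 * d%:R * local_error_const A ^+ 2.

(** The product [e * rho] is kept, since its mean vanishes; Young's inequality with
    weight [h] absorbs [e * r], as [r] has one more power of [h] than [rho]. *)
Lemma squared_error_step (e D rho r h lip m C q : R) : 0 < h <= 1 -> `|e| <= m ->
  0 <= lip -> 0 <= C -> 0 <= q ->
  `|D| <= h * lip * m -> `|rho| <= C * (q * h ^+ 2) -> `|r| <= C * (h * (q * h ^+ 2)) ->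
  (e + D + rho + r) ^+ 2 <=
    e ^+ 2 + 2 * (e * rho) + h * (2 * lip + 1 + 3 * lip ^+ 2) * m ^+ 2
    + 7 * C ^+ 2 * (h ^+ 4 * q ^+ 2).
Proof.
move=> /andP[h0 h1] em lip0 C0 q0 Db rhob rb; have hp := ltW h0.
have m0 : 0 <= m by apply: le_trans em.
have sq (x y : R) : `|x| <= y -> x ^+ 2 <= y ^+ 2.
  by move=> xy; rewrite -[x ^+ 2]real_normK ?num_real// lerXn2r// nnegrE ?(le_trans _ xy).
have D2 : D ^+ 2 <= h * lip ^+ 2 * m ^+ 2.
  apply: (le_trans (sq _ _ Db)).
  have -> : (h * lip * m) ^+ 2 = h * (h * lip ^+ 2 * m ^+ 2) by ring.
  by rewrite ler_piMl// !mulr_ge0// ?sqr_ge0.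
have rho2 : rho ^+ 2 <= C ^+ 2 * (h ^+ 4 * q ^+ 2).
  by apply: (le_trans (sq _ _ rhob)); rewrite le_eqVlt; apply/orP; left; apply/eqP; ring.
have X0 : 0 <= C ^+ 2 * (h ^+ 4 * q ^+ 2) by rewrite !mulr_ge0// ?sqr_ge0// exprn_ge0.
have r2 : r ^+ 2 <= h * (C ^+ 2 * (h ^+ 4 * q ^+ 2)).
  apply: (le_trans (sq _ _ rb)).
  have -> : (C * (h * (q * h ^+ 2))) ^+ 2 = h * (h * (C ^+ 2 * (h ^+ 4 * q ^+ 2))) by ring.
  by rewrite ler_wpM2l// ler_piMl.
have r2' : r ^+ 2 <= C ^+ 2 * (h ^+ 4 * q ^+ 2).
  by apply: (le_trans r2); rewrite ler_piMl.
have eD : e * D <= h * lip * m ^+ 2.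
  apply: (le_trans (ler_norm _)); rewrite normrM.
  have -> : h * lip * m ^+ 2 = m * (h * lip * m) by ring.
  exact: ler_pM.
have er : 2 * (e * r) <= h * m ^+ 2 + C ^+ 2 * (h ^+ 4 * q ^+ 2).
  rewrite -(ler_pM2l h0).
  have : 0 <= (h * e - r) ^+ 2 by exact: sqr_ge0.
  have : h * (h * e ^+ 2) <= h * (h * m ^+ 2) by rewrite !ler_wpM2l// sq.
  by rewrite !expr2 in r2 *; lra.
have : 0 <= (D - rho) ^+ 2 by exact: sqr_ge0.
have : 0 <= (D - r) ^+ 2 by exact: sqr_ge0.
have : 0 <= (rho - r) ^+ 2 by exact: sqr_ge0.
have -> : h * (2 * lip + 1 + 3 * lip ^+ 2) * m ^+ 2 =
  2 * (h * lip * m ^+ 2) + h * m ^+ 2 + 3 * (h * lip ^+ 2 * m ^+ 2) by ring.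
have -> : 7 * C ^+ 2 * (h ^+ 4 * q ^+ 2) = 7 * (C ^+ 2 * (h ^+ 4 * q ^+ 2)) by ring.
move: (C ^+ 2 * (h ^+ 4 * q ^+ 2)) X0 (h * lip * m ^+ 2) (h * m ^+ 2) (h * lip ^+ 2 * m ^+ 2)
  D2 rho2 r2' eD er => X X0 Y1 Y2 Y3 D2 rho2 r2' eD er.
by rewrite !expr2 in D2 rho2 r2' *; lra.
Qed.

End one_step.

Lemma sum_quadratic_step {R : realType} {d : nat} (X Y : 'I_d -> R) (a b : R) :
  \sum_i (X i + 2 * Y i + a + b) = \sum_i X i + 2 * (\sum_i Y i) + d%:R * a + d%:R * b.
Proof.
rewrite !big_split /= !sumr_const card_ord mulr_sumr.
by rewrite [in RHS]mulr_natl [in RHS](mulr_natl b).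
Qed.

Lemma growth_rate_ge0 {R : realType} (d : nat) (A : R) : 0 <= A -> 0 <= growth_rate d A.
Proof.
move=> A0; rewrite /growth_rate.
have : 0 <= A * (3 + 5 * A) by rewrite mulr_ge0 ?addr_ge0 ?mulr_ge0.
by move: (A * _) => l l0; rewrite mulr_ge0// !addr_ge0 ?mulr_ge0 ?sqr_ge0.
Qed.

Section error_recursion.
Context {R : realType} {d : nat}.
Context (F : R -> 'rV[R]_d -> 'rV[R]_d) (u : R -> 'rV[R]_d) (A B a h eps : R).
Context (c : 'rV[R]_d) (J : 'M[R]_d).
Hypotheses (A1 : 1 <= A) (BA : B <= A) (h0 : 0 < h) (hA : h * A <= 4^-1) (heps : h <= eps)
  (epsA : eps <= A).
Hypotheses (FB : forall t w, `|F t w| <= B)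
  (FL : forall t t' w w', `|F t w - F t' w'| <= A * (`|t - t'| + `|w - w'|)).
Hypotheses (cu : {within `[a, a + h], continuous u})
  (du : forall t, a < t < a + h -> is_derive t 1 u (F t (u t))).
Hypotheses (cB : `|c| <= A) (JB : forall w : 'rV[R]_d, `|w *m J| <= A * `|w|).
Hypothesis FA : forall t t' w w', a <= t <= a + h -> a <= t' <= a + h ->
  `|w - u a| <= 2 * (B * h) -> `|w' - u a| <= 2 * (B * h) ->
  `|F t w - F t' w' - ((t - t') *: c + (w - w') *m J)| <= eps * (`|t - t'| + `|w - w'|).

Let p := (c + F a (u a) *m J) *m J.

Lemma local_error_const_ge0 : 0 <= local_error_const A.
Proof.
have A0 : 0 <= A by apply: le_trans A1.
rewrite /local_error_const.
have K30 : 0 <= A + A * A + A * (1 + A) by rewrite !addr_ge0 ?mulr_ge0 ?addr_ge0.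
move: (A + A * A + A * (1 + A)) K30 => K3 K30.
have K50 : 0 <= 1 + A + A * K3 by rewrite !addr_ge0 ?mulr_ge0.
move: (1 + A + A * K3) K50 => K5 K50.
have Kq0 : 0 <= A + A * A by rewrite addr_ge0 ?mulr_ge0.
move: (A + A * A) Kq0 => Kq Kq0.
have D10 : 0 <= Kq + 2 * K5 * A by rewrite addr_ge0 ?mulr_ge0.
move: (Kq + 2 * K5 * A) D10 => D1 D10.
have Q20 : 0 <= 3 * K5 + 2 * A * D1 by rewrite addr_ge0 ?mulr_ge0.
move: (3 * K5 + 2 * A * D1) Q20 => Q2 Q20.
have D20 : 0 <= 2 * Kq + Q2 * A by rewrite addr_ge0 ?mulr_ge0.
move: (2 * Kq + Q2 * A) D20 => D2 D20.
by rewrite !addr_ge0 ?mulr_ge0 ?addr_ge0 ?mulr_ge0 ?addr_ge0 ?mulr_ge0.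
Qed.

Let FBA t w : `|F t w| <= A. Proof. exact: le_trans (FB t w) BA. Qed.

Let FLw t w w' : `|F t w - F t w'| <= A * `|w - w'|.
Proof. by have := FL t t w w'; rewrite subrr normr0 add0r. Qed.

Let error_split x : 2^-1 <= x <= 1 ->
  `|u (a + h) - Phi F a h x (u a) - unbiased_part F u a h p x|
     <= local_error_const A * (h * (eps * h ^+ 2)) /\
  `|unbiased_part F u a h p x| <= local_error_const A * (eps * h ^+ 2).
Proof.
move=> x12; have /andP[x1 x2] := x12.
have x01 : 0 <= x <= 1 by rewrite x2 (le_trans _ x1)// invr_ge0.
have -> : u (a + h) - Phi F a h x (u a) = u (a + h) - u a -
    (h / 2) *: (stage1 F a h x (u a) + stage2 F a h x (u a)) by rewrite /Phi opprD addrA.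
exact: (local_error_bound A1 BA h0 hA heps epsA FB FLw cu du cB JB FA x12
  (stage1E A1 h0 hA FL a (u a) x01) (stage2E A1 h0 hA FL a (u a) x01)).
Qed.

Lemma unbiased_part_bound x : 2^-1 <= x <= 1 ->
  `|unbiased_part F u a h p x| <= local_error_const A * (eps * h ^+ 2).
Proof. by move=> /error_split[]. Qed.

Lemma error_recursion (x : R) (y e e' : 'rV[R]_d) : 2^-1 <= x <= 1 ->
  e = u a - y -> e' = u (a + h) - Phi F a h x y ->
  edot e' e' <= (1 + h * growth_rate d A) * edot e e
    + 2 * (\sum_i e 0 i * unbiased_part F u a h p x 0 i)
    + error_rate d A * (h ^+ 4 * eps ^+ 2).
Proof.
move=> x12 eE eE'; have [rB rhoB] := error_split x12; have /andP[x1 x2] := x12.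
have x01 : 0 <= x <= 1 by rewrite x2 (le_trans _ x1)// invr_ge0.
set rho := unbiased_part F u a h p x in rB rhoB *.
set r := _ - rho in rB.
have := Phi_lipschitz A1 h0 hA FBA FL a (u a) y x01 x01; rewrite -eE (subrr x) (@normr0 R R) add0r.
set D := _ - e; move=> DB.
have A0 : 0 <= A by apply: le_trans A1.
have e'E i : e' 0 i = e 0 i + D 0 i + rho 0 i + r 0 i.
  by rewrite eE' /D /r !mxE; ring.
pose lip := A * (3 + 5 * A).
have h1 : 0 < h <= 1.
  have hhA : h <= h * A by rewrite ler_peMr// ltW.
  by rewrite h0 (le_trans hhA)// (le_trans hA)// invf_le1// ler1n.
have step i : e' 0 i ^+ 2 <= e 0 i ^+ 2 + 2 * (e 0 i * rho 0 i) +
   h * (2 * lip + 1 + 3 * lip ^+ 2) * `|e| ^+ 2 + 7 * local_error_const A ^+ 2 * (h ^+ 4 * eps ^+ 2).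
  rewrite e'E; apply: squared_error_step => //.
  - exact: coord_le_norm.
  - by rewrite mulr_ge0 ?addr_ge0 ?mulr_ge0.
  - exact: local_error_const_ge0.
  - by apply: le_trans heps; exact: ltW.
  - exact: le_trans (coord_le_norm D i) DB.
  - exact: le_trans (coord_le_norm rho i) rhoB.
  - exact: le_trans (coord_le_norm r i) rB.
have ne : `|e| ^+ 2 <= edot e e.
  rewrite -enorm_sqr lerXn2r ?nnegrE ?enorm_ge0//.
  by apply: norm_le_coord => [|i]; [exact: enorm_ge0|exact: coord_le_enorm].
have -> : edot e' e' = \sum_i e' 0 i ^+ 2 by apply: eq_bigr => i _; rewrite expr2.
apply: (le_trans (ler_sum _ (fun i _ => step i))).
rewrite sum_quadratic_step.
have -> : \sum_i e 0 i ^+ 2 = edot e e by apply: eq_bigr => i _; rewrite expr2.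
have k0 : 0 <= h * growth_rate d A by rewrite mulr_ge0 ?growth_rate_ge0// ltW.
have := ler_wpM2l k0 ne; rewrite /error_rate /growth_rate -/lip.
move: (edot e e) (`|e| ^+ 2) (\sum_(i < d) _) => X Y Z.
by move: (2 * lip + 1 + 3 * lip ^+ 2) (local_error_const A ^+ 2) (h ^+ 4 * eps ^+ 2) => W V U; lra.
Qed.

End error_recursion.

Section adapted_scheme.
Context {R : realType} {disp : measure_display} {Om : measurableType disp}.
Variables (P : probability Om R) (Fl : nat -> set (set Om)) (xi : nat -> {RV P >-> R}).
Hypothesis HX : assumption_X Fl xi.

(** Turns measurability with respect to a sub-sigma-algebra into measurability on
    another measurable type. *)
Lemma measurable_sub_sigma (G : set (set Om)) (X : Om -> R) : sigma_algebra setT G ->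
  measurable_fun [set: g_sigma_algebraType G] X <->
  (forall B, measurable B -> G (X @^-1` B)).
Proof.
move=> sG; have mE : (@measurable _ (g_sigma_algebraType G)) = G by exact: sigma_algebra_id.
split => [mX B mB|H _ B mB]; last by rewrite setTI mE; exact: H.
by have := mX measurableT B mB; rewrite setTI mE.
Qed.

Context {d : nat} (F : R -> 'rV[R]_d -> 'rV[R]_d) (A h : R).
Hypotheses (A1 : 1 <= A) (h0 : 0 < h) (hA : h * A <= 4^-1).
Hypotheses (FB : forall t w, `|F t w| <= A)
  (FL : forall t t' w w', `|F t w - F t' w'| <= A * (`|t - t'| + `|w - w'|)).
Variable u0 : 'rV[R]_d.

(** The samples are clamped to the interval where they lie almost surely, which
    makes the scheme bounded and Lipschitz in them for all outcomes. *)
Definition clamped_scheme (n : nat) (w : Om) : 'rV[R]_d :=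
  sdirk F u0 h (fun m => clamp 2^-1 1 (xi m w)) n.

Let half1 : 2^-1 <= 1 :> R. Proof. by rewrite invf_le1 ?ler1n. Qed.

Let cin (x : R) : 0 <= clamp 2^-1 1 x <= 1.
Proof.
have /andP[c1 ->] := clamp_in x half1; rewrite andbT; apply: le_trans c1.
by rewrite invr_ge0.
Qed.

Lemma clamped_scheme_bounded n w : `|clamped_scheme n w| <= `|u0| + n%:R * (h * A).
Proof.
elim: n => [|n IH]; first by rewrite mul0r addr0.
apply: (le_trans (Phi_bound A1 h0 hA FB FL _ _ (cin _))).
by rewrite -[X in _ <= _ + X * _]natr1 [X in _ <= _ + X]mulrDl mul1r addrA lerD2r.
Qed.

(** A step is a Lipschitz function of the new sample and of the previous iterate. *)
Lemma clamped_scheme_adapted n i B : measurable B ->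
  Fl n ((fun w => clamped_scheme n w 0 i) @^-1` B).
Proof.
have [[sF _ incF _] [_ _ mxi _]] := HX.
suff /(measurable_sub_sigma _ (sF n)) : measurable_fun [set: g_sigma_algebraType (Fl n)]
    (fun w => clamped_scheme n w 0 i) by exact.
elim: n i => [|n IH] i; first exact: measurable_cst.
pose lip := 1 + h * (A * (3 + 5 * A)).
have A0 : 0 <= A by apply: le_trans A1.
have l0 : 0 <= h * (A * (3 + 5 * A)) by rewrite !mulr_ge0 ?addr_ge0 ?mulr_ge0// ltW.
have lip0 : 0 < lip by rewrite ltr_pwDl.
apply: (@measurable_lipschitz R _ (g_sigma_algebraType (Fl n.+1)) d (xi n.+1) (clamped_scheme n)
   (fun x v => Phi F (n%:R * h) h (clamp 2^-1 1 x) v 0 i) lip lip0).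
- by apply/(measurable_sub_sigma _ (sF n.+1)); exact: mxi.
- move=> j; apply/(measurable_sub_sigma _ (sF n.+1)) => C mC; apply: incF.
  by move/(measurable_sub_sigma _ (sF n)) : (IH j); exact.
- move=> r r' z z'.
  set p := Phi _ _ _ _ z; set p' := Phi _ _ _ _ z'.
  have := Phi_lipschitz A1 h0 hA FB FL (n%:R * h) z z' (cin r) (cin r'); rewrite -/p -/p' => H.
  have : `|p 0 i - p' 0 i| <= `|p - p'| by have := coord_le_norm (p - p') i; rewrite !mxE.
  move=> /le_trans; apply; rewrite -[p - p'](subrK (z - z')).
  apply: (le_trans (ler_normD _ _)).
  have cl : `|clamp 2^-1 1 r - clamp 2^-1 1 r'| <= `|r - r'| by exact: clamp_lipschitz.
  have : h * (A * (3 + 5 * A)) * (`|clamp 2^-1 1 r - clamp 2^-1 1 r'| + `|z - z'|) <=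
      h * (A * (3 + 5 * A)) * (`|r - r'| + `|z - z'|) by rewrite ler_wpM2l// lerD2r.
  move=> e1; have -> : lip * (`|r - r'| + `|z - z'|) =
    h * (A * (3 + 5 * A)) * (`|r - r'| + `|z - z'|) + (`|r - r'| + `|z - z'|).
    by rewrite /lip; ring.
  by apply: lerD; [exact: le_trans H e1|rewrite lerDr].
Qed.

Lemma clamped_scheme_measurable n i : measurable_fun setT (fun w => clamped_scheme n w 0 i).
Proof.
have [[_ subF _ _] _] := HX; move=> _ B mB; rewrite setTI.
by apply: (subF n); exact: clamped_scheme_adapted.
Qed.

End adapted_scheme.

Lemma within_lipschitz_comp {R : realType} {d : nat} (F : R -> 'rV[R]_d -> 'rV[R]_d)
    (A : R) (u : R -> 'rV[R]_d) (D : set R) : 0 < A ->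
  (forall t t' w w', `|F t w - F t' w'| <= A * (`|t - t'| + `|w - w'|)) ->
  {within D, continuous u} -> {within D, continuous (fun t => F t (u t))}.
Proof.
move=> A0 FL cu x; apply/cvgrPdist_le => e e0.
have e2 : 0 < e / (2 * A) by rewrite divr_gt0 ?mulr_gt0.
have cid : {within D, continuous (@id R)} by apply: continuous_subspaceT => t; exact: cvg_id.
have /cvgrPdist_le/(_ _ e2) n1 := cu x.
have /cvgrPdist_le/(_ _ e2) n2 := cid x.
near=> t; apply: (le_trans (FL _ _ _ _)).
have -> : e = A * (e / (2 * A) + e / (2 * A)) by field; rewrite gt_eqF.
by rewrite ler_pM2l// lerD//; near: t.
Unshelve. all: by end_near. Qed.

Section mean_square_step.
Context {R : realType} {disp : measure_display} {Om : measurableType disp}.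
Variables (P : probability Om R) (Fl : nat -> set (set Om)) (xi : nat -> {RV P >-> R}).
Hypothesis HX : assumption_X Fl xi.
Context {d : nat} (F : R -> 'rV[R]_d -> 'rV[R]_d) (u : R -> 'rV[R]_d) (u0 : 'rV[R]_d) (A B h : R).
Hypotheses (A1 : 1 <= A) (BA : B <= A) (h0 : 0 < h) (hA : h * A <= 4^-1).
Hypotheses (FB : forall t w, `|F t w| <= B)
  (FL : forall t t' w w', `|F t w - F t' w'| <= A * (`|t - t'| + `|w - w'|)).

Local Notation Y := (clamped_scheme xi F h u0).

Definition scheme_error (n : nat) (w : Om) : 'rV[R]_d := u (n%:R * h) - Y n w.

Definition mean_square (n : nat) : R :=
  \int[P]_w edot (scheme_error n w) (scheme_error n w).

Let FBA t w : `|F t w| <= A. Proof. exact: le_trans (FB t w) BA. Qed.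

Lemma scheme_error_measurable n i : measurable_fun setT (fun w => scheme_error n w 0 i).
Proof.
have -> : (fun w => scheme_error n w 0 i) = (fun w => u (n%:R * h) 0 i - Y n w 0 i).
  by apply/funext => w; rewrite !mxE.
by apply: measurable_funB => //; exact: (clamped_scheme_measurable HX A1 h0 hA FBA FL).
Qed.

Let bound n : R := `|u (n%:R * h)| + (`|u0| + n%:R * (h * A)).

Lemma scheme_error_bounded n i w : `|scheme_error n w 0 i| <= bound n.
Proof.
apply: (le_trans (coord_le_norm _ _)); apply: (le_trans (ler_normB _ _)).
by rewrite lerD2l; exact: (clamped_scheme_bounded _ A1 h0 hA FBA FL).
Qed.

Lemma edot_scheme_error_measurable n :
  measurable_fun setT (fun w => edot (scheme_error n w) (scheme_error n w)).
Proof.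
by apply: measurable_sum => i; apply: measurable_funM; exact: scheme_error_measurable.
Qed.

Lemma edot_scheme_error_integrable n :
  P.-integrable setT (EFin \o (fun w => edot (scheme_error n w) (scheme_error n w))).
Proof.
apply: (@bounded_integrable _ _ _ _ _ (\sum_(i < d) bound n * bound n)).
  exact: edot_scheme_error_measurable.
move=> w; apply: (le_trans (ler_norm_sum _ _ _)); apply: ler_sum => i _.
by rewrite normrM ler_pM// scheme_error_bounded.
Qed.

Section step.
Context (n : nat) (eps : R) (c : 'rV[R]_d) (J : 'M[R]_d).
Local Notation a := (n%:R * h).
Hypotheses (heps : h <= eps) (epsA : eps <= A).
Hypotheses (cu : {within `[a, a + h], continuous u})
  (du : forall t, a < t < a + h -> is_derive t 1 u (F t (u t))).
Hypotheses (cB : `|c| <= A) (JB : forall w : 'rV[R]_d, `|w *m J| <= A * `|w|).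
Hypothesis FA : forall t t' w w', a <= t <= a + h -> a <= t' <= a + h ->
  `|w - u a| <= 2 * (B * h) -> `|w' - u a| <= 2 * (B * h) ->
  `|F t w - F t' w' - ((t - t') *: c + (w - w') *m J)| <= eps * (`|t - t'| + `|w - w'|).

Let p := (c + F a (u a) *m J) *m J.
Let g i y := unbiased_part F u a h p (clamp 2^-1 1 y) 0 i.
Let Cg := local_error_const A * (eps * h ^+ 2).

Let half1 : 2^-1 <= 1 :> R. Proof. by rewrite invf_le1 ?ler1n. Qed.

Let gE i y : g i y =
  quadrature_defect (fun t => u t 0 i) (fun t => F t (u t) 0 i) a h (p 0 i) (clamp 2^-1 1 y).
Proof. by rewrite /g /unbiased_part /quadrature_defect !mxE; ring. Qed.

Let g_bounded i y : `|g i y| <= Cg.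
Proof.
apply: (le_trans (coord_le_norm _ _)).
apply: (unbiased_part_bound A1 BA h0 hA heps epsA FB FL cu du cB JB FA).
exact: clamp_in.
Qed.

Let A0 : 0 < A. Proof. exact: lt_le_trans A1. Qed.

Let cw' i : {within `[a, a + h], continuous (fun t => F t (u t) 0 i)}.
Proof.
apply: (@within_coord _ _ (fun t => F t (u t))).
exact: (within_lipschitz_comp A0 FL cu).
Qed.

Let g_continuous i : continuous (g i).
Proof.
rewrite (_ : g i = fun y => quadrature_defect (fun t => u t 0 i) (fun t => F t (u t) 0 i) a h
  (p 0 i) (clamp 2^-1 1 y)); last by apply/funext => y; exact: gE.
exact: continuous_quadrature_defect.
Qed.

Let mxi : measurable_fun [set: Om] (xi n.+1 : Om -> measurableTypeR R).
Proof. exact: (@measurable_funPT _ _ _ _ (xi n.+1)). Qed.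

Let cross_term i : \int[P]_w (scheme_error n w 0 i * g i (xi n.+1 w)) = 0.
Proof.
have [_ [_ law _ indep]] := HX.
pose X : {mfun Om >-> R} := MeasurableFun.Pack (MeasurableFun.Class
  (isMeasurableFun.Build _ _ _ _ _ (scheme_error_measurable n i))).
pose Z : {mfun Om >-> measurableTypeR R} := MeasurableFun.Pack (MeasurableFun.Class
  (isMeasurableFun.Build _ _ _ _ _ mxi)).
apply: (@independent_centered _ _ _ P _ _ X Z (g i) (Num.max (bound n) Cg)).
- by apply: continuous_measurable_fun; exact: g_continuous.
- by move=> w; rewrite le_max scheme_error_bounded.
- by move=> y; rewrite le_max g_bounded orbT.
- move=> B1 B2 mB1 mB2; apply: (indep n) => //.
  have -> : X @^-1` B1 = (fun w => Y n w 0 i) @^-1` [set y | B1 (u a 0 i - y)].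
    by apply/seteqP; split => w /=; rewrite /X /= /scheme_error !mxE.
  apply: (clamped_scheme_adapted HX A1 h0 hA FBA FL).
  have mm : measurable_fun [set: R] (fun y => u a 0 i - y) by exact: measurable_funB.
  by have := mm measurableT B1 mB1; rewrite setTI.
- under eq_integral => y _ do rewrite gE.
  apply: (@quadrature_defect_centered _ _ _ P Z _ _ a h (p 0 i) Cg) => //.
  + exact: within_coord.
  + by move=> t tab; apply: is_derive_coord; exact: du.
  + by move=> x x12; have := g_bounded i x; rewrite gE clamp_id.
  + by move=> B2 mB2; exact: law.
Qed.

(** The new sample is independent of the past, hence of [scheme_error n], and
    [unbiased_part] is centered: only the square of the local error survives. *)
Lemma mean_square_step :
  mean_square n.+1 <= (1 + h * growth_rate d A) * mean_square n
    + error_rate d A * (h ^+ 4 * eps ^+ 2).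
Proof.
have icross i : P.-integrable setT
    (EFin \o (fun w => scheme_error n w 0 i * g i (xi n.+1 w))).
  apply: (@bounded_integrable _ _ _ _ _ (bound n * Cg)).
    apply: measurable_funM; first exact: scheme_error_measurable.
    apply: (@measurableT_comp _ _ _ _ _ _ (g i)) => //.
    by apply: continuous_measurable_fun; exact: g_continuous.
  by move=> w; rewrite normrM ler_pM// ?scheme_error_bounded.
pose G := 1 + h * growth_rate d A.
pose e2 w := edot (scheme_error n w) (scheme_error n w).
pose cr w := \sum_i scheme_error n w 0 i * g i (xi n.+1 w).
have icr : P.-integrable setT (EFin \o cr).
  rewrite (_ : EFin \o cr = fun w => (\sum_i (scheme_error n w 0 i * g i (xi n.+1 w))%:E)%E).
    by apply: integrable_sum => // i _; exact: icross.
  by apply/funext => w; rewrite /cr /= sumEFin.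
have cr0 : \int[P]_w cr w = 0.
  rewrite /Rintegral (_ : (\int[P]_w (cr w)%:E = 0)%E)//.
  under eq_integral => w _ do rewrite -sumEFin.
  rewrite integral_sum// big1// => i _.
  have fin := integrable_fin_num measurableT (icross i).
  by rewrite -(fineK fin) [X in X%:E](cross_term i).
have ie2 : P.-integrable setT (EFin \o e2) by exact: edot_scheme_error_integrable.
have iGe2 : P.-integrable setT (EFin \o (fun w => G * e2 w)).
  by have := integrableZl measurableT G ie2.
have i2cr : P.-integrable setT (EFin \o (fun w => 2 * cr w)).
  by have := integrableZl measurableT 2 icr.
pose K := error_rate d A * (h ^+ 4 * eps ^+ 2).
have iK : P.-integrable setT (EFin \o (fun _ : Om => K)).
  exact: (@bounded_integrable _ _ _ _ _ `|K|).
have i12 : P.-integrable setT (EFin \o (fun w => G * e2 w + 2 * cr w)).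
  by have := integrableD measurableT iGe2 i2cr.
have i123 : P.-integrable setT (EFin \o (fun w => G * e2 w + 2 * cr w + K)).
  by have := integrableD measurableT i12 iK.
have PT : fine (P setT) = 1 by rewrite probability_setT.
have -> : G * mean_square n + K = \int[P]_w (G * e2 w + 2 * cr w + K).
  have s1 := @RintegralD _ _ _ P setT _ _ measurableT i12 iK.
  have s2 := @RintegralD _ _ _ P setT _ _ measurableT iGe2 i2cr.
  have s3 := @RintegralZl _ _ _ P setT _ G measurableT ie2.
  have s4 := @RintegralZl _ _ _ P setT _ 2 measurableT icr.
  have s5 := @Rintegral_cst _ _ _ P setT measurableT K.
  by rewrite s1 s2 s3 s4 cr0 mulr0 addr0 s5 PT mulr1.
apply: le_Rintegral => //; first exact: edot_scheme_error_integrable.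
move=> w _; apply: (error_recursion A1 BA h0 hA heps epsA FB FL cu du cB JB FA
  (x := clamp 2^-1 1 (xi n.+1 w)) (y := Y n w)) => //.
- exact: clamp_in.
- by rewrite /scheme_error /= -natr1 mulrDl mul1r.
Qed.

End step.
End mean_square_step.

(** * Accumulation of the errors *)

Lemma discrete_gronwall {R : realType} (S q : nat -> R) (G h : R) (N : nat) :
  0 <= G -> 0 <= h -> (forall n, 0 <= q n) -> S 0%N <= 0 ->
  (forall n, (n < N)%N -> S n.+1 <= (1 + h * G) * S n + q n) ->
  forall n, (n <= N)%N -> S n <= expR (G * (n%:R * h)) * \sum_(k < n) q k.
Proof.
move=> G0 h0 q0 S0 step; elim=> [_|n IH nN]; first by rewrite big_ord0 mulr0.
have hG0 : 0 <= h * G by exact: mulr_ge0.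
apply: (le_trans (step n nN)).
have -> : expR (G * (n.+1%:R * h)) = expR (h * G) * expR (G * (n%:R * h)).
  by rewrite -expRD; congr expR; rewrite -natr1; ring.
have E1 : 1 + h * G <= expR (h * G) by exact: expR_ge1Dx.
have En : 1 <= expR (G * (n%:R * h)) by rewrite -expR0 ler_expR !mulr_ge0.
have Q0 : 0 <= \sum_(k < n) q k by exact: sumr_ge0.
rewrite big_ord_recr /= [leRHS]mulrDr; apply: lerD.
  rewrite -mulrA; apply: (@le_trans _ _ ((1 + h * G) * (expR (G * (n%:R * h)) * \sum_(k < n) q k))).
    by rewrite ler_wpM2l ?addr_ge0// IH// ltnW.
  by rewrite ler_wpM2r// mulr_ge0// expR_ge0.
rewrite -[leLHS]mul1r ler_wpM2r// -[leLHS]mulr1 ler_pM//.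
by rewrite (le_trans _ E1)// lerDl.
Qed.

(** The factor of [truncated_almost_affine] for windows of radius [2 L h]; the
    term 1 keeps its product with [E] above the step size. *)
Definition window_const {R : realType} (d : nat) (L : R) : R :=
  (1 + d%:R) * (L * (1 + 2 * L)) + 1.

(** A common bound for all constants of the truncated field. *)
Definition field_const {R : realType} (d : nat) (nu L : R) : R :=
  1 + (1 + d%:R) * L + window_const d L * L + `|nu|.

Definition small_step_const {R : realType} (d : nat) (T nu L : R) : R :=
  let A := field_const d nu L in
  expR (growth_rate d A * T) * (error_rate d A * (window_const d L ^+ 2 * L)).

Section small_steps.
Context {R : realType} {disp : measure_display} {Om : measurableType disp}.
Variables (P : probability Om R) (Fl : nat -> set (set Om)) (xi : nat -> {RV P >-> R}).
Hypothesis HX : assumption_X Fl xi.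
Context {d : nat} (T nu : R) (f : R -> 'rV[R]_d -> 'rV[R]_d) (K L : R) (E : R -> R -> R).
Hypotheses (T0 : 0 < T) (K0 : 0 <= K) (reg : regular_on T f K L E).
Context (u0 : 'rV[R]_d) (u : R -> 'rV[R]_d) (h : R) (N : nat).
Hypotheses (sol : is_solution T f u0 u) (uK : forall t : R, 0 <= t <= T -> `|u t| + 1 <= K).
Local Notation A := (field_const d nu L).
Local Notation kap := (window_const d L).
Hypotheses (hA : h * A <= 4^-1) (N0 : (0 < N)%N) (NT : N%:R * h = T).
Local Notation F := (truncated T f K).

Let L0 : 0 <= L. Proof. by case: reg. Qed.

Let h0 : 0 < h.
Proof. by rewrite -(pmulr_rgt0 _ (_ : 0 < N%:R)) ?NT// ltr0n. Qed.

Lemma window_const_ge1 : 1 <= kap.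
Proof. by rewrite lerDr !mulr_ge0 ?addr_ge0 ?mulr_ge0. Qed.

Let dL0 : 0 <= (1 + d%:R) * L. Proof. by rewrite mulr_ge0 ?addr_ge0. Qed.

Let kL0 : 0 <= kap * L.
Proof. by rewrite mulr_ge0// (le_trans ler01)// window_const_ge1. Qed.

Lemma field_const_ge : [/\ 1 <= A, (1 + d%:R) * L <= A, kap * L <= A & nu <= A].
Proof.
have := ler_norm nu; have := normr_ge0 nu; rewrite /field_const.
move: ((1 + d%:R) * L) (kap * L) dL0 kL0 => X Y X0 Y0 n0 n1; split; lra.
Qed.

Let LA : L <= A.
Proof.
have [_ h1 _ _] := field_const_ge; apply: le_trans h1.
by rewrite mulrDl mul1r lerDl mulr_ge0.
Qed.

Let FL t t' w w' : `|F t w - F t' w'| <= A * (`|t - t'| + `|w - w'|).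
Proof.
have [_ h1 _ _] := field_const_ge.
apply: (le_trans (truncated_lipschitz T0 K0 reg t t' w w')).
by rewrite ler_wpM2r// addr_ge0.
Qed.

(** The local errors are square-summable with the sum of [window_size ^ 2] of order
    [h], which gives the fifth power. *)
Lemma mean_square_small n : (n <= N)%N ->
  mean_square xi F u u0 h n <= small_step_const d T nu L * h ^+ 5.
Proof.
move=> nN; have [A1 dLA kLA nuA] := field_const_ge.
have hp := ltW h0.
have [_ _ _ [Ebd Esum] _] := reg.
pose eps k := kap * E (k%:R * h) (k.+1%:R * h).
have kap1 := window_const_ge1.
have k0 : 0 <= kap by apply: le_trans kap1.
have FB := truncated_bound T0 K0 reg.
have A0 : 0 <= A by apply: le_trans A1.
have S0 : mean_square xi F u u0 h 0 <= 0.
  have [u00 _ _] := sol.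
  rewrite /mean_square /scheme_error mul0r u00 /clamped_scheme /= subrr.
  rewrite /Rintegral (_ : edot 0 0 = 0) ?integral0//.
  by rewrite /edot big1// => i _; rewrite mxE mul0r.
have stepn k : (k < N)%N -> mean_square xi F u u0 h k.+1 <=
    (1 + h * growth_rate d A) * mean_square xi F u u0 h k
    + error_rate d A * (h ^+ 4 * eps k ^+ 2).
  move=> kN; pose a := k%:R * h.
  have a0 : 0 <= a by exact: mulr_ge0.
  have ahE : k.+1%:R * h = a + h by rewrite -natr1 mulrDl mul1r.
  have ahT : a + h <= T by rewrite -ahE -NT ler_wpM2r// ler_nat.
  have tT t : a <= t <= a + h -> 0 <= t <= T.
    by move=> /andP[t1 t2]; rewrite (le_trans a0 t1) (le_trans t2 ahT).
  have ab : a < a + h by rewrite ltrDl.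
  have /andP[E1 E2] := Ebd a (a + h) a0 ab ahT; rewrite addrAC subrr add0r in E1.
  have uT t : 0 <= t <= T -> `|u t| <= K.
    by move=> /uK; apply: le_trans; rewrite lerDl.
  have r0 : 0 <= 2 * (L * h) by rewrite !mulr_ge0.
  have ur : `|u a| + 2 * (L * h) <= K.
    apply: le_trans (uK (tT a _)); last by rewrite lexx ltW.
    rewrite lerD2l; have : L * h <= h * A by rewrite mulrC ler_wpM2l.
    by move: (L * h) (h * A) hA => X Y; lra.
  have [c [J [cB JB FA]]] := truncated_almost_affine reg a0 h0 ahT r0 ur.
  have heps : h <= eps k.
    by rewrite /eps ahE; apply: (le_trans E1); rewrite ler_peMl// (le_trans hp).
  have epsA : eps k <= A by rewrite /eps ahE; apply: le_trans kLA; rewrite ler_wpM2l.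
  have [_ cu du] := sol.
  apply: (mean_square_step (B := L) HX u0 A1 LA h0 hA FB FL (eps := eps k) (c := c) (J := J)) => //.
  - apply: continuous_subspaceW cu => t /=; rewrite !in_itv /=; exact: tT.
  - move=> t /andP[t1 t2]; rewrite truncated_id//; last 2 first.
      by apply: tT; rewrite !ltW.
      by apply: uT; apply: tT; rewrite !ltW.
    by apply: du; rewrite in_itv /= (le_lt_trans a0 t1) (lt_le_trans t2 ahT).
  - exact: le_trans cB LA.
  - move=> w; apply: (le_trans (JB w)); rewrite ler_wpM2r//; apply: le_trans dLA.
    by rewrite mulrDl lerDr mul1r.
  - move=> t t' w w' t1 t2 w1 w2; apply: (le_trans (FA _ _ _ _ t1 t2 w1 w2)).
    rewrite ler_wpM2r ?addr_ge0// /eps ahE ler_wpM2r ?(le_trans hp)//.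
    rewrite (_ : 2 * (L * h) / h = 2 * L); last by field; rewrite gt_eqF.
    by rewrite /window_const lerDl.
have Gr0 := growth_rate_ge0 d A0.
have er0 : 0 <= error_rate d A.
  by rewrite /error_rate mulr_ge0 ?sqr_ge0// mulr_ge0.
have q0 k : 0 <= error_rate d A * (h ^+ 4 * eps k ^+ 2).
  by rewrite mulr_ge0// mulr_ge0 ?sqr_ge0// exprn_ge0.
apply: (le_trans (discrete_gronwall Gr0 hp q0 S0 stepn nN)).
rewrite /small_step_const -[leRHS]mulrA -[X in _ <= _ * X]mulrA; apply: ler_pM.
- exact: expR_ge0.
- by apply: sumr_ge0 => k _.
- rewrite ler_expR ler_wpM2l// -NT ler_wpM2r// ler_nat//.
have widen : \sum_(k < n) error_rate d A * (h ^+ 4 * eps k ^+ 2) <=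
    \sum_(k < N) error_rate d A * (h ^+ 4 * eps k ^+ 2).
  by rewrite (big_ord_widen _ (fun k => error_rate d A * (h ^+ 4 * eps k ^+ 2)) nN)
    big_mkcond /=; apply: ler_sum => k _; case: ifP.
apply: (le_trans widen); rewrite -!mulr_sumr ler_wpM2l//.
have -> : \sum_(k < N) eps k ^+ 2 = kap ^+ 2 * \sum_(k < N) E (k%:R * h) (k.+1%:R * h) ^+ 2.
  by rewrite mulr_sumr; apply: eq_bigr => k _; rewrite /eps exprMn.
have := Esum N h N0 NT; move=> H.
have -> : kap ^+ 2 * L * h ^+ 5 = h ^+ 4 * (kap ^+ 2 * (h * L)) by ring.
by rewrite !ler_wpM2l ?exprn_ge0.
Qed.

End small_steps.

Section expectations.
Import HBNNSimple.
Context {R : realType} {disp : measure_display} {Om : measurableType disp}.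
Variable P : probability Om R.

(** For large steps the stages need not depend measurably on the samples, so that
    the expectation is bounded through the simple functions that define it. *)
Lemma expectation_le_cst (X : Om -> R) (c : R) : (forall w, 0 <= X w <= c) ->
  ('E_P[X] <= c%:E)%E.
Proof.
move=> Xc; rewrite unlock /= ge0_integralTE; last first.
  by move=> w; rewrite lee_fin; case/andP: (Xc w).
apply: ge_ereal_sup => _ [g /= gX <-]; rewrite -integralT_nnsfun.
apply: (@le_trans _ _ (\int[P]_w (cst c%:E) w)%E).
  apply: ge0_le_integral => //.
  - by move=> w _; rewrite lee_fin; exact: fun_ge0.
  - exact/measurable_EFinP.
  - by move=> w _; apply: (le_trans (gX w)); rewrite lee_fin; case/andP: (Xc w).
have PT : P setT = 1%E by exact: probability_setT.
by rewrite integral_cst//= PT mule1.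
Qed.

(** On a complete space, changing a random variable on a null set affects
    neither its measurability nor its expectation. *)
Lemma expectation_ae (X Z : Om -> R) :
  (forall A, P.-negligible A -> measurable A) ->
  measurable_fun setT Z -> P.-negligible [set w | X w != Z w] ->
  ('E_P[X] = \int[P]_w (Z w)%:E)%E.
Proof.
move=> comp mZ nXZ.
have mX : measurable_fun setT X.
  move=> _ B mB; rewrite setTI; set D := [set w | X w != Z w] in nXZ.
  have -> : X @^-1` B = (Z @^-1` B `\` D) `|` (X @^-1` B `&` D).
    apply/seteqP; split => w /=.
      move=> XB; case: (boolP (X w == Z w)) => [/eqP e|ne]; [left|by right].
      by split; [rewrite -e|rewrite /D /= e eqxx].
    case=> [[ZB nD]|[]//]; suff -> : X w = Z w by [].
    by apply/eqP; move: nD; rewrite /D /=; case: eqP.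
  apply: measurableU.
    apply: measurableD; last exact: comp.
    by have := mZ measurableT B mB; rewrite setTI.
  by apply: comp; apply: negligibleS nXZ => w [].
rewrite unlock; apply: ae_eq_integral => //; [exact/measurable_EFinP|exact/measurable_EFinP|].
apply: negligibleS nXZ => w /= H; apply/negP => /eqP XZ; apply: H => _.
by rewrite /= XZ.
Qed.

End expectations.

Lemma continuous_edot {R : realType} {d : nat} : continuous (fun v : 'rV[R]_d => edot v v).
Proof.
apply: continuous_big => [|i _]; first exact: add_continuous.
by move=> v; apply: continuousM; exact: coord_continuous.
Qed.

Section solution_bound.
Context {R : realType} {d : nat} (T nu : R) (f : R -> 'rV[R]_d -> 'rV[R]_d) (m : R).
Hypotheses (f0 : forall (t : R) i, 0 <= t <= T -> `|f t 0 0 i| <= m).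
Hypothesis osl : forall (t : R) v w, t \in `[0, T] ->
  edot (f t v - f t w) (v - w) <= nu * enorm (v - w) ^+ 2.

Definition solution_bound (a : R) : R :=
  expR ((2 * `|nu| + 1) * T) * (a ^+ 2 + d%:R * m ^+ 2).

(** The energy [|u|^2 + d m^2], damped by [exp (- c t)], decreases. *)
Lemma solution_bounded (u0 : 'rV[R]_d) (u : R -> 'rV[R]_d) (t : R) :
  is_solution T f u0 u -> 0 <= t <= T -> enorm (u t) ^+ 2 <= solution_bound (enorm u0).
Proof.
move=> [u00 cu du] /andP[t0 tT].
pose c : R := 2 * `|nu| + 1; pose Q : R := d%:R * m ^+ 2.
have Q0 : 0 <= Q by rewrite mulr_ge0 ?sqr_ge0.
have c0 : 0 <= c by rewrite addr_ge0 ?mulr_ge0.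
suff H : (edot (u t) (u t) + Q) * expR (- c * t) <= edot u0 u0 + Q.
  rewrite enorm_sqr /solution_bound enorm_sqr -/c -/Q.
  have e0 : 0 < expR (c * t) by exact: expR_gt0.
  have : edot (u t) (u t) + Q <= expR (c * t) * (edot u0 u0 + Q).
    rewrite -(ler_pM2l e0) in H; apply: le_trans H.
    by rewrite mulrCA -expRD mulNr subrr expR0 mulr1.
  have : expR (c * t) * (edot u0 u0 + Q) <= expR (c * T) * (edot u0 u0 + Q).
    by rewrite ler_wpM2r ?addr_ge0 ?edot_ge0// ler_expR ler_wpM2l.
  by move: (expR _ * _) (expR _ * _) => X Z; lra.
move: t0; rewrite le_eqVlt => /predU1P[<-|t0].
  by rewrite u00 mulr0 expR0 mulr1.
pose W s : R := (edot (u s) (u s) + Q) * expR (- c * s).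
pose W' s : R := (2 * edot (f s (u s)) (u s) - c * (edot (u s) (u s) + Q)) * expR (- c * s).
have sin (s : R) : 0 < s < t -> 0 < s < T by move=> /andP[-> st]; exact: lt_le_trans tT.
have dW (s : R) : s \in `]0, t[ -> is_derive s 1 W (W' s).
  rewrite in_itv /= => /sin; rewrite -[_ && _]/(s \in `]0, T[) => sT.
  have di i := is_derive_coord i (du s sT).
  have dmul i : is_derive s 1 (fun s => u s 0 i * u s 0 i) (2 * (f s (u s) 0 i * u s 0 i)).
    have d1 := di i.
    by apply: is_derive_eq; rewrite /GRing.scale /=; ring.
  have dsum : is_derive s 1 (fun s => edot (u s) (u s)) (2 * edot (f s (u s)) (u s)).
    have := is_derive_sum dmul; rewrite -mulr_sumr.
    by congr (is_derive _ _ _ _); apply/funext => r; rewrite fct_sumE.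
  have dlin : is_derive s 1 (fun s : R => - c * s) (- c).
    by apply: is_derive_eq; rewrite /GRing.scale /=; ring.
  have dexp := @is_derive1_comp R expR (fun s : R => - c * s) s _ _ (is_derive_expR _) dlin.
  have dQ : is_derive s 1 (fun s => edot (u s) (u s) + Q) (2 * edot (f s (u s)) (u s)).
    by apply: is_derive_eq; rewrite addr0.
  have dd := is_deriveM dQ dexp.
  apply: (is_derive_eq (dd : is_derive s 1 W _)).
  by rewrite /W' /GRing.scale /=; ring.
have cW : {within `[0, t], continuous W}.
  have cut : {within `[0, t], continuous u}.
    apply: continuous_subspaceW cu => s /=; rewrite !in_itv /= => /andP[-> st].
    exact: le_trans tT.
  have ce : {within `[0, t], continuous (fun s => expR (- c * s))}.
    apply: continuous_subspaceT => s; apply/differentiable_continuous/derivable1_diffP.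
    exact: ex_derive.
  have cedot : {within `[0, t], continuous (fun s => edot (u s) (u s))}.
    move=> s; apply: (@continuous_comp _ _ _ (u : subspace `[0, t] -> _) (fun v : 'rV[R]_d => edot v v)).
      exact: cut.
    exact: continuous_edot.
  move=> s; apply: (@continuousM _ (subspace `[0, t]) (fun s => edot (u s) (u s) + Q) (fun s => expR (- c * s))).
    by apply: (@continuousD _ _ (subspace `[0, t]) (fun s => edot (u s) (u s)) (fun _ => Q));
      [exact: cedot|exact: cvg_cst].
  exact: ce.
have [s st E] := MVT t0 dW cW.
have W0 : W 0 = edot u0 u0 + Q by rewrite /W u00 mulr0 expR0 mulr1.
rewrite -W0 -/(W t) -subr_le0 E; apply: mulr_le0_ge0; last by rewrite subr0 ltW.
rewrite /W'; apply: mulr_le0_ge0; last exact: expR_ge0.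
move: st; rewrite in_itv /= => /sin /andP[s0 sT].
have sT' : 0 <= s <= T by rewrite !ltW.
have := @osl s (u s) 0; rewrite in_itv subr0 enorm_sqr => /(_ sT') H1.
have fE : edot (f s (u s)) (u s) = edot (f s (u s) - f s 0) (u s) + edot (f s 0) (u s).
  rewrite /edot -big_split /=; apply: eq_bigr => i _; rewrite !mxE; ring.
have H2 : 2 * edot (f s 0) (u s) <= Q + edot (u s) (u s).
  have -> : Q = \sum_(i < d) m ^+ 2 by rewrite sumr_const card_ord /Q mulr_natl.
  rewrite /edot mulr_sumr -big_split /=; apply: ler_sum => i _.
  have : 0 <= (f s 0 0 i - u s 0 i) ^+ 2 by exact: sqr_ge0.
  have : f s 0 0 i ^+ 2 <= m ^+ 2.
    by rewrite -[leLHS]real_normK ?num_real// lerXn2r ?nnegrE ?(le_trans _ (f0 i sT'))// f0.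
  by rewrite !expr2; lra.
have H3 : nu * edot (u s) (u s) <= `|nu| * edot (u s) (u s).
  by rewrite ler_wpM2r ?edot_ge0// ler_norm.
have H4 : 0 <= `|nu| * Q by exact: mulr_ge0.
have -> : c * (edot (u s) (u s) + Q) = 2 * (`|nu| * edot (u s) (u s)) + 2 * (`|nu| * Q) + edot (u s) (u s) + Q.
  by rewrite /c; ring.
by rewrite fE; lra.
Qed.

End solution_bound.

Section almost_sure_samples.
Context {R : realType} {disp : measure_display} {Om : measurableType disp}.
Variables (P : probability Om R) (Fl : nat -> set (set Om)) (xi : nat -> {RV P >-> R}).
Hypothesis HX : assumption_X Fl xi.

Lemma samples_in_range :
  P.-negligible (\bigcup_m [set w | ~~ (2^-1 <= xi m.+1 w <= 1)]).
Proof.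
have [_ [_ law _ _]] := HX.
apply: negligible_bigcup => m.
pose I : set R := `[2^-1, 1]%classic.
have mI : measurable I by exact: measurable_itv.
have mxI : measurable (xi m.+1 @^-1` I).
  by have := @measurable_funPT _ _ _ _ (xi m.+1) measurableT I mI; rewrite setTI.
have PI : P (xi m.+1 @^-1` I) = 1%E.
  rewrite law// /uniform_prob; apply: integral_uniform_pdf1 => //; exact: half_lt1.
have -> : [set w | ~~ (2^-1 <= xi m.+1 w <= 1)] = ~` (xi m.+1 @^-1` I).
  by apply/seteqP; split => w /=; rewrite /I /= in_itv /= => /negP.
apply/negligibleP; first exact: measurableC.
transitivity (1 - P (xi m.+1 @^-1` I))%E; first exact: probability_setC.
by rewrite PI subee.
Qed.

Context {d : nat} (T nu : R) (f : R -> 'rV[R]_d -> 'rV[R]_d) (K L : R) (E : R -> R -> R).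
Hypotheses (T0 : 0 < T) (K0 : 0 <= K) (reg : regular_on T f K L E).
Hypothesis osl : forall (t : R) v w, t \in `[0, T] ->
  edot (f t v - f t w) (v - w) <= nu * enorm (v - w) ^+ 2.
Context (u0 : 'rV[R]_d) (u : R -> 'rV[R]_d) (h : R) (N : nat).
Hypotheses (sol : is_solution T f u0 u) (uK : forall t : R, 0 <= t <= T -> `|u t| + 1 <= K).
Hypotheses (hA : h * field_const d nu L <= 4^-1) (N0 : (0 < N)%N) (NT : N%:R * h = T).
Hypothesis sK : forall m w, (m <= N)%N -> `|sdirk f u0 h (fun k => xi k w) m| + 1 <= K.

(** Almost surely the samples lie in [1/2, 1], where [sdirk f] and the clamped scheme
    of the truncated field agree. *)
Lemma small_step_error n : (n <= N)%N ->
  ('E_P[fun w => (enorm (u (n%:R * h) - sdirk f u0 h (fun k => xi k w) n) ^+ 2)%R] <=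
    (small_step_const d T nu L * h ^+ 5)%:E)%E.
Proof.
move=> nN; have [A1 dLA kLA nuA] := field_const_ge nu reg.
have h0 : 0 < h by rewrite -(pmulr_rgt0 _ (_ : 0 < N%:R)) ?NT// ltr0n.
have L0 : 0 <= L by case: reg.
have LA : L <= field_const d nu L.
  by apply: le_trans dLA; rewrite mulrDl mul1r lerDl mulr_ge0.
have FL t t' w w' : `|truncated T f K t w - truncated T f K t' w'| <=
    field_const d nu L * (`|t - t'| + `|w - w'|).
  apply: (le_trans (truncated_lipschitz T0 K0 reg t t' w w')).
  by rewrite ler_wpM2r// addr_ge0.
have FB := truncated_bound T0 K0 reg.
pose Z w := edot (scheme_error xi (truncated T f K) u u0 h n w) (scheme_error xi (truncated T f K) u u0 h n w).
have mZ : measurable_fun setT Z.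
  exact: (edot_scheme_error_measurable HX u u0 A1 LA h0 hA FB FL n).
have iZ : P.-integrable setT (EFin \o Z).
  exact: (edot_scheme_error_integrable HX u u0 A1 LA h0 hA FB FL n).
have [[_ subF _ nullF] _] := HX.
rewrite (@expectation_ae _ _ _ P _ Z) //.
- rewrite -(fineK (integrable_fin_num measurableT iZ)) lee_fin.
  exact: (mean_square_small HX T0 K0 reg sol uK hA N0 NT nN).
- by move=> B nB; apply: (subF 0%N); exact: nullF.
- apply: negligibleS samples_in_range => w /=.
  move=> ne; apply: contrapT => nw; move/negP: ne; apply; apply/eqP.
  rewrite /Z enorm_sqr /scheme_error /clamped_scheme.
  rewrite (sdirk_truncated T0 K0 reg A1 dLA nuA h0 hA osl (x := fun k => xi k w) NT _ _ nN)//.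
    by move=> m; apply: contrapT => /negP bad; apply: nw; exists m.
  by move=> m mN; exact: sK.
Qed.

End almost_sure_samples.

(** * The error estimate *)

Lemma enorm_u0_le_Mexact {R : realType} {d : nat} (T nu : R) (f : R -> 'rV[R]_d -> 'rV[R]_d)
    (u0 : 'rV[R]_d) : 0 < T -> enorm u0 <= Mexact T nu f u0.
Proof.
move=> /ltW T0; rewrite /Mexact.
have e1 : 1 <= expR (T * Num.max nu 0).
  by rewrite -expR0 ler_expR mulr_ge0// le_max lexx orbT.
apply: (@le_trans _ _ (expR (T * Num.max nu 0) * enorm u0)).
  by rewrite ler_peMl ?enorm_ge0.
rewrite lerDl; apply: Rintegral_ge0 => t _.
by rewrite mulr_ge0 ?expR_ge0 ?enorm_ge0.
Qed.

Lemma powR_between {R : realType} (h p : R) : 0 < h -> h <= 1 -> 0 <= p <= 5 ->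
  h ^+ 5 <= h `^ p.
Proof.
move=> h0 h1 /andP[p0 p5].
have h01 : 0 < h <= 1 by rewrite h0.
rewrite -(powR_mulrn 5 (ltW h0)); exact: (ger_powR h01 p5).
Qed.

Theorem theorem7p5 (R : realType) :
  exists C2 : R -> R -> R, (forall nu hm, 0 < C2 nu hm) /\
  forall (d : nat) (T nu alpha sigma : R) (f : R -> 'rV[R]_d -> 'rV[R]_d),
    0 < T ->
    (0 < nu -> 0 < alpha < nu^-1) ->
    assumption_R T nu sigma f ->
  exists C : R -> R -> R, (forall a b, 0 < C a b) /\
  forall (u0 : 'rV[R]_d) (u : R -> 'rV[R]_d),
    is_solution T f u0 u ->
  forall (disp : measure_display) (Om : measurableType disp)
    (P : probability Om R) (F : nat -> set (set Om)) (xi : nat -> {RV P >-> R}),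
    assumption_X F xi ->
  forall Mapriori : R,
    (forall (N n : nat) (om : Om),
      (0 < N)%N -> T / N%:R <= hmax T nu alpha -> (n <= N)%N ->
      enorm (sdirk f u0 (T / N%:R) (fun m => xi m om) n) <= Mapriori) ->
  forall N n : nat,
    (0 < N)%N -> T / N%:R <= hmax T nu alpha -> (1 <= n <= N.-1)%N ->
    let h := T / N%:R in
    let e (k : nat) (om : Om) :=
      u (k%:R * h) - sdirk f u0 h (fun m => xi m om) k in
    ('E_P[fun om => (enorm (e n.+1 om) ^+ 2)%R] <=
      (h `^ (4 + 4 * Num.min sigma 4^-1) * C (Mexact T nu f u0) Mapriori *
        expR (C2 nu (hmax T nu alpha) * T))%:E)%E.
Proof.
exists (fun _ _ => 1); split=> [? ?|]; first exact: ltr01.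
move=> d T nu alpha sigma f T0 _ Rf.
have [_ [Df [_ _ osl _ [/andP[sigma0 _] _]]]] := Rf.
pose p : R := 4 + 4 * Num.min sigma 4^-1.
have p05 : 0 <= p <= 5.
  have : Num.min sigma 4^-1 <= 4^-1 by rewrite ge_min lexx orbT.
  have : 0 <= Num.min sigma 4^-1 by rewrite le_min sigma0 /= invr_ge0.
  by rewrite /p; move: (Num.min sigma 4^-1) => q q0 q4; apply/andP; split; lra.
have [m [E0 reg0]] := regularity T0 Rf (lexx 0).
have f0 (t : R) i : 0 <= t <= T -> `|f t 0 0 i| <= m.
  move=> tT; have [_ H _ _ _] := reg0; apply: H => // j.
  by rewrite mxE normr0.
(* The constant is fixed by the bounds [a] on [u0] and [b] on the scheme, before the
   data that satisfy them. *)
have main a b : exists C : R, 0 < C /\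
  forall (u0 : 'rV[R]_d) (u : R -> 'rV[R]_d), is_solution T f u0 u -> enorm u0 <= a ->
  forall (disp : measure_display) (Om : measurableType disp)
    (P : probability Om R) (F : nat -> set (set Om)) (xi : nat -> {RV P >-> R}),
    assumption_X F xi ->
  forall (N n : nat), (0 < N)%N -> (n <= N)%N ->
    (forall (k : nat) (om : Om), (k <= N)%N ->
      enorm (sdirk f u0 (T / N%:R) (fun j => xi j om) k) <= b) ->
    ('E_P[fun om => (enorm (u (n%:R * (T / N%:R)) -
        sdirk f u0 (T / N%:R) (fun j => xi j om) n) ^+ 2)%R] <=
      ((T / N%:R) `^ p * C)%:E)%E.
  pose M := @solution_bound R d T nu m a + 1.
  have M0 : 0 <= M.
    by rewrite addr_ge0// mulr_ge0 ?expR_ge0// addr_ge0 ?sqr_ge0// mulr_ge0 ?sqr_ge0.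
  pose K := M + `|b| + 1.
  have K0 : 0 <= K by rewrite addr_ge0// addr_ge0.
  have [L [E reg]] := regularity T0 Rf K0.
  have [A1 _ _ _] := field_const_ge nu reg.
  set A := field_const d nu L in A1.
  have A0 : 0 < A by apply: lt_le_trans A1.
  have L0 : 0 <= L by case: reg.
  pose Cb := (d%:R * (M + `|b|) + 1) ^+ 2.
  have s0 : 0 <= small_step_const d T nu L.
    rewrite /small_step_const mulr_ge0 ?expR_ge0// mulr_ge0//.
      by rewrite /error_rate mulr_ge0 ?sqr_ge0// mulr_ge0.
    by rewrite mulr_ge0 ?sqr_ge0.
  have c0 : 0 <= Cb * (4 * A) ^+ 5.
    by rewrite mulr_ge0 ?sqr_ge0// exprn_ge0// mulr_ge0// ltW.
  exists (small_step_const d T nu L + Cb * (4 * A) ^+ 5 + 1); split.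
    by rewrite ltr_wpDl ?addr_ge0.
  move=> u0 u sol u0a disp Om P F xi HX N n N0 nN sb.
  set h := T / N%:R.
  have N0' : 0 < N%:R :> R by rewrite ltr0n.
  have h0 : 0 < h by rewrite divr_gt0.
  have NT : N%:R * h = T by rewrite mulrC divfK// gt_eqF.
  have uM (t : R) : 0 <= t <= T -> forall i, `|u t 0 i| <= M.
    move=> tT i; apply: (le_trans (coord_le_enorm _ i)).
    have := solution_bounded f0 osl sol tT.
    have : @solution_bound R d T nu m (enorm u0) <= @solution_bound R d T nu m a.
      rewrite /solution_bound ler_wpM2l ?expR_ge0// lerD2r.
      by rewrite lerXn2r ?nnegrE ?enorm_ge0// (le_trans (enorm_ge0 u0)).
    have : 0 <= (enorm (u t) - 1) ^+ 2 by exact: sqr_ge0.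
    have := enorm_ge0 (u t).
    rewrite /M !expr2; move: (@solution_bound R d T nu m a) (@solution_bound R d T nu m (enorm u0)) (enorm (u t)).
    by move=> X Y Z; lra.
  have sM k om : (k <= N)%N -> forall i, `|sdirk f u0 h (fun j => xi j om) k 0 i| <= `|b|.
    move=> kN i; apply: (le_trans (coord_le_enorm _ i)).
    by apply: (le_trans (sb k om kN)); exact: ler_norm.
  have hp0 : 0 <= h `^ p by exact: powR_ge0.
  (* For larger steps [h ^ p] is bounded below, and the errors are bounded. *)
  have [hA|hA] := leP (h * A) 4^-1.
    have h1 : h <= 1.
      have hhA : h <= h * A by rewrite ler_peMr// ltW.
      by rewrite (le_trans hhA)// (le_trans hA)// invf_le1// ler1n.
    have H := @small_step_error R disp Om P F xi HX d T nu f K L E T0 K0 reg osl u0 u h N sol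
      _ hA N0 NT _ n nN.
    apply: (le_trans (H _ _)).
    - move=> t tT; rewrite /K lerD2r (_ : `|u t| <= M + `|b|)//.
      by rewrite (le_trans (norm_le_coord M0 (uM t tT)))// lerDl.
    - move=> k om kN; rewrite /K lerD2r.
      by rewrite (le_trans (norm_le_coord _ (sM k om kN)))// lerDr.
    rewrite lee_fin mulrC; apply: ler_pM => //; first by rewrite exprn_ge0// ltW.
      exact: powR_between.
    by rewrite -addrA lerDl addr_ge0.
  apply: (@le_trans _ _ Cb%:E).
    apply: expectation_le_cst => om; rewrite sqr_ge0 /=.
    have Mb0 : 0 <= M + `|b| by rewrite addr_ge0.
    have D0 : 0 <= d%:R * (M + `|b|) + 1 by rewrite addr_ge0// mulr_ge0.
    rewrite lerXn2r ?nnegrE ?enorm_ge0//; apply: enorm_le_coord => //.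
    move=> i; rewrite !mxE; apply: (le_trans (ler_normB _ _)); apply: lerD; last exact: sM.
    by apply: uM; have hp := ltW h0; rewrite mulr_ge0//= -NT ler_wpM2r// ler_nat.
  have k0 : 0 < 4 * A by rewrite mulr_gt0.
  have hk : (4 * A)^-1 <= h.
    by rewrite -[_^-1]mul1r ler_pdivrMr// mulrCA -ler_pdivrMl// mulr1 ltW.
  have kp : (4 * A)^-1 ^+ 5 <= h `^ p.
    apply: (@le_trans _ _ ((4 * A)^-1 `^ p)).
      apply: powR_between => //; first by rewrite invr_gt0.
      rewrite invf_le1// (le_trans A1)// ler_peMl ?ler1n// ltW//.
    by case/andP: p05 => p0 _; apply: ge0_ler_powR => //; rewrite nnegrE ltW// invr_gt0.
  rewrite lee_fin; apply: (@le_trans _ _ ((4 * A)^-1 ^+ 5 * (Cb * (4 * A) ^+ 5))).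
    by rewrite mulrCA exprVn mulVf ?mulr1// expf_eq0/= gt_eqF.
  apply: ler_pM => //; first by rewrite exprn_ge0// invr_ge0 ltW.
  by rewrite addrAC lerDr addr_ge0.
have [C hC] := choice (fun ab : R * R => main ab.1 ab.2).
exists (fun a b => C (a, b)); split=> [a b|]; first by have [] := hC (a, b).
move=> u0 u sol disp Om P F xi HX Mapriori apri N n N0 hmaxN nN /=.
have [C0 bnd] := hC (Mexact T nu f u0, Mapriori).
have nN' : (n.+1 <= N)%N.
  by case/andP: nN => _ nN; rewrite -(prednK N0) ltnS.
apply: (le_trans (bnd u0 u sol (enorm_u0_le_Mexact nu f u0 T0) disp Om P F xi HX N n.+1 N0 nN' _)).
  by move=> k om kN; exact: apri.
rewrite lee_fin ler_peMr//; first by rewrite mulr_ge0 ?powR_ge0// ltW.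
by rewrite mul1r -expR0 ler_expR ltW.
Qed.
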